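(* Assume $\mathbb{E} Y_-<\infty$ and $\mathbb{E} Y_+<\infty$. Then $\bar\mu$ satisfies $$\bar\mu(x)=\begin{cases}\min_{a\in\mathbb{R}}\big[\bar\mu(a\mathbf e_2)+\mu_-(x-a\mathbf e_2)\big], & x\in\mathbb H_-,\\ \min_{a\in\mathbb{R}}\big[\bar\mu(a\mathbf e_2)+\mu_+(x-a\mathbf e_2)\big], & x\in\mathbb H_+,\end{cases}$$ (in particular the minima are attained). Moreover $\bar\mu$ is subadditive and positively homogeneous, and $$\overline{\mathcal W}=\text{closed convex hull}\Big[\mathcal W_-\cup\mathcal W_+\cup\{0\}\times\big[-\bar\mu(\mathbf e_2)^{-1},\bar\mu(\mathbf e_2)^{-1}\big]\Big],$$ where $\overline{\mathcal W}=\{x\in\mathbb{R}^2:\bar\mu(x)\le1\}$ (with the convention $0^{-1}=\infty$).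
   Context: Inhomogeneous first-passage percolation on $\mathbb{Z}^2$. Let $F_-$ and $F_+$ be distribution functions of probability measures supported on $[0,\infty)$. Edge weights $(\tau_e)$ on nearest-neighbour edges of $\mathbb{Z}^2$ are independent; $\tau_e\sim F_-$ if at least one endpoint of $e$ has strictly negative first coordinate, and $\tau_e\sim F_+$ otherwise. $T(u,v)$ is the infimum over nearest-neighbour paths from $u$ to $v$ of the sum of edge weights, extended to $\mathbb{R}^2$ by $T(x,y)=T(x',y')$ with $x\in x'+[0,1)^2$, $y\in y'+[0,1)^2$, $x',y'\in\mathbb{Z}^2$. $Y_\pm$ is the minimum of four i.i.d. $F_\pm$ variables. $\bar\mu(x)$ is the almost sure limit of $T(0,nx)/n$ (which exists for every $x$ under $\mathbb{E}Y_\pm<\infty$). For a distribution $F$ on $[0,\infty)$, $T_F$ denotes passage times in the homogeneous environment with i.i.d. $F$ edge weights, and $\mu_F(x)$ is the limit in probability of $T_F(0,nx)/n$ (the time constant; it exists for all $x\in\mathbb{R}^2$ and is a seminorm); $\mu_\pm=\mu_{F_\pm}$. $\mathbf e_1,\mathbf e_2$ are the coordinate vectors. $\mathbb H_-=\{(x_1,x_2):x_1\le0\}$, $\mathbb H_+=\{(x_1,x_2):x_1\ge0\}$, $\mathcal W_-=\{x\in\mathbb H_-:\mu_-(x)\le1\}$, $\mathcal W_+=\{x\in\mathbb H_+:\mu_+(x)\le1\}$. *)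

(* Defs.v *)
From HB Require Import structures.
From mathcomp Require Import all_boot all_order all_algebra.
From mathcomp Require Import all_classical all_reals all_analysis.
Set Implicit Arguments. Unset Strict Implicit. Unset Printing Implicit Defensive.
Import Order.TTheory GRing.Theory Num.Theory.
Import numFieldNormedType.Exports.
Local Open Scope classical_set_scope.
Local Open Scope ring_scope.

Definition vtx := (int * int)%type.

(* Nearest-neighbour edges of Z^2: (u, false) is the edge {u, u + e1},
   (u, true) is the edge {u, u + e2}.  Each edge has exactly one name. *)
Definition edge := (vtx * bool)%type.

Definition edge_ends (e : edge) : vtx * vtx :=
  let: (u, d) := e in
  if d then (u, (u.1, u.2 + 1)) else (u, (u.1 + 1, u.2)).

Definition neg_edge (e : edge) : bool :=
  ((edge_ends e).1.1 < 0) || ((edge_ends e).2.1 < 0).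

Definition adjacent (a b : vtx) : bool :=
  (`|a.1 - b.1| + `|a.2 - b.2| == 1)%R.

(* weight of the step a -> b (a, b adjacent) in the weight configuration w *)
Definition step_weight (R : Type) (w : edge -> R) (a b : vtx) : R :=
  if b == (a.1 + 1, a.2) then w (a, false)
  else if a == (b.1 + 1, b.2) then w (b, false)
  else if b == (a.1, a.2 + 1) then w (a, true)
  else w (b, true).

Fixpoint path_weight (R : numDomainType) (w : edge -> R) (a : vtx) (p : seq vtx)
  : R :=
  match p with
  | [::] => 0
  | b :: p' => step_weight w a b + path_weight w b p'
  end.

Definition passage_time (R : realType) (w : edge -> R) (u v : vtx) : R :=
  inf [set t | exists p : seq vtx,
         [/\ path adjacent u p, last u p = v & t = path_weight w u p]].

Definition lattice_pt (R : realType) (x : R * R) : vtx :=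
  (Num.floor x.1, Num.floor x.2).

Definition passage_timeR (R : realType) (w : edge -> R) (x y : R * R) : R :=
  passage_time w (lattice_pt x) (lattice_pt y).

Definition scal2 (R : realType) (t : R) (x : R * R) : R * R := (t * x.1, t * x.2).
Definition add2 (R : realType) (x y : R * R) : R * R := (x.1 + y.1, x.2 + y.2).
Definition sub2 (R : realType) (x y : R * R) : R * R := (x.1 - y.1, x.2 - y.2).
Definition e2 (R : realType) : R * R := (0, 1).

Definition independent_family d (T : measurableType d) (R : realType) (I : eqType)
  (P : probability T R) (X : I -> T -> R) : Prop :=
  forall (s : seq I) (B : I -> set R), uniq s -> (forall i, measurable (B i)) ->
    fine (P (\bigcap_(i in [set` s]) (X i @^-1` B i))) =
    \prod_(i <- s) fine (P (X i @^-1` B i)).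

Definition has_law d (T : measurableType d) (R : realType)
  (P : probability T R) (X : T -> R) (nu : probability R R) : Prop :=
  measurable_fun setT X /\ forall B, measurable B -> P (X @^-1` B) = nu B.

Definition as_time_constant d (T : measurableType d) (R : realType)
  (P : probability T R) (tau : edge -> T -> R) (x : R * R) (c : R) : Prop :=
  {ae P, forall om,
     (fun n : nat => passage_timeR (tau^~ om) (0, 0) (scal2 n%:R x) / n%:R)
       @ \oo --> c}.

Definition prob_time_constant d (T : measurableType d) (R : realType)
  (P : probability T R) (tau : edge -> T -> R) (x : R * R) (c : R) : Prop :=
  forall eps : R, 0 < eps ->
    (fun n : nat => P [set om | eps <=
        `|passage_timeR (tau^~ om) (0, 0) (scal2 n%:R x) / n%:R - c|])
      @ \oo --> 0%E.

Definition Ymin d (T : measurableType d) (R : realType) (tau : edge -> T -> R)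
  (om : T) : R :=
  Num.min (Num.min (tau ((0, 0), false) om) (tau ((-1, 0), false) om))
          (Num.min (tau ((0, 0), true) om) (tau ((0, -1), true) om)).

Definition convex2 (R : realType) (A : set (R * R)) : Prop :=
  forall x y t, A x -> A y -> 0 <= t <= 1 ->
    A (add2 (scal2 t x) (scal2 (1 - t) y)).

Definition closed_convex_hull (R : realType) (A : set (R * R)) : set (R * R) :=
  \bigcap_(C in [set C : set (R * R) | [/\ closed C, convex2 C & A `<=` C]]) C.

(* Main.v *)
(** Idea. Write m for the time constant of F_- and mb for the inhomogeneous one. Two local
    comparisons hold in the open left half-plane.

    (U) mb (y + x) <= mb y + m x if y and y + x lie in it. Cut the segment from n y to n (y + x)
    into blocks of fixed size. Deep in the left half-plane, finitely many paths realize the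
    homogeneous passage time of a block up to an event of small probability. The passage time
    between neighbours is bounded by a sum of minima of four weights, because there are four
    edge-disjoint paths joining them; it is thus integrable, which controls the exceptional
    blocks in mean.

    (L) mb y >= mb z + m (z - y) - e for some z on the boundary of a given small box around y:
    look at the first exit from the box of a path from n y to the origin.

    With y = x / 2, (U) and homogeneity give mb <= m, and then, by vertical translation
    invariance, |mb x - mb y| <= m (x - y) on the closed half-plane; this is the upper bound of
    the variational formula. By lattice symmetries m is zero or a norm. In the second case, the
    minimum over the half-plane of mb z + (1 - eta) m (z - x) cannot be attained in the interior
    by (L), which gives the lower bound as eta tends to 0. The right half-plane follows by
    reflection, and subadditivity and the description of the unit ball from the two formulas. *)
Require Import Defs.
From HB Require Import structures.
From mathcomp Require Import all_boot all_order all_algebra.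
From mathcomp Require Import all_classical all_reals all_analysis.
From mathcomp Require Import measurable_realfun zify ring lra.
Set Implicit Arguments. Unset Strict Implicit. Unset Printing Implicit Defensive.
Import Order.TTheory GRing.Theory Num.Theory.
Import numFieldNormedType.Exports.
Local Open Scope classical_set_scope.
Local Open Scope ring_scope.
(* [adjacent] is shadowed by a lemma of the order library. *)
Local Notation adjacent := Defs.adjacent.

(** * Lattice paths and passage times *)

(** Only the minimum of four weights is assumed integrable, and the limits come without a rate of
    convergence. Hence means are taken only of overshoots of such minima, no independence between
    blocks is used, and Markov's inequality controls their sum. A union bound is affordable only
    over a number of points that does not depend on n, which is why exit points are rounded to a
    fixed grid.

    The environments of the statement are not coupled. They are compared in law, through events that
    depend only on edges where the laws agree. This is why both comparisons live in the open
    half-plane: after scaling, the segments and boxes lie at distance of order n from the axis.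

    Each inequality between time constants is read off at one sample point outside finitely many bad
    events of total probability below 1, for one large n.

    The factor 1 - eta is there because (L) carries an arbitrary error e: a step of length r then
    gains a fixed multiple of eta * r, against which e can be chosen. *)

Definition step_edge (a b : vtx) : edge :=
  if b == (a.1 + 1, a.2) then (a, false)
  else if a == (b.1 + 1, b.2) then (b, false)
  else if b == (a.1, a.2 + 1) then (a, true)
  else (b, true).

Lemma step_weightE (R : Type) (w : edge -> R) a b :
  step_weight w a b = w (step_edge a b).
Proof. by rewrite /step_weight /step_edge; do 3 case: ifP => //. Qed.

Lemma adjacentP (a b : vtx) : adjacent a b <->
  [\/ b = (a.1 + 1, a.2), a = (b.1 + 1, b.2), b = (a.1, a.2 + 1)
    | a = (b.1, b.2 + 1)].
Proof.
case: a b => [a1 a2] [b1 b2]; rewrite /adjacent /=; split; last first.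
  by case=> -[-> ->]; apply/eqP; lia.
move=> /eqP h.
have : (b1 = a1 + 1 /\ b2 = a2) \/ (a1 = b1 + 1 /\ a2 = b2) \/
  (b1 = a1 /\ b2 = a2 + 1) \/ (a1 = b1 /\ a2 = b2 + 1) by lia.
case=> [[-> ->]|[[-> ->]|[[-> ->]|[-> ->]]]];
  by [constructor 1|constructor 2|constructor 3|constructor 4].
Qed.

Lemma pair_intE (a b c d : int) :
  ((a, b) == (c, d) :> vtx) = (a == c) && (b == d).
Proof. by []. Qed.

Lemma step_edge_sym a b : adjacent a b -> step_edge a b = step_edge b a.
Proof.
case: a b => [a1 a2] [b1 b2] /adjacentP /= h; rewrite /step_edge /= !pair_intE.
by case: h => -[-> ->] /=; rewrite !eqxx ?andbT /=;
  (do ?case: ifP) => //; lia.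
Qed.

Lemma adjacent_sym a b : adjacent a b = adjacent b a.
Proof. by rewrite /adjacent distrC [X in _ + X == _]distrC. Qed.

Fixpoint path_edges (a : vtx) (p : seq vtx) : seq edge :=
  if p is b :: p' then step_edge a b :: path_edges b p' else [::].

Lemma path_weightE (R : numDomainType) (w : edge -> R) a p :
  path_weight w a p = \sum_(e <- path_edges a p) w e.
Proof.
elim: p a => [|b p IH] a /=; first by rewrite big_nil.
by rewrite big_cons step_weightE IH.
Qed.

Lemma path_weight_cat (R : numDomainType) (w : edge -> R) a p q :
  path_weight w a (p ++ q) = path_weight w a p + path_weight w (last a p) q.
Proof. by elim: p a => [|b p IH] a /=; rewrite ?add0r // IH addrA. Qed.

Lemma path_weight_rev (R : numDomainType) (w : edge -> R) a p :
  path adjacent a p ->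
  path_weight w (last a p) (rev (belast a p)) = path_weight w a p.
Proof.
elim: p a => [|b p IH] a //= /andP[ab bp].
rewrite rev_cons -cats1 path_weight_cat IH //= addr0 addrC; congr (_ + _).
rewrite !step_weightE (step_edge_sym ab); congr (w (step_edge _ _)).
by case: p {IH} bp => //= c p _; rewrite rev_cons last_rcons.
Qed.

Lemma rev_adjacent_path a p : path adjacent a p ->
  path adjacent (last a p) (rev (belast a p)).
Proof.
by move=> ap; rewrite (@eq_path _ _ (fun x y => adjacent y x)) ?rev_path // => x y;
  exact: adjacent_sym.
Qed.

Lemma last_rev_belast (T : Type) (a : T) p : last (last a p) (rev (belast a p)) = a.
Proof. by case: p => //= b p; rewrite rev_cons last_rcons. Qed.

(** The path moves horizontally, then vertically. The bound on first coordinates keeps a path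
    between two points far to the left in the region where the weights have the homogeneous law. *)
Lemma stair_path (u v : vtx) : exists p : seq vtx,
  [/\ path adjacent u p, last u p = v,
      size p = (`|u.1 - v.1|%N + `|u.2 - v.2|%N)%N &
      forall z, z \in u :: p -> z.1 <= Num.max u.1 v.1].
Proof.
have [n hn] := ubnP (`|u.1 - v.1|%N + `|u.2 - v.2|%N)%N.
elim: n u hn => // n IH u hn.
have [e1|ne1] := eqVneq u.1 v.1; last first.
  pose u' : vtx := (if u.1 < v.1 then u.1 + 1 else u.1 - 1, u.2).
  have [|p [p1 p2 p3 p4]] := IH u'.
    by rewrite /u' /=; case: ifP; lia.
  exists (u' :: p); split => //=.
  - by rewrite p1 andbT /adjacent /u' /=; case: ifP => _; apply/eqP; lia.
  - by rewrite p3 /u' /=; case: ifP; lia.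
  - move=> z; rewrite inE => /orP[/eqP->|/p4]; first by lia.
    by rewrite /u' /=; case: ifP; lia.
have [e2|ne2] := eqVneq u.2 v.2.
  exists [::]; split => //=; [by rewrite [u]surjective_pairing e1 e2 -surjective_pairing|by lia|].
  by move=> z; rewrite inE => /eqP->; lia.
pose u' : vtx := (u.1, if u.2 < v.2 then u.2 + 1 else u.2 - 1).
have [|p [p1 p2 p3 p4]] := IH u'.
  by rewrite /u' /=; case: ifP; lia.
exists (u' :: p); split => //=.
- by rewrite p1 andbT /adjacent /u' /=; case: ifP => _; apply/eqP; lia.
- by rewrite p3 /u' /=; case: ifP; lia.
- by move=> z; rewrite inE => /orP[/eqP->|/p4]; rewrite /u' /=; lia.
Qed.

Section PassageTime.
Context {R : realType}.
Implicit Types (w : edge -> R) (u v x : vtx) (p : seq vtx).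

Definition nonneg w := forall e, 0 <= w e.

Lemma path_weight_ge0 w u p : nonneg w -> 0 <= path_weight w u p.
Proof. by move=> w0; rewrite path_weightE sumr_ge0. Qed.

Let weights w u v := [set t | exists p : seq vtx,
  [/\ path adjacent u p, last u p = v & t = path_weight w u p]].

Lemma passage_time_has_inf w u v : nonneg w -> has_inf (weights w u v).
Proof.
move=> w0; split; last by exists 0 => _ [p [_ _ ->]]; exact: path_weight_ge0.
by have [p [p1 p2 _ _]] := stair_path u v; exists (path_weight w u p), p.
Qed.

Lemma passage_time_le w u p : nonneg w -> path adjacent u p ->
  passage_time w u (last u p) <= path_weight w u p.
Proof.
move=> w0 up; apply: ge_inf; first exact: (passage_time_has_inf _ _ w0).2.
by exists p.
Qed.

Lemma passage_time_ge w u v (t : R) :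
  (forall p, path adjacent u p -> last u p = v -> t <= path_weight w u p) ->
  t <= passage_time w u v.
Proof.
move=> h; apply: lb_le_inf; last by move=> _ [p [p1 p2 ->]]; exact: h.
by have [p [p1 p2 _ _]] := stair_path u v; exists (path_weight w u p), p.
Qed.

Lemma passage_time_ltP w u v (t : R) : nonneg w ->
  passage_time w u v < t <->
  exists p, [/\ path adjacent u p, last u p = v & path_weight w u p < t].
Proof.
move=> w0; split.
  by move=> /(inf_lt (passage_time_has_inf u v w0).1)[_ [p [p1 p2 ->]] pt]; exists p.
by move=> [p [p1 <- pt]]; exact: le_lt_trans (passage_time_le w0 p1) pt.
Qed.

Lemma passage_time_ge0 w u v : nonneg w -> 0 <= passage_time w u v.
Proof. by move=> w0; apply: passage_time_ge => p _ _; exact: path_weight_ge0. Qed.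

Lemma passage_time_refl w u : nonneg w -> passage_time w u u = 0.
Proof.
move=> w0; apply/le_anti; rewrite passage_time_ge0 // andbT.
exact: (@passage_time_le w u [::]).
Qed.

Lemma passage_time_triangle w u x v : nonneg w ->
  passage_time w u v <= passage_time w u x + passage_time w x v.
Proof.
move=> w0; rewrite -lerBlDr; apply: passage_time_ge => p p1 p2.
rewrite lerBlDr -lerBlDl; apply: passage_time_ge => q q1 q2.
rewrite lerBlDl -p2 -path_weight_cat.
have <- : last u (p ++ q) = v by rewrite last_cat p2.
by apply: passage_time_le => //; rewrite cat_path p1 p2.
Qed.

Lemma passage_time_sym w u v : nonneg w -> passage_time w u v = passage_time w v u.
Proof.
move=> w0; wlog suff : u v / passage_time w u v <= passage_time w v u.
  by move=> h; apply/le_anti; rewrite !h.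
apply: passage_time_ge => p p1 p2.
have := passage_time_le w0 (rev_adjacent_path p1).
by rewrite last_rev_belast path_weight_rev // p2.
Qed.

End PassageTime.

(** * Symmetries of the lattice *)

Definition shiftv (c v : vtx) : vtx := (v.1 + c.1, v.2 + c.2).
Definition shifte (c : vtx) (e : edge) : edge := (shiftv c e.1, e.2).
Definition reflv (v : vtx) : vtx := (- v.1, v.2).
(** A horizontal edge is named by its left endpoint, so its mirror image is named by the image of
    its right endpoint; hence [- e.1.1 - 1]. *)
Definition refle (e : edge) : edge :=
  if e.2 then (reflv e.1, true) else ((- e.1.1 - 1, e.1.2), false).
Definition swapv (v : vtx) : vtx := (v.2, v.1).
Definition swape (e : edge) : edge := (swapv e.1, ~~ e.2).
Definition oppv (v : vtx) : vtx := (- v.1, - v.2).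

(** The action on edge names is carried along with the action on vertices: its injectivity keeps a
    reindexed family of weights independent. *)
Record lattice_aut (g : vtx -> vtx) (ge : edge -> edge) : Prop := LatticeAut {
  aut_bij : bijective g;
  aut_edge_inj : injective ge;
  aut_adj : forall a b, adjacent (g a) (g b) = adjacent a b;
  aut_step : forall a b, adjacent a b ->
    step_edge (g a) (g b) = ge (step_edge a b) }.

Lemma shift_aut c : lattice_aut (shiftv c) (shifte c).
Proof.
have inj : injective (shiftv c).
  by move=> [a1 a2] [b1 b2] [] /addIr -> /addIr ->.
split=> //.
- exists (shiftv (oppv c)) => -[a b];
  by rewrite /shiftv /= ?addrK ?addrNK.
- by move=> [a d] [b d'] [] h1 h2 ->; congr (_, _); apply: inj; rewrite /shiftv h1 h2.
- by move=> a b; rewrite /adjacent /=; congr (_ == _); lia.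
- move=> [a1 a2] [b1 b2] /adjacentP /= h; rewrite /step_edge /shifte /shiftv /= !pair_intE.
  by case: h => -[-> ->] /=; (do ?case: ifP => //=); lia.
Qed.

Lemma refl_aut : lattice_aut reflv refle.
Proof.
split.
- by exists reflv => -[a b]; rewrite /reflv /= opprK.
- move=> [[a1 a2] [|]] [[b1 b2] [|]]; rewrite /refle /= => -[] // h1 ->.
    by rewrite (oppr_inj h1).
  by congr (_, _, _); lia.
- by move=> a b; rewrite /adjacent /=; congr (_ == _); lia.
- move=> [a1 a2] [b1 b2] /adjacentP /= h; rewrite /step_edge /refle /reflv /= !pair_intE.
  by case: h => -[-> ->] /=; (do ?case: ifP => //=); try lia; move=> *; congr (_, _, _); lia.
Qed.

Lemma swap_aut : lattice_aut swapv swape.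
Proof.
split.
- by exists swapv => -[a b].
- by move=> [[a1 a2] d] [[b1 b2] d'] [] -> -> /negb_inj ->.
- by move=> a b; rewrite /adjacent /= addrC.
- move=> [a1 a2] [b1 b2] /adjacentP /= h; rewrite /step_edge /swape /swapv /= !pair_intE.
  by case: h => -[-> ->] /=; (do ?case: ifP => //=); lia.
Qed.

Section Automorphism.
Context {R : realType} (g : vtx -> vtx) (ge : edge -> edge).
Hypothesis gP : lattice_aut g ge.
Implicit Types (w : edge -> R).

Lemma path_aut u p : path adjacent (g u) (map g p) = path adjacent u p.
Proof. by rewrite path_map; apply: eq_path => a b; rewrite /= (aut_adj gP). Qed.

Lemma path_weight_aut w u p : path adjacent u p ->
  path_weight w (g u) (map g p) = path_weight (w \o ge) u p.
Proof.
elim: p u => //= v p IH u /andP[uv vp].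
by rewrite IH // !step_weightE (aut_step gP).
Qed.

Lemma passage_time_aut w u v :
  passage_time w (g u) (g v) = passage_time (w \o ge) u v.
Proof.
rewrite /passage_time; congr inf; apply/seteqP; split => t [p [p1 p2 ->]].
  have [g' gK g'K] := aut_bij gP.
  have pE : p = map g (map g' p) by rewrite -map_comp map_id_in // => x _ /=.
  have p1' : path adjacent u (map g' p) by rewrite -path_aut -pE.
  exists (map g' p); split => //; last by rewrite -path_weight_aut // -pE.
  by apply: (can_inj gK); rewrite -last_map -pE.
exists (map g p); split; first by rewrite path_aut.
  by rewrite last_map p2.
by rewrite path_weight_aut.
Qed.

End Automorphism.

(** The vector [((~~ d)%:Z, d%:Z)] is e1 for [d = false] and e2 for [d = true], in accordance with
    the naming of edges. *)
Lemma adjacent_dir (a b : vtx) : adjacent a b -> exists c d,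
  (a = c /\ b = shiftv ((~~ d)%:Z, d%:Z) c) \/ (b = c /\ a = shiftv ((~~ d)%:Z, d%:Z) c).
Proof.
move=> /adjacentP[] h; [exists a, false; left|exists b, false; right
  |exists a, true; left|exists b, true; right]; rewrite h /shiftv /= ?addr0; split => //;
by case: (a) (b) => [? ?] [? ?].
Qed.

(** Four paths from 0 to a neighbour of 0. They are pairwise edge-disjoint, so that the
    least of their weights is integrable as soon as the minimum of four weights is. *)
Definition detours (d : bool) : seq (seq vtx) :=
  let ps : seq (seq vtx) :=
    [:: [:: (1, 0)]; [:: (0, 1); (1, 1); (1, 0)]; [:: (0, -1); (1, -1); (1, 0)];
        [:: (-1, 0); (-1, 1); (-1, 2); (0, 2); (1, 2); (2, 2); (2, 1); (2, 0); (1, 0)]] in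
  if d then map (map swapv) ps else ps.

Definition detour_edges (d : bool) (i : nat) : seq edge :=
  path_edges (0, 0) (nth [::] (detours d) i).

Definition quad := (edge * edge * (edge * edge))%type.

(** One edge is taken from each detour. The detours have 1, 3, 3 and 9 edges, which makes 81
    quadruples. *)
Definition quads (d : bool) : seq quad :=
  [seq (ab, cd) | ab <- [seq (a, b) | a <- detour_edges d 0, b <- detour_edges d 1],
                  cd <- [seq (c, e) | c <- detour_edges d 2, e <- detour_edges d 3]].

Definition quad_edge (q : quad) (i : bool * bool) : edge :=
  let p := if i.1 then q.2 else q.1 in if i.2 then p.2 else p.1.

(** The minima are nested as in [Ymin], so that the two agree by conversion on the four edges at the
    origin. *)
Definition min4 {R : realType} (f : bool * bool -> R) : R :=
  Num.min (Num.min (f (false, false)) (f (false, true)))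
          (Num.min (f (true, false)) (f (true, true))).

Lemma quads_uniq d : all (fun q : quad => uniq [:: q.1.1; q.1.2; q.2.1; q.2.2]) (quads d).
Proof. by case: d; vm_compute. Qed.

Lemma quad_edge_inj d q : q \in quads d -> injective (quad_edge q).
Proof.
move=> /(allP (quads_uniq d)); case: q => [[a b] [c e]] /=.
rewrite !inE !negb_or => /and4P[/and3P[n1 n2 n3] /andP[n4 n5] n6 _].
by move=> [[|] [|]] [[|] [|]] //= h; move: n1 n2 n3 n4 n5 n6; rewrite /quad_edge /= in h;
  rewrite h eqxx.
Qed.

Lemma quads_left d : all (fun q : quad => all (fun e =>
  ((edge_ends e).1.1 <= 2) && ((edge_ends e).2.1 <= 2))
  [:: q.1.1; q.1.2; q.2.1; q.2.2]) (quads d).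
Proof. by case: d; vm_compute. Qed.

(** Stricter than [neg_edge]: both endpoints lie strictly to the left. The mirror image of such an
    edge is never a [neg_edge], so the same predicate serves the right half-plane after
    reflection. *)
Definition left_edge (e : edge) : bool :=
  ((edge_ends e).1.1 < 0) && ((edge_ends e).2.1 < 0).

Lemma edge_ends_shift c e : edge_ends (shifte c e) =
  (shiftv c (edge_ends e).1, shiftv c (edge_ends e).2).
Proof. by case: e => [[a b] [|]]; rewrite /shifte /shiftv /=; congr (_, (_, _)); ring. Qed.

(** The detours reach at most 2 to the right of their starting point; this is the origin of the
    threshold -3 used everywhere below. *)
Lemma quad_left d q u i : q \in quads d -> u.1 <= -3 :> int ->
  left_edge (shifte u (quad_edge q i)).
Proof.
move=> /(allP (quads_left d)); case: q => [[a b] [c e]] /= /and5P[h1 h2 h3 h4 _] hu.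
by rewrite /left_edge edge_ends_shift /=;
  case: i => [[|] [|]] /=; rewrite /quad_edge /=; lia.
Qed.

Section Detours.
Context {R : realType}.
Implicit Types (w : edge -> R) (f : edge -> R).

(** With [x] the passage time, iterating this over the four paths bounds [x] by a sum of
    minima of four distinct weights. *)
Lemma min_sum_le (s : seq edge) f (x : R) : (forall e, 0 <= f e) -> 0 <= x ->
  Num.min (\sum_(e <- s) f e) x <= \sum_(e <- s) Num.min (f e) x.
Proof.
move=> f0 x0; elim: s => [|e s IH]; first by rewrite !big_nil ge_min lexx.
rewrite !big_cons; apply: le_trans (lerD (lexx _) IH).
have fe := f0 e; have : 0 <= \sum_(j <- s) f j by rewrite sumr_ge0.
move: (\sum_(j <- s) _) => y y0.
by rewrite !minEle; (do ?case: ifP); lra.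
Qed.

Lemma le_sum_min (s : seq edge) f (x : R) : (forall e, 0 <= f e) -> 0 <= x ->
  x <= \sum_(e <- s) f e -> x <= \sum_(e <- s) Num.min (f e) x.
Proof.
by move=> f0 x0 h; apply: le_trans (min_sum_le s f0 x0); rewrite le_min h lexx.
Qed.

Lemma detours_path d i : (i < 4)%N ->
  path adjacent (0, 0) (nth [::] (detours d) i) /\
  last (0, 0) (nth [::] (detours d) i) = ((~~ d)%:Z, d%:Z).
Proof. by case: d; case: i => [|[|[|[|i]]]]. Qed.

Lemma passage_time_detour w u d i : nonneg w -> (i < 4)%N ->
  passage_time w u (shiftv ((~~ d)%:Z, d%:Z) u) <=
  \sum_(e <- detour_edges d i) w (shifte u e).
Proof.
move=> w0 i4; have [p1 p2] := detours_path d i4.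
have -> : u = shiftv u (0, 0) by case: u => a b; rewrite /shiftv /= !add0r.
have -> : shiftv ((~~ d)%:Z, d%:Z) (shiftv u (0, 0)) = shiftv u ((~~ d)%:Z, d%:Z).
  by rewrite /shiftv /=; congr (_, _); ring.
rewrite (passage_time_aut (shift_aut u)) -p2.
apply: le_trans (passage_time_le _ p1) _; first by move=> e; exact: w0.
rewrite path_weightE /=; apply: ler_sum => e _.
by case: u => a b; rewrite /shiftv /= !add0r.
Qed.

Lemma passage_time_step_le w u d : nonneg w ->
  passage_time w u (shiftv ((~~ d)%:Z, d%:Z) u) <=
  \sum_(q <- quads d) min4 (fun i => w (shifte u (quad_edge q i))).
Proof.
move=> w0; set t := passage_time _ _ _.
have t0 : 0 <= t by exact: passage_time_ge0.
have w0' e : 0 <= w (shifte u e) by exact: w0.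
have D i : (i < 4)%N -> t <= \sum_(e <- detour_edges d i) w (shifte u e).
  by move=> i4; exact: passage_time_detour.
rewrite /quads big_allpairs big_allpairs /=.
apply: le_trans (le_sum_min w0' t0 (D 0%N isT)) _; apply: ler_sum => a _.
(* [ta], [tb] and [tc] truncate the passage time [t] at the edges chosen so far. Each is at most
   [t], hence at most the weight of the next detour, so that [le_sum_min] applies again. *)
set ta := Num.min _ _; have ta0 : 0 <= ta by rewrite le_min w0' t0.
have tat : ta <= t by rewrite ge_min lexx orbT.
apply: le_trans (le_sum_min w0' ta0 (le_trans tat (D 1%N isT))) _.
apply: ler_sum => b _.
set tb := Num.min _ _; have tb0 : 0 <= tb by rewrite le_min w0' ta0.
have tbt : tb <= ta by rewrite ge_min lexx orbT.
rewrite big_allpairs.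
apply: le_trans (le_sum_min w0' tb0 (le_trans (le_trans tbt tat) (D 2%N isT))) _.
apply: ler_sum => c _.
set tc := Num.min _ _; have tc0 : 0 <= tc by rewrite le_min w0' tb0.
have tct : tc <= tb by rewrite ge_min lexx orbT.
apply: le_trans
  (le_sum_min w0' tc0 (le_trans tct (le_trans (le_trans tbt tat) (D 3%N isT)))) _.
apply: ler_sum => e _.
have la : ta <= w (shifte u a) by rewrite ge_min lexx.
have lb : tb <= w (shifte u b) by rewrite ge_min lexx.
have lc : tc <= w (shifte u c) by rewrite ge_min lexx.
set x := Num.min _ tc; have xc : x <= tc by rewrite ge_min lexx orbT.
have xe : x <= w (shifte u e) by rewrite ge_min lexx.
rewrite /min4 /quad_edge /= !le_min xe (le_trans xc lc).
by rewrite (le_trans xc (le_trans tct lb)) (le_trans xc (le_trans tct (le_trans tbt la))).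
Qed.

End Detours.

(** * Laws of independent families *)

Section Law.
Context (d : measure_display) (T : measurableType d) (R : realType).
Variable P : probability T R.

Section Family.
Context (I : eqType).
Implicit Types (X : I -> T -> R).

Definition cylinder (s : seq I) (B : I -> set R) : set (I -> R) :=
  [set w | forall i, i \in s -> B i (w i)].

Definition cylinders : set (set (I -> R)) :=
  [set A | exists s B, (forall i, measurable (B i)) /\ A = cylinder s B].

(** The product sigma-algebra on configurations; the joint law of a family is its image measure
    under [sample]. *)
Definition config := g_sigma_algebraType cylinders.
HB.instance Definition _ := Measurable.on config.

Lemma cylinders_setI : setI_closed cylinders.
Proof.
move=> _ _ [s [B [mB ->]]] [s' [B' [mB' ->]]].
exists (s ++ s'), (fun i => (if i \in s then B i else setT) `&`
                            (if i \in s' then B' i else setT)); split.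
  by move=> i; apply: measurableI; case: ifP.
apply/seteqP; split => w /=.
  by move=> [h h'] i _; split; case: ifP => // /[dup]; [move=> _ /h|move=> _ /h'].
move=> h; split=> i is_; have := h i; rewrite mem_cat is_ ?orbT => /(_ isT)[];
  by rewrite ?is_.
Qed.

Lemma measurable_eval i : measurable_fun setT (fun w : config => w i).
Proof.
move=> _ B mB; rewrite setTI; apply: sub_sigma_algebra.
exists [:: i], (fun=> B); split => //; apply/seteqP; split => w /=.
  by move=> h j; rewrite inE => /eqP->.
by move=> /(_ i); rewrite inE eqxx; exact.
Qed.

Definition sample X (om : T) : config := X^~ om.

Lemma preimage_cylinder X s B :
  sample X @^-1` cylinder s B = \bigcap_(i in [set` s]) (X i @^-1` B i).
Proof. by []. Qed.

Lemma measurable_sample X : (forall i, measurable_fun setT (X i)) ->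
  measurable_fun setT (sample X).
Proof.
move=> mX; apply: (@measurability _ _ _ config setT _ cylinders) => // _ [_ [s [B [mB ->]]] <-].
rewrite setTI preimage_cylinder.
apply: fin_bigcap_measurable => // i _.
by rewrite -[X in measurable X]setTI; exact: mX.
Qed.

Definition same_marginals X X' :=
  forall i B, measurable B -> P (X i @^-1` B) = P (X' i @^-1` B).

(** Independence and equal marginals give equality on cylinders; these are stable under
    intersection, so the pi-lambda theorem extends it to the product sigma-algebra. *)
Lemma independent_same_law X X' :
  (forall i, measurable_fun setT (X i)) -> (forall i, measurable_fun setT (X' i)) ->
  independent_family P X -> independent_family P X' -> same_marginals X X' ->
  forall A : set config, measurable A ->
  P (sample X @^-1` A) = P (sample X' @^-1` A).
Proof.
move=> mX mX' iX iX' XX'.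
have mpre Y (B : set config) : (forall i, measurable_fun setT (Y i)) -> measurable B ->
    measurable (sample Y @^-1` B).
  by move=> mY mB; rewrite -[X in measurable X]setTI; exact: measurable_sample.
suff : <<s cylinders >> `<=`
    [set A : set config | P (sample X @^-1` A) = P (sample X' @^-1` A)] by [].
move=> A cA.
move: A cA; apply: (@dynkin_induction _ config cylinders) => //.
- exact: cylinders_setI.
- move=> _ [s [B [mB ->]]].
    (* [independent_family] speaks of duplicate-free lists, while a cylinder may list an index
       twice. *)
    have E Y : (forall i, measurable_fun setT (Y i)) -> independent_family P Y ->
      fine (P (sample Y @^-1` cylinder s B)) =
      \prod_(i <- undup s) fine (P (Y i @^-1` B i)).
    move=> mY iY; rewrite -iY ?undup_uniq //; congr (fine (P _)).
    rewrite preimage_cylinder; apply/seteqP; split => om /= h i;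
      by have := h i; rewrite /= mem_undup.
    have mc : measurable (cylinder s B : set config).
    by apply: sub_sigma_algebra; exists s, B.
    rewrite /= -[LHS]fineK ?fin_num_measure //; last exact: mpre.
  rewrite -[RHS]fineK ?fin_num_measure //; last exact: mpre.
    rewrite (E X mX iX) (E X' mX' iX'). congr EFin; apply: eq_bigr => i _.
  by rewrite (XX' i (B i) (mB i)).
- move=> S mS hS.
  have hC Y : (forall i, measurable_fun setT (Y i)) ->
      P (sample Y @^-1` (~` S)) = (1 - P (sample Y @^-1` S))%E.
    by move=> mY; rewrite preimage_setC (probability_setC _ (mpre Y S mY mS)).
  by rewrite /= (hC X mX) (hC X' mX') hS.
- move=> F mF tF hF.
  have hU Y : (forall i, measurable_fun setT (Y i)) ->
      P (sample Y @^-1` (\bigcup_k F k)) = (\sum_(0 <= k <oo) P (sample Y @^-1` F k))%E.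
    move=> mY; rewrite preimage_bigcup measure_bigcup.
    - by apply: eq_eseriesl => n; rewrite in_setT.
    - by move=> n _; exact: mpre Y (F n) mY (mF n).
    - move=> i j _ _ [om [Fi Fj]]; apply: tF => //; by exists (sample Y om).
  rewrite /= (hU X mX) (hU X' mX'); apply: eq_eseriesr => n _; exact: hF.
Qed.

Lemma independent_compose X (g : I -> R -> R) :
  (forall i, measurable_fun setT (g i)) -> independent_family P X ->
  independent_family P (fun i => g i \o X i).
Proof.
move=> mg iX s B us mB.
have := iX s (fun i => g i @^-1` B i) us; apply => i.
by rewrite -[X in measurable X]setTI; exact: mg.
Qed.

End Family.

Lemma independent_reindex (I J : eqType) (f : J -> I) (X : I -> T -> R) :
  injective f -> independent_family P X -> independent_family P (X \o f).
Proof.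
move=> f_inj iX s B us mB.
(* [B'] transports [B] along [f], with [setT] off the image of [s]. By injectivity the head of the
   filtered list at [f j] is [j] itself. *)
pose B' i := if [seq j <- s | f j == i] is j :: _ then B j else setT.
have B'f j : j \in s -> B' (f j) = B j.
  move=> js; rewrite /B'.
  have : j \in [seq k <- s | f k == f j] by rewrite mem_filter eqxx.
  case E: [seq k <- s | f k == f j] => [//|k l] _.
  have : k \in [seq k <- s | f k == f j] by rewrite E mem_head.
  by rewrite mem_filter => /andP[/eqP/f_inj-> _].
have := iX (map f s) B'; rewrite map_inj_uniq // big_map => /(_ us) => h.
have -> : \bigcap_(i in [set` s]) ((X \o f) i @^-1` B i) =
          \bigcap_(i in [set` map f s]) (X i @^-1` B' i).
  apply/seteqP; split => om /= H.
    move=> i; rewrite /= => /mapP[j js ->]; rewrite /preimage /= B'f //; exact: (H j).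
  by move=> j js; rewrite /preimage /= -B'f //; apply: (H (f j)); exact: map_f.
rewrite h; last by move=> i; rewrite /B'; case: [seq _ <- _ | _].
by rewrite !big_seq; apply: eq_bigr => j js; rewrite B'f.
Qed.

(** Replacing the coordinates outside [E] by the constant 0 keeps independence and does not change
    the event, and it makes the marginals agree at every index. This is how uncoupled environments
    are compared on the edges where their laws agree. *)
Lemma independent_same_law_on (I : eqType) (E : I -> bool) (X X' : I -> T -> R) :
  (forall i, measurable_fun setT (X i)) -> (forall i, measurable_fun setT (X' i)) ->
  independent_family P X -> independent_family P X' ->
  (forall i B, E i -> measurable B -> P (X i @^-1` B) = P (X' i @^-1` B)) ->
  forall A : set (config I), measurable A ->
  (forall w w' : I -> R, (forall i, E i -> w i = w' i) -> A w -> A w') ->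
  P (sample X @^-1` A) = P (sample X' @^-1` A).
Proof.
move=> mX mX' iX iX' XX' A mA Aloc.
pose g i : R -> R := if E i then id else cst 0.
have mg i : measurable_fun setT (g i) by rewrite /g; case: ifP => // _.
have pre Y : sample Y @^-1` A = sample (fun i => g i \o Y i) @^-1` A.
  by apply/seteqP; split => om /=; apply: Aloc => i Ei; rewrite /sample /g /= Ei.
rewrite pre [in RHS]pre; apply: independent_same_law => //.
- by move=> i; exact: measurableT_comp.
- by move=> i; exact: measurableT_comp.
- exact: independent_compose.
- exact: independent_compose.
- move=> i B mB; rewrite /g; case: ifP => Ei; first exact: XX'.
  by [].
Qed.

Lemma independent_same_integral (I : eqType) (X X' : I -> T -> R) (f : config I -> R) :
  (forall i, measurable_fun setT (X i)) -> (forall i, measurable_fun setT (X' i)) ->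
  independent_family P X -> independent_family P X' -> same_marginals X X' ->
  measurable_fun [set: config I] f -> (forall w, 0 <= f w) ->
  (\int[P]_om (f (sample X om))%:E = \int[P]_om (f (sample X' om))%:E)%E.
Proof.
move=> mX mX' iX iX' XX' mf f0.
have mf' : measurable_fun [set: config I] (EFin \o f) by exact/measurable_EFinP.
have E Y : (forall i, measurable_fun setT (Y i)) ->
    (\int[P]_om (f (sample Y om))%:E = \int[pushforward P (sample Y)]_w (EFin \o f) w)%E.
  move=> mY; rewrite ge0_integral_pushforward //; first exact: measurable_sample.
  by move=> w _; rewrite lee_fin.
rewrite (E X mX) (E X' mX').
pose m (Y : I -> T -> R) (mY : forall i, measurable_fun setT (Y i)) :=
  measure_function_pushforward__canonical__measure_function_Measure P (measurable_sample mY).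
have := @eq_measure_integral _ _ _ setT (m X' mX') (m X mX) (EFin \o f); apply.
by move=> A mA _; exact: (independent_same_law mX mX' iX iX' XX' mA).
Qed.

End Law.

Lemma countable_bigcup_measurable d (T : measurableType d) (I : countType) (F : I -> set T) :
  (forall i, measurable (F i)) -> measurable (\bigcup_i F i).
Proof.
move=> mF.
have -> : \bigcup_i F i = \bigcup_n (if unpickle n is Some i then F i else set0).
  apply/seteqP; split => x.
    by move=> [i _ Fx]; exists (pickle i) => //; rewrite pickleK.
  by move=> [n _]; case: unpickle => // i Fx; exists i.
by apply: bigcupT_measurable => n; case: unpickle.
Qed.

Lemma measurable_superlevel d (T : measurableType d) (R : realType) (f : T -> R) (t : R) :
  measurable_fun setT f -> measurable [set x | t <= f x].
Proof.
move=> mf; rewrite -[X in measurable X]setTI.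
exact: (measurable_fun_ler (measurable_cst t) mf).
Qed.

Lemma measurable_sublevel d (T : measurableType d) (R : realType) (f : T -> R) (t : R) :
  measurable_fun setT f -> measurable [set x | f x < t].
Proof.
move=> mf; rewrite -[X in measurable X]setTI.
exact: (measurable_fun_ltr mf (measurable_cst t)).
Qed.

(** * Events of small probability *)

Section Small.
Context (d : measure_display) (T : measurableType d) (R : realType).
Variable P : probability T R.
Implicit Types (A B : set T) (a b : R).

(** Stated for the outer measure: unions and subsets then need no measurability. *)
Definition small A a := exists B, [/\ measurable B, A `<=` B & (P B <= a%:E)%E].

Lemma small_measurable A a : measurable A -> (P A <= a%:E)%E -> small A a.
Proof. by move=> mA PA; exists A; split. Qed.

Lemma small_measurableE A a : measurable A -> small A a -> (P A <= a%:E)%E.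
Proof.
by move=> mA [B [mB AB PB]]; apply: le_trans PB; apply: le_measure => //; rewrite inE.
Qed.

Lemma small_sub A B a : A `<=` B -> small B a -> small A a.
Proof. by move=> AB [C [mC BC PC]]; exists C; split => //; exact: subset_trans BC. Qed.

Lemma small_le A a b : a <= b -> small A a -> small A b.
Proof.
by move=> ab [C [mC AC PC]]; exists C; split => //; apply: le_trans PC _; rewrite lee_fin.
Qed.

Lemma small0 a : 0 <= a -> small set0 a.
Proof. by move=> a0; exists set0; split => //; rewrite measure0 lee_fin. Qed.

Lemma smallU A B a b : small A a -> small B b -> small (A `|` B) (a + b).
Proof.
move=> [A' [mA AA' PA]] [B' [mB BB' PB]]; exists (A' `|` B'); split.
- exact: measurableU.
- exact: setUSS.
- by apply: le_trans (measureU2 _ mA mB) _; rewrite EFinD leeD.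
Qed.

Lemma small_bigU (J : eqType) (s : seq J) (A : J -> set T) a :
  (forall j, j \in s -> small (A j) a) ->
  small [set om | exists2 j, j \in s & A j om] ((size s)%:R * a).
Proof.
elim: s => [|j s IH] h.
  by rewrite mul0r; apply: small_sub (small0 (lexx _)) => om [].
rewrite /= -natr1 mulrDl mul1r addrC.
apply: small_sub (smallU (h j (mem_head _ _)) (IH _)).
  move=> om [k]; rewrite inE => /orP[/eqP->|ks Ak]; [by left|by right; exists k].
by move=> k ks; apply: h; rewrite inE ks orbT.
Qed.

(** The passage from probabilities to deterministic inequalities: a sample point avoiding all bad
    events satisfies all the estimates at once. *)
Lemma small_exists A a : small A a -> a < 1 -> exists om, ~ A om.
Proof.
move=> [B [mB AB PB]] a1; apply: contrapT => h.
have : B = setT.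
  by rewrite -subTset => om _; apply: AB; apply: contrapT => nA; apply: h; exists om.
move=> BT; move: PB; rewrite BT probability_setT lee_fin leNgt.
by rewrite a1.
Qed.

Lemma markov_small (f : T -> R) (c t : R) : measurable_fun setT f ->
  (forall om, 0 <= f om) -> (\int[P]_om (f om)%:E <= c%:E)%E -> 0 < t ->
  small [set om | t <= f om] (c / t).
Proof.
move=> mf f0 fc t0; apply: small_measurable.
  exact: measurable_superlevel.
have := @le_integral_comp_abse _ _ _ P setT measurableT (EFin \o f) t id.
have mE : measurable_fun setT (EFin \o f) by exact/measurable_EFinP.
move=> /(_ (@measurable_id _ _ _) (fun _ h => h) (fun _ _ _ _ h => h) mE t0).
have -> : [set: T] `&` [set x | (t%:E <= `|(EFin \o f) x|)%E] = [set om | t <= f om].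
  by apply/seteqP; split => x /=; rewrite ger0_norm ?lee_fin //; case.
move=> h; rewrite EFinM lee_pdivlMr // muleC; apply: le_trans h _.
apply: le_trans fc; rewrite le_eqVlt; apply/orP; left; apply/eqP.
by apply: eq_integral => x _; rewrite /= ger0_norm.
Qed.

End Small.

(** * Measurability of the passage time *)

Section PassageTimeMeasurable.
Context {R : realType}.
Local Notation W := (@config R edge).

Lemma measurable_path_weight u p :
  measurable_fun [set: W] (fun w : W => path_weight w u p).
Proof.
elim: p u => [|v p IH] u /=; first exact: measurable_cst.
apply: measurable_funD; last exact: IH.
by under eq_fun do rewrite step_weightE; exact: measurable_eval.
Qed.

Lemma measurable_path_weight_lt u p (t : R) :
  measurable [set w : W | path_weight w u p < t].
Proof. exact: (measurable_sublevel _ (measurable_path_weight u p)). Qed.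

(** There are countably many paths, but an arbitrary configuration may have path weights unbounded
    below, where [inf] takes its default value 0. The event [lb] that they are bounded below
    separates the two cases. *)
Lemma measurable_passage_time u v :
  measurable_fun [set: W] (fun w : W => passage_time w u v).
Proof.
move=> mD; apply: (measurability _ (RGenInftyO.measurableE R)) => //.
move=> _ [_ [t ->] <-]; rewrite setTI.
pose Q p := path adjacent u p && (last u p == v).
pose below s := \bigcup_p (if Q p then [set w : W | path_weight w u p < s] else set0).
have mbelow s : measurable (below s).
  apply: countable_bigcup_measurable => p; case: ifP => // _.
  exact: measurable_path_weight_lt.
pose lb := \bigcup_(m : nat) ~` below (- m%:R).
have mlb : measurable lb by apply: bigcupT_measurable => m; exact: measurableC.
have lbP w l : (forall p, Q p -> l <= path_weight w u p) -> lb w.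
  move=> hl; exists (Num.bound `|l|) => //= -[p _]; case: ifP => // Qp /=; apply/negP.
  rewrite -leNgt; apply: le_trans (hl p Qp).
  by have := archi_boundP (normr_ge0 l); have := ler_norm (- l); rewrite normrN; lra.
have -> : (fun w : W => passage_time w u v) @^-1` [set` `]-oo, t[] =
    (lb `&` below t) `|` (~` lb `&` [set w | 0 < t]).
  apply/seteqP; split => w /=; rewrite in_itv /=.
    have [hlb|nlb] := pselect (lb w); last first.
      move=> h; right; split => //; move: h; rewrite /passage_time.
      rewrite inf_out // => -[_ [l hl]]; apply: nlb; apply: (lbP _ l) => p.
      by move=> /andP[up /eqP pv]; apply: hl; exists p.
    move=> h; left; split => //.
    have hi : [set t0 | exists p : seq vtx, [/\ path adjacent u p, last u p = v
        & t0 = path_weight w u p]] !=set0.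
      by have [p [p1 p2 _ _]] := stair_path u v; exists (path_weight w u p), p.
    have [_ [p [p1 p2 ->]] pt] := inf_lt hi h.
    by exists p => //; rewrite /Q p1 p2 eqxx.
  move=> [[[m _ hm] [p _]]|[nlb t0]].
    case: ifP => // /andP[p1 /eqP p2] pt; apply: le_lt_trans pt.
    apply: ge_inf; last by exists p.
    exists (- m%:R) => _ [q [q1 q2 ->]]; rewrite leNgt; apply/negP => hq.
    by apply: hm; exists q => //; rewrite /Q q1 q2 eqxx.
  rewrite /passage_time inf_out // => -[_ [l hl]]; apply: nlb; apply: (lbP _ l) => p.
  by move=> /andP[up /eqP pv]; apply: hl; exists p.
apply: measurableU; first exact: measurableI.
apply: measurableI; first exact: measurableC.
case: (ltP 0 t) => t0.
  by rewrite (_ : [set _ | _] = setT) //; apply/seteqP; split.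
by rewrite (_ : [set _ | _] = set0) //; apply/seteqP; split.
Qed.

End PassageTimeMeasurable.

(** * Environments and time constants *)

Definition l1dist (u v : vtx) : nat := (`|u.1 - v.1|%N + `|u.2 - v.2|%N)%N.

Definition close_to {R : realType} (C : R) (v : vtx) (x : R * R) : Prop :=
  `|v.1%:~R - x.1| <= C /\ `|v.2%:~R - x.2| <= C.

Section CloseTo.
Context {R : realType}.
Implicit Types (x y : R * R) (u v : vtx) (C : R).

Lemma floor_close (t : R) : `|(Num.floor t)%:~R - t| <= 1.
Proof.
have := @Num.Theory.ge_floor R t; have := @Num.Theory.floorD1_gt R t.
by rewrite intrD ler_norml => h1 h2; apply/andP; split; lra.
Qed.

Lemma lattice_pt_close x : close_to 1 (lattice_pt x) x.
Proof. by split; exact: floor_close. Qed.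

Lemma close_le C C' v x : C <= C' -> close_to C v x -> close_to C' v x.
Proof. by move=> CC' [h1 h2]; split; apply: le_trans CC'. Qed.

Lemma close_l1dist C u v x : close_to C u x -> close_to C v x ->
  (l1dist u v)%:R <= 4 * C.
Proof.
move=> [u1 u2] [v1 v2]; rewrite /l1dist natrD !natr_absz !intr_norm !intrB.
have := ler_distD x.1 u.1%:~R v.1%:~R; have := ler_distD x.2 u.2%:~R v.2%:~R.
rewrite (distrC x.1) (distrC x.2); lra.
Qed.

Lemma close_add C C' u v x y : close_to C u x -> close_to C' v y ->
  close_to (C + C') (shiftv u v) (add2 x y).
Proof.
move=> [] + + []; rewrite /close_to /= !intrD !ler_norml.
by move=> /andP[? ?] /andP[? ?] /andP[? ?] /andP[? ?]; split; apply/andP; split; lra.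
Qed.

Lemma close_opp C v x : close_to C v x -> close_to C (oppv v) (- x.1, - x.2).
Proof.
by move=> [v1 v2]; rewrite /close_to /= !intrN; split;
  rewrite -opprD normrN.
Qed.

End CloseTo.

Section Environment.
Context (d : measure_display) (T : measurableType d) (R : realType).
Variable P : probability T R.
Implicit Types (X : edge -> T -> R) (nu : edge -> probability R R).

Definition ptime X (om : T) (u v : vtx) : R := passage_time (X^~ om) u v.

(** Nonnegativity is required at every sample point, so that path estimates hold pointwise.
    Tightness is uniform over edges, which is available because only two laws occur. *)
Record environment X nu : Prop := Environment {
  env_law : forall e, has_law P (X e) (nu e);
  env_indep : independent_family P X;
  env_ge0 : forall om, nonneg (X^~ om);
  env_tight : forall b : R, 0 < b -> exists t, forall e, small P [set om | t <= X e om] b }.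

Lemma env_measurable X nu : environment X nu -> forall e, measurable_fun setT (X e).
Proof. by move=> eX e; exact: (env_law eX e).1. Qed.

Lemma measurable_ptime X nu u v : environment X nu ->
  measurable_fun setT (fun om => ptime X om u v).
Proof.
move=> eX; have := measurableT_comp (measurable_passage_time u v)
  (measurable_sample (env_measurable eX)); exact.
Qed.

Lemma env_reindex X nu ge : injective ge -> environment X nu ->
  environment (X \o ge) (nu \o ge).
Proof.
move=> ge_inj eX; split.
- by move=> e; exact: env_law eX (ge e).
- exact: independent_reindex (env_indep eX).
- by move=> om e; exact: env_ge0 eX om (ge e).
- by move=> b /(env_tight eX)[t ht]; exists t => e; exact: ht.
Qed.

Lemma env_same_law X nu X' nu' (E : edge -> bool) (A : set (@config R edge)) :
  environment X nu -> environment X' nu' -> (forall e, E e -> nu e = nu' e) ->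
  measurable A ->
  (forall w w' : edge -> R, (forall e, E e -> w e = w' e) -> A w -> A w') ->
  P (sample X @^-1` A) = P (sample X' @^-1` A).
Proof.
move=> eX eX' nuE mA; apply: independent_same_law_on => //.
- exact: env_measurable eX.
- exact: env_measurable eX'.
- exact: env_indep eX.
- exact: env_indep eX'.
- move=> e B Ee mB.
  by rewrite (env_law eX e).2 // (env_law eX' e).2 // nuE.
Qed.

Lemma env_aut_law X nu X' nu' g ge u v (B : set R) : lattice_aut g ge ->
  environment X nu -> environment X' nu' -> (forall e, nu' e = nu (ge e)) ->
  measurable B ->
  P [set om | B (ptime X om (g u) (g v))] = P [set om | B (ptime X' om u v)].
Proof.
move=> gP eX eX' nuE mB.
pose A := [set w : @config R edge | B (passage_time w u v)].
have mA : measurable A.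
  by rewrite -[X in measurable X]setTI; exact: (measurable_passage_time u v).
have -> : [set om | B (ptime X om (g u) (g v))] = sample (X \o ge) @^-1` A.
  by apply/seteqP; split => om; rewrite /ptime /A /= (passage_time_aut gP).
apply: (@env_same_law _ (nu \o ge) _ nu' xpredT A) => //.
- exact: env_reindex (aut_edge_inj gP) eX.
- by move=> w w' ww'; rewrite (_ : w = w') //; apply/funext => e; exact: ww'.
Qed.

Lemma ptime_shift_law X nu c u v (B : set R) : environment X nu ->
  (forall e, nu (shifte c e) = nu e) -> measurable B ->
  P [set om | B (ptime X om (shiftv c u) (shiftv c v))] =
  P [set om | B (ptime X om u v)].
Proof.
by move=> eX nuE; apply: (env_aut_law _ _ (shift_aut c) eX eX) => e; rewrite nuE.
Qed.

Lemma small_shift X nu c u v (B : set R) b : environment X nu ->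
  (forall e, nu (shifte c e) = nu e) -> measurable B ->
  small P [set om | B (ptime X om u v)] b ->
  small P [set om | B (ptime X om (shiftv c u) (shiftv c v))] b.
Proof.
move=> eX nuE mB; have mE a a' : measurable [set om | B (ptime X om a a')].
  by rewrite -[X in measurable X]setTI; exact: (measurable_ptime a a' eX).
move=> /(small_measurableE (mE _ _)) h; apply: small_measurable => //.
by rewrite (ptime_shift_law _ _ eX).
Qed.

Lemma passage_time_tight X nu (l : nat) (b : R) : environment X nu -> 0 < b ->
  exists2 t : R, 0 < t & forall u v, (l1dist u v <= l)%N ->
    small P [set om | t <= ptime X om u v] b.
Proof.
move=> eX b0; have [|t ht] := @env_tight _ _ eX (b / l.+1%:R).
  by rewrite divr_gt0.
pose s := Num.max t 1; have s0 : 0 < s by rewrite lt_max ltr01 orbT.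
exists (l.+1%:R * s) => [|u v uvl]; first by rewrite mulr_gt0.
have [p [p1 p2 p3 _]] := stair_path u v.
have sp : size (path_edges u p) = size p.
  by elim: (p) (u) => //= c q IH a; rewrite IH.
have hb := @small_bigU _ _ _ P _ (path_edges u p)
  (fun e => [set om | t <= X e om]) (b / l.+1%:R) (fun e _ => ht e).
apply: small_sub (small_le _ hb); last first.
  rewrite mulrCA -{2}[b]mulr1 ler_wpM2l ?(ltW b0) // ler_pdivrMr // mul1r ler_nat.
  by rewrite sp p3 (leq_trans uvl).
move=> om /= h; apply: contrapT => hn.
have hlt e : e \in path_edges u p -> X e om <= s.
  move=> ep; rewrite leNgt; apply/negP => se; apply: hn; exists e => //.
  by apply: ltW; apply: le_lt_trans se; rewrite le_max lexx.
have : ptime X om u v <= l%:R * s.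
  rewrite /ptime -p2; apply: le_trans (passage_time_le (env_ge0 eX om) p1) _.
  rewrite path_weightE; apply: (@le_trans _ _ (\sum_(e <- path_edges u p) s)).
    by rewrite big_seq [leRHS]big_seq; apply: ler_sum => e /hlt.
  rewrite big_const_seq count_predT iter_addr addr0 -[s *+ _]mulr_natl.
  by rewrite ler_wpM2r ?(ltW s0) // ler_nat sp p3.
by rewrite leNgt => /negP; apply; apply: lt_le_trans h; rewrite ltr_pM2r // ltr_nat.
Qed.

(** Convergence in probability, uniformly over lattice points close to [n x]. *)
Definition time_const X (m : R * R -> R) : Prop := forall x (C e b : R),
  0 < e -> 0 < b -> exists n0 : nat, forall n, (n0 <= n)%N -> forall v,
  close_to C v (scal2 n%:R x) ->
  small P [set om | n%:R * e <= `|ptime X om (0, 0) v - n%:R * m x|] b.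

(** Any point close to n x is at bounded lattice distance from [lattice_pt] of n x. The passage time
    between the two is tight, hence negligible compared with n. *)
Lemma prob_time_const X nu m : environment X nu ->
  (forall x (e b : R), 0 < e -> 0 < b -> exists N : nat, forall n, (N <= n)%N ->
    small P [set om | e <=
      `|passage_timeR (X^~ om) (0, 0) (scal2 n%:R x) / n%:R - m x|] b) ->
  time_const X m.
Proof.
move=> eX hm x C e b e0 b0.
have e2 : 0 < e / 2 by rewrite divr_gt0.
have b2 : 0 < b / 2 by rewrite divr_gt0.
have [N hN] := hm x _ _ e2 b2.
pose l := (Num.bound (4 * Num.max C 1)).
have [t t0 ht] := passage_time_tight l eX b2.
exists (maxn N (Num.bound (2 * t / e)).+1) => n; rewrite geq_max => /andP[Nn tn] v hv.
have n0 : 0 < n%:R :> R by rewrite ltr0n; exact: leq_trans tn.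
pose u := lattice_pt (scal2 n%:R x).
have hu : close_to (Num.max C 1) u (scal2 n%:R x).
  by apply: close_le (lattice_pt_close _); rewrite le_max lexx orbT.
have uvl : (l1dist u v <= l)%N.
  rewrite -(ler_nat R); apply: le_trans (close_l1dist hu (close_le _ hv)) _.
    by rewrite le_max lexx.
  by apply/ltW/archi_boundP; rewrite mulr_ge0 // le_max ler01 orbT.
pose f om := `|ptime X om (0, 0) u / n%:R - m x|.
have s1 : small P [set om | e / 2 <= f om] (b / 2).
  by have := hN n Nn; rewrite /passage_timeR /f /ptime /u /lattice_pt /= floor0.
have := smallU s1 (ht u v uvl); rewrite -splitr; apply: small_sub => om /= h.
have [hf|hf] := leP (e / 2) (f om); [by left|right].
have hf' : `|ptime X om (0, 0) u - n%:R * m x| < n%:R * (e / 2).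
  have -> : ptime X om (0, 0) u - n%:R * m x =
      n%:R * (ptime X om (0, 0) u / n%:R - m x) by field; rewrite gt_eqF.
  by rewrite normrM gtr0_norm // ltr_pM2l.
have nt : t < n%:R * (e / 2).
  rewrite mulrA ltr_pdivlMr // -ltr_pdivrMr // (mulrC t).
  apply: lt_le_trans (archi_boundP _) _; first by rewrite divr_ge0 ?mulr_ge0 // ltW.
  by rewrite ler_nat ltnW.
have w0 := env_ge0 eX om.
have tr1 := passage_time_triangle (0, 0) u v w0.
have tr2 := passage_time_triangle (0, 0) v u w0.
move: h hf' tr1 tr2; rewrite -!/(ptime X om _ _) [ptime X om v u]passage_time_sym //.
rewrite -/(ptime X om _ _) => h; rewrite ltr_norml => /andP[h1 h2] tr1 tr2.
by move: h; rewrite ler_normr => /orP[] h; lra.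
Qed.

End Environment.

Lemma le_addepsP (R : realFieldType) (a b K : R) : 0 <= K ->
  (forall e, 0 < e -> a <= b + K * e) -> a <= b.
Proof.
move=> K0 h; apply/ler_addgt0Pr => e e0.
have K1 : 0 < K + 1 by rewrite ltr_wpDl.
apply: le_trans (h (e / (K + 1)) _) _; first by rewrite divr_gt0.
by rewrite lerD2l mulrA ler_pdivrMr // mulrC ler_wpM2l ?lerDl // ltW.
Qed.

Lemma natr_trunc_close (R : realType) (t : R) : 0 <= t ->
  (Num.trunc t)%:R <= t < (Num.trunc t)%:R + 1.
Proof. by move=> t0; have := truncn_itv t0; rewrite -natr1. Qed.

(** * Homogeneity, translation and symmetry of time constants *)

Section TimeConstants.
Context (d : measure_display) (T : measurableType d) (R : realType).
Variable P : probability T R.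
Implicit Types (X : edge -> T -> R) (nu : edge -> probability R R).

Lemma measurable_deviation (a c : R) : measurable [set t : R | c <= `|t - a|].
Proof.
apply: measurable_superlevel; apply: measurableT_comp => //.
exact: measurable_funB.
Qed.

Lemma small3_exists (A B C : set T) (b : R) : b < 3%:R^-1 ->
  small P A b -> small P B b -> small P C b -> exists om, [/\ ~ A om, ~ B om & ~ C om].
Proof.
move=> b3 sA sB sC.
have [|om h] := small_exists (smallU (smallU sA sB) sC).
  by move: b3; rewrite -div1r ltr_pdivlMr //; lra.
by exists om; split => h'; apply: h; [left; left|left; right|right].
Qed.

Section OneEnvironment.
Variables (X : edge -> T -> R) (nu : edge -> probability R R) (m : R * R -> R).
Hypotheses (eX : environment P X nu) (tX : time_const P X m).

(** For real [t], one vertex is read at two scales: it is close to n (t x) and also to k x, where k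
    is the integer part of n t. The radius [C] absorbs the rounding, which moves the target by at
    most x. *)
Lemma time_const_homogeneous t x : 0 < t -> m (scal2 t x) = t * m x.
Proof.
move=> t0; suff : `|m (scal2 t x) - t * m x| <= 0.
  by rewrite normr_le0 subr_eq0 => /eqP.
apply: (@le_addepsP _ _ _ (2 + t)) => [|e e0]; first by rewrite addr_ge0 // ltW.
rewrite add0r.
have q0 : 0 < 4%:R^-1 :> R by rewrite invr_gt0.
pose C := 1 + `|x.1| + `|x.2|.
have [n0 h0] := tX (scal2 t x) 1 e0 q0.
have [k0 h1] := tX x C e0 q0.
have [na hna] : exists a : nat, k0.+1%:R / t <= a%:R.
  by exists (Num.bound (k0.+1%:R / t)); apply/ltW/archi_boundP; rewrite divr_ge0 // ltW.
have [nb hnb] : exists a : nat, `|m x| / e <= a%:R.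
  by exists (Num.bound (`|m x| / e)); apply/ltW/archi_boundP; rewrite divr_ge0 // ltW.
pose n := (n0 + (na + nb.+1))%N.
have n_gt0 : 0 < n%:R :> R by rewrite ltr0n /n addnS addnS.
have nk : k0.+1%:R <= n%:R * t.
  by rewrite -ler_pdivrMr //; apply: le_trans hna _; rewrite ler_nat /n; lia.
have nm : `|m x| <= n%:R * e.
  by rewrite -ler_pdivrMr //; apply: le_trans hnb _; rewrite ler_nat /n; lia.
have nt0 : 0 <= n%:R * t by rewrite mulr_ge0 // ltW.
have /andP[k1 k2] := natr_trunc_close nt0.
set k := Num.trunc _ in k1 k2.
have kk : (k0 <= k)%N.
  by rewrite -ltnS -(ltr_nat R) -[k.+1%:R]natr1; apply: le_lt_trans k2;
    apply: le_trans nk; rewrite ler_nat.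
pose v := lattice_pt (scal2 n%:R (scal2 t x)).
have v1 : close_to 1 v (scal2 n%:R (scal2 t x)) by exact: lattice_pt_close.
have kx y : `|n%:R * (t * y) - k%:R * y| <= `|y|.
  rewrite mulrA -mulrBl normrM -[leRHS]mul1r ler_wpM2r // ler_norml.
  by apply/andP; split; lra.
have v2 : close_to C v (scal2 k%:R x).
  have [a1 a2] := v1; have := kx x.1; have := kx x.2 => b2 b1.
  split; [have := ler_distD (n%:R * (t * x.1)) v.1%:~R (k%:R * x.1)
         |have := ler_distD (n%:R * (t * x.2)) v.2%:~R (k%:R * x.2)];
  move: a1 a2 b1 b2 (normr_ge0 x.1) (normr_ge0 x.2); rewrite /C /=; lra.
have s1 := h0 n (leq_addr _ _) v v1.
have s2 := h1 k kk v v2.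
have [|om [g1 g2 _]] := small3_exists _ s1 s2 s2; first by rewrite ltf_pV2 ?posrE // ltr_nat.
move: g1 g2 => /= /negP; rewrite -ltNge => g1 /negP; rewrite -ltNge => g2.
rewrite -(ler_pM2l n_gt0) -[X in X * `|_|]ger0_norm ?ler0n // -normrM.
have -> : n%:R * (m (scal2 t x) - t * m x) =
  - (ptime X om (0, 0) v - n%:R * m (scal2 t x)) +
    (ptime X om (0, 0) v - k%:R * m x) + - (n%:R * (t * m x) - k%:R * m x) by ring.
apply: le_trans (ler_normD _ _) _.
have := ler_normD (- (ptime X om (0, 0) v - n%:R * m (scal2 t x)))
    (ptime X om (0, 0) v - k%:R * m x).
have := kx (m x); rewrite !normrN.
have : k%:R * e <= n%:R * t * e by rewrite ler_wpM2r // ltW.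
move: g1 g2; lra.
Qed.

Lemma time_const0 : m (0, 0) = 0.
Proof.
have := @time_const_homogeneous 2 (0, 0) (ltr0Sn _ _).
by rewrite /scal2 /= mulr0; lra.
Qed.

Lemma time_const_ge0 x : 0 <= m x.
Proof.
apply: (@le_addepsP _ _ _ 1) => // e e0; rewrite mul1r.
have q0 : 0 < 2%:R^-1 :> R by rewrite invr_gt0.
have [n0 h0] := tX x 1 e0 q0.
have [|om /= /negP] := small_exists (h0 n0.+1 (leqnSn _) _ (lattice_pt_close _)).
  by rewrite invf_lt1 ?ltr1n.
rewrite -ltNge ltr_norml => /andP[_ h].
have := passage_time_ge0 (0, 0) (lattice_pt (scal2 n0.+1%:R x)) (env_ge0 eX om).
rewrite -/(ptime _ _ _ _) => h2.
have : 0 < n0.+1%:R * (m x + e) by rewrite mulrDr; lra.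
by rewrite pmulr_rgt0 // => /ltW.
Qed.

(** Two triangle inequalities between 0, [c n] and n z, where the passage time from [c n] to n z has
    the law of the one from 0 to n z - [c n]. In a homogeneous environment this applies to every [x]
    and gives the seminorm properties; in the inhomogeneous one, to vertical [x]. *)
Lemma time_const_shift (c : nat -> vtx) (C : R) x z :
  (forall n, close_to C (c n) (scal2 n%:R x)) ->
  (forall n e, nu (shifte (c n) e) = nu e) ->
  m z <= m x + m (sub2 z x) /\ m x <= m z + m (sub2 z x).
Proof.
move=> hc hnu.
suff H e : 0 < e -> m z <= m x + m (sub2 z x) + 3 * e /\
    m x <= m z + m (sub2 z x) + 3 * e.
  by split; apply: (@le_addepsP _ _ _ 3) => // e /H[].
move=> e0.
have q0 : 0 < 4%:R^-1 :> R by rewrite invr_gt0.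
have [n1 h1] := tX z 1 e0 q0.
have [n2 h2] := tX x C e0 q0.
have [n3 h3] := tX (sub2 z x) (1 + C) e0 q0.
pose n := (n1 + (n2 + n3.+1))%N.
have n_gt0 : 0 < n%:R :> R by rewrite ltr0n /n !addnS.
pose v := lattice_pt (scal2 n%:R z).
have v1 : close_to 1 v (scal2 n%:R z) by exact: lattice_pt_close.
have v2 : close_to (1 + C) (shiftv v (oppv (c n))) (scal2 n%:R (sub2 z x)).
  have := close_add v1 (close_opp (hc n)).
  by rewrite /add2 /scal2 /sub2 /= !mulrBr.
have s1 : small P _ _ := h1 n (leq_addr _ _) v v1.
have s2 : small P _ _ := h2 n _ (c n) (hc n).
have {}s2 := s2 (ltac:(by rewrite /n; lia)).
have s3 : small P _ _ := h3 n _ _ v2.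
have {}s3 := s3 (ltac:(by rewrite /n; lia)).
have {}s3 := small_shift eX (hnu n) (measurable_deviation _ _) s3.
have E : shiftv (c n) (shiftv v (oppv (c n))) = v.
  by case: (v) (c n) => a b [a' b']; rewrite /shiftv /=; congr (_, _); ring.
have E0 : shiftv (c n) (0, 0) = c n by case: (c n) => a b; rewrite /shiftv /= !add0r.
rewrite E E0 in s3.
have [|om [g1 g2 g3]] := small3_exists _ s1 s2 s3.
  by rewrite ltf_pV2 ?posrE // ltr_nat.
have w0 := env_ge0 eX om.
have tr1 := passage_time_triangle (0, 0) (c n) v w0.
have tr2 := passage_time_triangle (0, 0) v (c n) w0.
rewrite [passage_time _ v (c n)]passage_time_sym // in tr2.
move: g1 g2 g3 => /= /negP; rewrite -ltNge ltr_norml => /andP[g1 g1'].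
move=> /negP; rewrite -ltNge ltr_norml => /andP[g2 g2'].
move=> /negP; rewrite -ltNge ltr_norml => /andP[g3 g3'].
move: tr1 tr2; rewrite -!/(ptime _ _ _ _) => tr1 tr2.
by split; rewrite -(ler_pM2l n_gt0) !mulrDr; lra.
Qed.

Lemma time_const_aut X' nu' m' g ge gR : environment P X' nu' -> time_const P X' m' ->
  lattice_aut g ge -> (forall e, nu' e = nu (ge e)) -> g (0, 0) = (0, 0) ->
  (forall (C : R) v x, close_to C v x -> close_to C (g v) (gR x)) ->
  (forall t x, gR (scal2 t x) = scal2 t (gR x)) ->
  forall x, m (gR x) = m' x.
Proof.
move=> eX' tX' gP hnu g0 gC gS x; suff : `|m (gR x) - m' x| <= 0.
  by rewrite normr_le0 subr_eq0 => /eqP.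
apply: (@le_addepsP _ _ _ 2) => // e e0; rewrite add0r.
have q0 : 0 < 4%:R^-1 :> R by rewrite invr_gt0.
have [n1 h1] := tX (gR x) 1 e0 q0.
have [n2 h2] := tX' x 1 e _ e0 q0.
pose n := (n1 + n2.+1)%N.
have n_gt0 : 0 < n%:R :> R by rewrite ltr0n /n !addnS.
pose v := lattice_pt (scal2 n%:R x).
have v1 : close_to 1 v (scal2 n%:R x) by exact: lattice_pt_close.
have v2 : close_to 1 (g v) (scal2 n%:R (gR x)) by rewrite -gS; exact: gC.
have s1 : small P _ _ := h1 n (leq_addr _ _) _ v2.
have s2 : small P _ _ := h2 n _ v v1.
have {}s2 := s2 (ltac:(by rewrite /n; lia)).
have mB := measurable_deviation (n%:R * m (gR x)) (n%:R * e).
have {}s1 : small P [set om | n%:R * e <= `|ptime X' om (0, 0) v - n%:R * m (gR x)|] 4^-1.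
  have mE u : measurable [set om | n%:R * e <= `|ptime X om (0, 0) u - n%:R * m (gR x)|].
    by rewrite -[X in measurable X]setTI; exact: (measurable_ptime (0,0) u eX measurableT mB).
  have mE' u : measurable [set om | n%:R * e <= `|ptime X' om (0, 0) u - n%:R * m (gR x)|].
    by rewrite -[X in measurable X]setTI; exact: (measurable_ptime (0,0) u eX' measurableT mB).
  apply: small_measurable => //; have := small_measurableE (mE (g v)) s1.
  by have := env_aut_law (0, 0) v gP eX eX' hnu mB; rewrite g0 /= => ->.
have [|om [g1 g2 _]] := small3_exists _ s1 s2 s2.
  by rewrite ltf_pV2 ?posrE // ltr_nat.
move: g1 g2 => /= /negP; rewrite -ltNge => g1 /negP; rewrite -ltNge => g2.
rewrite -(ler_pM2l n_gt0) -[X in X * `|_|]ger0_norm ?ler0n // -normrM.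
have -> : n%:R * (m (gR x) - m' x) = - (ptime X' om (0, 0) v - n%:R * m (gR x)) +
    (ptime X' om (0, 0) v - n%:R * m' x) by ring.
apply: le_trans (ler_normD _ _) _; rewrite normrN; lra.
Qed.

(** A pathwise identity, in contrast to the equality of laws behind [time_const_aut]. *)
Lemma time_const_reindex g ge gR : lattice_aut g ge -> g (0, 0) = (0, 0) ->
  (forall (C : R) v x, close_to C v x -> close_to C (g v) (gR x)) ->
  (forall t x, gR (scal2 t x) = scal2 t (gR x)) ->
  time_const P (X \o ge) (m \o gR).
Proof.
move=> gP g0 gC gS x C e b e0 b0; have [n0 h] := tX (gR x) C e0 b0.
exists n0 => n nn0 v hv; have := h n nn0 (g v); rewrite -gS => /(_ (gC _ _ _ hv)).
apply: small_sub => om /=; rewrite /ptime -{2}g0 (passage_time_aut gP); exact.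
Qed.

End OneEnvironment.
End TimeConstants.

(** * Integrable bounds from minima of four weights *)

Section Excess.
Context (d : measure_display) (T : measurableType d) (R : realType).
Variable P : probability T R.
Implicit Types (X : edge -> T -> R) (nu : edge -> probability R R).

Lemma size_quads b : size (quads b) = 81%N.
Proof. by case: b; vm_compute. Qed.

Definition star_edge (i : bool * bool) : edge :=
  if i.1 then (if i.2 then ((0, -1), true) else ((0, 0), true))
  else (if i.2 then ((-1, 0), false) else ((0, 0), false)).

Lemma star_edge_inj : injective star_edge.
Proof. by move=> [[|] [|]] [[|] [|]]. Qed.

Lemma measurable_min4 (f : bool * bool -> T -> R) :
  (forall i, measurable_fun setT (f i)) ->
  measurable_fun setT (fun om => min4 (f^~ om)).
Proof. by move=> mf; rewrite /min4; do !apply: measurable_minr. Qed.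

Definition over (L t : R) : R := Num.max (t - L) 0.

Lemma over_ge0 L t : 0 <= over L t.
Proof. by rewrite le_max lexx orbT. Qed.

Lemma le_over L t : t <= L + over L t.
Proof. by rewrite -lerBlDl le_max lexx. Qed.

Lemma measurable_over L (f : T -> R) : measurable_fun setT f ->
  measurable_fun setT (fun om => over L (f om)).
Proof. by move=> mf; apply: measurable_maxr => //; exact: measurable_funB. Qed.

Definition good nu (nu0 : probability R R) (u : vtx) : Prop :=
  forall b q i, q \in quads b -> nu (shifte u (quad_edge q i)) = nu0.

Lemma good_left nu (nu0 : probability R R) u : (forall e, left_edge e -> nu e = nu0) ->
  u.1 <= -3 :> int -> good nu nu0 u.
Proof. by move=> h u3 b q i hq; apply: h; exact: quad_left hq u3. Qed.

Section Integrable.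
Variables (X0 : edge -> T -> R) (nu0 : probability R R).
Hypothesis eX0 : environment P X0 (fun=> nu0).
Hypothesis intY : (\int[P]_om (Ymin X0 om)%:E < +oo)%E.

Lemma Ymin_ge0 om : 0 <= Ymin X0 om.
Proof. by rewrite !le_min !(env_ge0 eX0 om). Qed.

Lemma measurable_Ymin : measurable_fun setT (Ymin X0).
Proof.
by apply: (@measurable_min4 (fun i => X0 (star_edge i))) => i; exact: env_measurable eX0 _.
Qed.

(** Dominated convergence, with [Ymin] as the dominating function. *)
Lemma over_Ymin_small (e : R) : 0 < e ->
  exists2 L, 0 < L & (\int[P]_om (over L (Ymin X0 om))%:E <= e%:E)%E.
Proof.
move=> e0.
have mY := measurable_Ymin.
pose f n om := (over n%:R (Ymin X0 om))%:E.
have mf n : measurable_fun setT (f n) by apply/measurable_EFinP; exact: measurable_over.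
have iY : P.-integrable setT (EFin \o Ymin X0).
  apply/integrableP; split; first exact/measurable_EFinP.
  by under eq_integral do rewrite /= ger0_norm ?Ymin_ge0 //.
have f0 : {ae P, forall x, setT x -> f ^~ x @ \oo --> (cst 0%E : T -> \bar R) x}.
  apply: aeW => om _; apply: cvg_near_cst; exists (Num.bound (Ymin X0 om)) => // n /= hn.
  congr EFin; rewrite /over; apply/max_idPr; rewrite subr_le0.
  apply: ltW; apply: lt_le_trans (archi_boundP (Ymin_ge0 om)) _; by rewrite ler_nat.
have fY : {ae P, forall x n, setT x -> (`|f n x| <= (EFin \o Ymin X0) x)%E}.
  apply: aeW => om n _; rewrite /= ger0_norm ?over_ge0 // lee_fin ge_max Ymin_ge0 andbT.
  by rewrite lerBlDr lerDl.
have [_ _] := dominated_convergence measurableT mf (measurable_cst _) f0 iY fY.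
rewrite /= integral0 => /fine_cvgP[_ /cvgrPdist_lt/(_ _ e0)[N _ hN]].
exists N.+1%:R; first by rewrite ltr0n.
have := hN N.+1 (leqnSn N); rewrite /= sub0r normrN => h.
have i0 : (0 <= \int[P]_om (over N.+1%:R (Ymin X0 om))%:E)%E.
  by apply: integral_ge0 => om _; rewrite lee_fin over_ge0.
rewrite -[leLHS]fineK ?lee_fin; first by apply/ltW/(le_lt_trans (ler_norm _)).
rewrite ge0_fin_numE //; apply: le_lt_trans intY; apply: ge0_le_integral => //.
- by move=> om _; rewrite lee_fin over_ge0.
- exact: mf.
- exact/measurable_EFinP.
- by move=> om _; rewrite lee_fin ge_max Ymin_ge0 andbT lerBlDr lerDl.
Qed.

(** Four distinct edges of law [nu0] carry jointly the same law as the four edges at the origin. *)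
Lemma over_quad_integral X nu b q u L : environment P X nu -> q \in quads b ->
  (forall i, nu (shifte u (quad_edge q i)) = nu0) ->
  (\int[P]_om (over L (min4 (fun i => X (shifte u (quad_edge q i)) om)))%:E =
   \int[P]_om (over L (Ymin X0 om))%:E)%E.
Proof.
move=> eX hq hnu.
pose f (w : @config R (bool * bool)%type) := over L (min4 w).
have inj1 : injective (fun i => shifte u (quad_edge q i)).
  by move=> i j /(aut_edge_inj (shift_aut u))/(quad_edge_inj hq).
have := @independent_same_integral _ _ _ P _ (fun i => X (shifte u (quad_edge q i)))
  (fun i => X0 (star_edge i)) f; apply.
- by move=> i; exact: env_measurable eX _.
- by move=> i; exact: env_measurable eX0 _.
- exact: independent_reindex inj1 (env_indep eX).
- exact: independent_reindex star_edge_inj (env_indep eX0).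
- by move=> i B mB; rewrite (env_law eX _).2 // (env_law eX0 _).2 // hnu.
- rewrite /f /over; apply: measurable_maxr => //; apply: measurable_funB => //.
  by rewrite /min4; do !apply: measurable_minr; exact: measurable_eval.
- by move=> w; exact: over_ge0.
Qed.

(** What remains of the bound for a nearest-neighbour passage time once each of the 81 minima has
    been charged the constant [L]. *)
Definition excess X L u b om :=
  \sum_(q <- quads b) over L (min4 (fun i => X (shifte u (quad_edge q i)) om)).

Lemma excess_ge0 X L u b om : 0 <= excess X L u b om.
Proof. by apply: sumr_ge0 => q _; exact: over_ge0. Qed.

Lemma measurable_excess X nu L u b : environment P X nu ->
  measurable_fun setT (excess X L u b).
Proof.
move=> eX; apply: measurable_sum => q; apply: measurable_over.
by apply: (@measurable_min4 (fun i => X (shifte u (quad_edge q i)))) => i;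
  exact: env_measurable eX _.
Qed.

Lemma excess_integral X nu L u b : environment P X nu -> good nu nu0 u ->
  (\int[P]_om (excess X L u b om)%:E = 81%:E * \int[P]_om (over L (Ymin X0 om))%:E)%E.
Proof.
move=> eX gu; rewrite /excess.
under eq_integral do rewrite -sumEFin.
rewrite ge0_integral_sum //; last 2 first.
- move=> q; apply/measurable_EFinP/measurable_over.
  by apply: (@measurable_min4 (fun i => X (shifte u (quad_edge q i)))) => i;
  exact: env_measurable eX _.
- by move=> q om _; rewrite lee_fin over_ge0.
rewrite (eq_big_seq (fun=> (\int[P]_om (over L (Ymin X0 om))%:E)%E)); last first.
  by move=> q hq; apply: (over_quad_integral _ eX hq) => i; exact: gu hq.
have : (0 <= \int[P]_om (over L (Ymin X0 om))%:E)%E.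
  by apply: integral_ge0 => om _; rewrite lee_fin over_ge0.
move: (\int[P]_om _)%E => I I0; rewrite big_const_seq count_predT size_quads.
elim: 81%N => [|n IH] /=; first by rewrite mul0e.
by rewrite IH -natr1 EFinD ge0_muleDl ?lee_fin ?ler0n ?ler01 // mul1e addeC.
Qed.

Lemma ptime_step_le X nu L u b om : environment P X nu ->
  ptime X om u (shiftv ((~~ b)%:Z, b%:Z) u) <= 81 * L + excess X L u b om.
Proof.
move=> eX; apply: le_trans (passage_time_step_le u b (env_ge0 eX om)) _.
have -> : 81 * L = \sum_(q <- quads b) L.
  by rewrite big_const_seq count_predT size_quads iter_addr addr0 mulr_natl.
by rewrite -big_split; apply: ler_sum => q _; exact: le_over.
Qed.

(** The passage times along [s] exceed their linear bound by at most one variable [xi] whose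
    mean is a small fraction of the length: this replaces a law of large numbers. *)
Lemma gap_control (e : R) : 0 < e -> exists2 L, 0 < L &
  forall X nu (s : nat -> vtx) N, environment P X nu ->
  (forall k, (k < N)%N -> adjacent (s k) (s k.+1)) ->
  (forall k, (k <= N)%N -> good nu nu0 (s k)) ->
  exists xi : T -> R, [/\ measurable_fun setT xi, forall om, 0 <= xi om,
    (\int[P]_om (xi om)%:E <= (N%:R * e)%:E)%E &
    forall om i j, (i <= j <= N)%N ->
      ptime X om (s i) (s j) <= L * (j - i)%:R + xi om].
Proof.
move=> e0; have [|L L0 hL] := @over_Ymin_small (e / 81%:R); first by rewrite divr_gt0.
exists (81 * L) => [|X nu s N eX adj gs]; first by rewrite mulr_gt0.
(* [ptime_step_le] starts at the lower or left endpoint of the edge, which may be [s k] or [s k.+1].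
   Past [N] the value is a default. *)
have step k : exists c : vtx * bool, (k < N)%N -> good nu nu0 c.1 /\
    forall om, ptime X om (s k) (s k.+1) <= 81 * L + excess X L c.1 c.2 om.
  have [kN|kN] := ltnP k N; last by exists ((0, 0), false).
  have [c [b hc]] := adjacent_dir (adj k kN).
  exists (c, b) => _ /=; split.
    by case: hc => -[<- _]; apply: gs => //; exact: ltnW.
  move=> om; case: hc => -[-> ->]; first exact: ptime_step_le eX.
  by rewrite /ptime passage_time_sym; [exact: ptime_step_le eX|exact: env_ge0 eX om].
have [c hc] := choice step.
(* The sum over all steps dominates the one over any subinterval, so a single variable serves all
   pairs [i], [j]. *)
exists (fun om => \sum_(0 <= k < N) excess X L (c k).1 (c k).2 om); split.
- by apply: measurable_sum => k; exact: measurable_excess eX.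
- by move=> om; apply: sumr_ge0 => k _; exact: excess_ge0.
- under eq_integral do rewrite -sumEFin.
  rewrite ge0_integral_sum //; last 2 first.
  + by move=> k; apply/measurable_EFinP; exact: measurable_excess eX.
  + by move=> k om _; rewrite lee_fin excess_ge0.
  have -> : (N%:R * e)%:E = (\sum_(0 <= k < N) e%:E)%E.
    by rewrite sumEFin big_const_nat subn0 iter_addr addr0 mulr_natl.
  rewrite big_nat_cond [leRHS]big_nat_cond; apply: lee_sum => k.
  rewrite andbT => /andP[_ kN]; rewrite (excess_integral _ _ eX (hc k kN).1).
  apply: (@le_trans _ _ (81%:E * (e / 81%:R)%:E)%E); first by rewrite lee_pmul2l.
  by rewrite -EFinM lee_fin mulrC divfK.
- move=> om i j /andP[ij jN].
  have h : ptime X om (s i) (s j) <=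
      \sum_(i <= k < j) (81 * L + excess X L (c k).1 (c k).2 om).
    elim: j ij jN => [|j IH] ij jN.
      by move: ij; rewrite leqn0 => /eqP->; rewrite big_geq // /ptime
        passage_time_refl //; exact: env_ge0 eX om.
    move: ij; rewrite leq_eqVlt => /orP[/eqP->|ij].
      by rewrite big_geq // /ptime passage_time_refl //; exact: env_ge0 eX om.
    rewrite big_nat_recr //=.
    apply: le_trans (passage_time_triangle _ (s j) _ (env_ge0 eX om)) _.
    apply: lerD; first by apply: IH => //; exact: ltnW.
    exact: (hc j jN).2.
  apply: le_trans h _; rewrite big_split /=; apply: lerD.
    by rewrite sumr_const_nat mulr_natr.
  rewrite [leRHS](@big_cat_nat _ _ _ i) //=; last exact: leq_trans jN.
  rewrite ler_wpDl //; first by apply: sumr_ge0 => k _; exact: excess_ge0.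
  rewrite [leRHS](@big_cat_nat _ _ _ j) //= ler_wpDr //.
  by apply: sumr_ge0 => k _; exact: excess_ge0.
Qed.

End Integrable.
End Excess.

(** * Comparison of the two environments in the left half-plane *)

Section Localization.
Context (d : measure_display) (T : measurableType d) (R : realType).
Variable P : probability T R.
Variables (X X0 : edge -> T -> R) (nu : edge -> probability R R) (nu0 : probability R R).
Hypotheses (eX : environment P X nu) (eX0 : environment P X0 (fun=> nu0)).
Hypothesis nu_left : forall e, left_edge e -> nu e = nu0.

Lemma left_edges_shift (s : seq edge) : exists h : int, forall u : vtx, u.1 <= - h ->
  forall e, e \in s -> left_edge (shifte u e).
Proof.
elim: s => [|e s [h hh]]; first by exists 0.
exists (Num.max h (Num.max ((edge_ends e).1.1 + 1) ((edge_ends e).2.1 + 1))) => u hu e'.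
rewrite inE => /orP[/eqP->|]; last by apply: hh; lia.
by rewrite /left_edge edge_ends_shift /=; lia.
Qed.

(** Finitely many paths nearly realize the event [T(0, v) < s]; far to the left
    all of them only use edges of the left half-plane. *)
Lemma localize (v : vtx) (s b b' : R) : 0 < b' ->
  small P [set om | s <= ptime X0 om (0, 0) v] b ->
  exists h : int, forall u : vtx, u.1 <= - h ->
    small P [set om | s <= ptime X om u (shiftv u v)] (b + b').
Proof.
move=> b'0 sb.
pose Q p := path adjacent (0, 0) p && (last (0, 0) p == v).
pose A (n : nat) : set (@config R edge) :=
  if unpickle n is Some p then
    if Q p then [set w | s <= path_weight w (0, 0) p] else setT
  else setT.
(* No path among the first [N] codes has weight below [s]. The preimages under [sample X0] decrease
   to the event that the passage time is at least [s]; continuity from above then selects a finite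
   [N]. *)
pose C N := \bigcap_(n in `I_N) A n.
have mA n : measurable (A n).
  rewrite /A; case: unpickle => // p; case: ifP => // _.
  exact: (measurable_superlevel _ (measurable_path_weight _ p)).
have mC N : measurable (C N) by apply: fin_bigcap_measurable.
have mpre Y (D : set (@config R edge)) nu' : environment P Y nu' -> measurable D ->
    measurable (sample Y @^-1` D).
  move=> eY mD; rewrite -[X in measurable X]setTI.
  exact: (measurable_sample (env_measurable eY)).
have mT0 : measurable [set om | s <= ptime X0 om (0, 0) v].
  exact: measurable_superlevel (measurable_ptime _ _ eX0).
pose F N := sample X0 @^-1` C N.
have FE : \bigcap_N F N = [set om | s <= ptime X0 om (0, 0) v].
  apply/seteqP; split => om /= h; last first.
    move=> N _ n _; rewrite /A; case: unpickle => // p; case: ifP => // /andP[p1 /eqP p2].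
    by apply: le_trans h _; rewrite -p2; apply: passage_time_le => //; exact: env_ge0 eX0 om.
  apply: passage_time_ge => p p1 p2.
  have := h (pickle p).+1 I (pickle p) (ltnSn _).
  by rewrite /A pickleK /Q p1 p2 eqxx.
have [N hN] : exists N, (P (F N) <= (b + b')%:E)%E.
  have cv : (P \o F) n @[n --> \oo] --> P (\bigcap_N F N).
    apply: nonincreasing_cvg_mu.
    - by rewrite (le_lt_trans (probability_le1 _ _)) ?ltry //; exact: mpre eX0 (mC 0%N).
    - by move=> i; exact: mpre eX0 (mC i).
    - by rewrite FE.
    - move=> i j ij; apply/subsetPset => om h n /= nj; apply: h => /=.
      exact: leq_trans ij.
  have fin : P (\bigcap_N F N) = (fine (P (\bigcap_N F N)))%:E.
    by rewrite fineK // FE fin_num_measure.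
  move: cv; rewrite fin => /fine_cvgP[[N1 _ h1] /cvgrPdist_lt/(_ _ b'0)[N2 _ h2]].
  exists (maxn N1 N2).
  have := h1 (maxn N1 N2) (leq_maxl _ _) => /= h1'.
  have := h2 (maxn N1 N2) (leq_maxr _ _) => /=; rewrite ltr_norml => /andP[h2' _].
  rewrite -[leLHS]fineK // lee_fin.
  have : fine (P (\bigcap_N F N)) <= b.
    by rewrite -lee_fin -fin FE; exact: small_measurableE.
  by move: h2'; rewrite /=; lra.
pose es := flatten
  [seq (if unpickle n is Some p then path_edges (0, 0) p else [::]) | n <- iota 0 N].
have [h hh] := left_edges_shift es; exists h => u hu.
have eXu := env_reindex (aut_edge_inj (shift_aut u)) eX.
have law : P (sample (X \o shifte u) @^-1` C N) = P (F N).
  apply: (@env_same_law _ _ _ _ _ _ _ _ (mem es) _ eXu eX0) => //.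
    by move=> e /= ees; apply: nu_left; exact: hh.
  move=> w w' ww' Cw n /= nN; have := Cw n nN; rewrite /A.
  case E: (unpickle n) => [p|//]; case: ifP => // _ /=.
  rewrite !path_weightE => /le_trans; apply.
  rewrite le_eqVlt; apply/orP; left; apply/eqP; apply: eq_big_seq => e he; apply: ww'.
  apply/flattenP; exists (path_edges (0, 0) p) => //.
  by apply/mapP; exists n; rewrite ?mem_iota ?E.
exists (sample (X \o shifte u) @^-1` C N); split.
- exact: mpre eXu (mC N).
- move=> om /= hs n nN; rewrite /A; case: unpickle => // p; case: ifP => // /andP[p1 /eqP p2].
  apply: le_trans hs _.
  have E0 : u = shiftv u (0, 0) by case: (u) => a c; rewrite /shiftv /= !add0r.
  rewrite /ptime {1}E0 (passage_time_aut (shift_aut u)) -p2.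
  by apply: passage_time_le => // e; exact: env_ge0 eX om _.
- by rewrite law.
Qed.

Lemma localize_seq (vs : seq vtx) (s b b' : R) : 0 < b' ->
  (forall v, v \in vs -> small P [set om | s <= ptime X0 om (0, 0) v] b) ->
  exists h : int, forall u v : vtx, u.1 <= - h -> v \in vs ->
    small P [set om | s <= ptime X om u (shiftv u v)] (b + b').
Proof.
move=> b'0; elim: vs => [|v vs IH] hs; first by exists 0.
have [h1 hh1] := localize b'0 (hs v (mem_head _ _)).
have [|h2 hh2] := IH; first by move=> v' h; apply: hs; rewrite inE h orbT.
exists (Num.max h1 h2) => u v' hu; rewrite inE => /orP[/eqP->|].
  by apply: hh1; lia.
by apply: hh2; lia.
Qed.

End Localization.

(** * The upper comparison (U) *)

Section UpperBound.
Context (d : measure_display) (T : measurableType d) (R : realType).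
Variable P : probability T R.
Variables (X X0 : edge -> T -> R) (nu : edge -> probability R R) (nu0 : probability R R).
Hypotheses (eX : environment P X nu) (eX0 : environment P X0 (fun=> nu0)).
Hypothesis nu_left : forall e, left_edge e -> nu e = nu0.
Hypothesis intY : (\int[P]_om (Ymin X0 om)%:E < +oo)%E.
Variables (mb m : R * R -> R).
Hypotheses (tX : time_const P X mb) (tX0 : time_const P X0 m).

(** With [v = lattice_pt y], the possible values of [lattice_pt (x + y) - lattice_pt x]: the blocks
    along a segment have finitely many shapes, as [localize_seq] requires. *)
Definition neighbours (v : vtx) : seq vtx :=
  [seq shiftv v w | w <- [:: (0, 0); (1, 0); (0, 1); (1, 1)]].

Lemma floorD_neighbour (a b : R) :
  Num.floor (a + b) - Num.floor a = Num.floor b \/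
  Num.floor (a + b) - Num.floor a = Num.floor b + 1.
Proof.
have [a1 a2] := (@Num.Theory.ge_floor R a, @Num.Theory.floorD1_gt R a).
have [b1 b2] := (@Num.Theory.ge_floor R b, @Num.Theory.floorD1_gt R b).
have [c1 c2] := (@Num.Theory.ge_floor R (a + b), @Num.Theory.floorD1_gt R (a + b)).
rewrite !intrD in a2 b2 c2.
have h1 : (Num.floor a + Num.floor b - 1 < Num.floor (a + b))%R.
  by rewrite -(ltr_int R) !intrD intrN; lra.
have h2 : (Num.floor (a + b) < Num.floor a + Num.floor b + 2)%R.
  by rewrite -(ltr_int R) !intrD; lra.
have : Num.floor (a + b) = Num.floor a + Num.floor b \/
    Num.floor (a + b) = Num.floor a + Num.floor b + 1 by lia.
by case=> ->; [left|right]; ring.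
Qed.

Lemma lattice_pt_add (x y : R * R) : exists2 v : vtx,
  v \in neighbours (lattice_pt y) & lattice_pt (add2 x y) = shiftv (lattice_pt x) v.
Proof.
exists (Num.floor (x.1 + y.1) - Num.floor x.1, Num.floor (x.2 + y.2) - Num.floor x.2);
  last by rewrite /lattice_pt /shiftv /add2 /= !subrK.
rewrite /neighbours /= /shiftv /lattice_pt /= !inE !add0r.
by case: (floorD_neighbour x.1 y.1) => ->; case: (floorD_neighbour x.2 y.2) => ->;
  rewrite ?(addrC 1) !eqxx ?orbT.
Qed.

Lemma neighbours_close (y : R * R) v : v \in neighbours (lattice_pt y) -> close_to 2 v y.
Proof.
have [h1 h2] := lattice_pt_close y; move: h1 h2; rewrite !ler_norml.
move=> /andP[a1 a2] /andP[b1 b2].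
by rewrite !inE => /or4P[] /eqP->; rewrite /close_to /= !intrD !ler_norml;
  split; apply/andP; split; lra.
Qed.

Lemma l1dist_shift (u v : vtx) : l1dist u (shiftv u v) = l1dist (0, 0) v.
Proof. by rewrite /l1dist /shiftv /=; lia. Qed.

(** At a fixed scale [k], convergence in probability only fails on an event of small
    probability, where the passage time is bounded by [gap_control]. *)
Lemma block_bound (x : R * R) (e : R) : 0 < e ->
  exists k : nat, exists h : int, (0 < k)%N /\
  forall (u v : vtx), v \in neighbours (lattice_pt (scal2 k%:R x)) ->
    u.1 <= - h -> (shiftv u v).1 <= - h ->
  exists xi : T -> R, [/\ measurable_fun setT xi, forall om, 0 <= xi om,
    (\int[P]_om (xi om)%:E <= (k%:R * e)%:E)%E &
    forall om, ptime X om u (shiftv u v) <= k%:R * (m x + e) + xi om].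
Proof.
move=> e0.
(* A staircase across a block has at most [k * C] steps; the 4 accounts for rounding by 2 in each
   coordinate. *)
pose C : R := `|x.1| + `|x.2| + 4.
have C0 : 0 < C by rewrite /C; have := normr_ge0 x.1; have := normr_ge0 x.2; lra.
have e2C : 0 < e / 2 / C by rewrite !divr_gt0.
have [L L0 hL] := gap_control eX0 intY e2C.
(* The exceptional event has probability at most [b + b] and costs at most [L * (k * C)] on it: in
   mean, one half of [k * e]. The other half is left for the variable of [gap_control]. *)
pose b : R := e / 2 / (L * C) / 2.
have b0 : 0 < b by rewrite /b !divr_gt0 // mulr_gt0.
have [k0 hk] := tX0 x 2 e0 b0.
pose k := k0.+1.
have k_gt0 : 0 < k%:R :> R by rewrite ltr0n.
have hs v : v \in neighbours (lattice_pt (scal2 k%:R x)) ->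
    small P [set om | k%:R * (m x + e) <= ptime X0 om (0, 0) v] b.
  move=> /neighbours_close /(hk k (leqnSn _)); apply: small_sub => om /=.
  rewrite mulrDr => h; rewrite ler_normr; apply/orP; left; lra.
have [h hh] := localize_seq eX eX0 nu_left b0 hs.
exists k, (Num.max h 3); split => // u v hv hu hw.
have h3h : - Num.max h 3 <= - h by rewrite lerN2 le_max lexx.
have h33 : - Num.max h 3 <= -3 by rewrite lerN2 le_max lexx orbT.
have {}hh := hh u v (le_trans hu h3h) hv.
pose B := [set om | k%:R * (m x + e) <= ptime X om u (shiftv u v)].
have mB : measurable B by apply: measurable_superlevel; exact: measurable_ptime eX.
have PB : (P B <= (b + b)%:E)%E by exact: small_measurableE.
have [p [p1 p2 p3 p4]] := stair_path u (shiftv u v).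
have adj j : (j < size p)%N -> adjacent (nth u (u :: p) j) (nth u (u :: p) j.+1).
  by move=> jp; exact: (pathP _ p1).
have gd j : (j <= size p)%N -> good nu nu0 (nth u (u :: p) j).
  move=> jp; apply: good_left nu_left _; apply: le_trans (p4 _ (@mem_nth _ u (u :: p) j jp)) _.
  by rewrite ge_max (le_trans hu h33) (le_trans hw h33).
have [xi [mxi xi0 ixi hxi]] := hL X nu _ (size p) eX adj gd.
have sp : (size p)%:R <= k%:R * C.
  have -> : size p = l1dist (0, 0) v.
    by rewrite p3 -/(l1dist u (shiftv u v)) l1dist_shift.
  have [h1 h2] := neighbours_close hv.
  have a (z : int) (t : R) : `|z%:~R - k%:R * t| <= 2 -> `|z%:~R| <= k%:R * `|t| + 2 :> R.
    move=> hz; have := ler_normD (z%:~R - k%:R * t) (k%:R * t).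
    by rewrite subrK normrM ger0_norm ?ler0n //; lra.
  have := a _ _ h1; have := a _ _ h2.
  rewrite /l1dist natrD !natr_absz /= !sub0r !normrN !intr_norm /C !mulrDr.
  have : 4 <= k%:R * 4 :> R by rewrite ler_peMl // ler1n.
  lra.
have mI : measurable_fun setT (\1_B : T -> R) by exact: measurable_indic.
have mLI : measurable_fun setT (fun om => L * (k%:R * C) * \1_B om).
  by apply: measurable_funM => //; exact: measurable_cst.
exists (fun om => L * (k%:R * C) * \1_B om + xi om); split.
- exact: measurable_funD.
- by move=> om; rewrite addr_ge0 // !mulr_ge0 // ltW.
- under eq_integral do rewrite EFinD.
  rewrite ge0_integralD //; try exact/measurable_EFinP;
    try (by move=> om _; rewrite lee_fin !mulr_ge0 // ltW);
    try by move=> om _; rewrite lee_fin.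
  under eq_integral do rewrite EFinM.
  rewrite ge0_integralZl //; try exact/measurable_EFinP;
    try by rewrite lee_fin !mulr_ge0 // ltW.
  rewrite integral_indic // setIT.
  have -> : (k%:R * e)%:E = (k%:R * e / 2 + k%:R * e / 2)%:E by rewrite -splitr.
  rewrite EFinD leeD //.
    apply: (@le_trans _ _ ((L * (k%:R * C))%:E * (b + b)%:E)%E).
      by rewrite lee_wpmul2l // lee_fin !mulr_ge0 // ltW.
    rewrite -EFinM lee_fin /b -splitr le_eqVlt; apply/orP; left; apply/eqP.
    by field; rewrite !gt_eqF.
  apply: le_trans ixi _; rewrite lee_fin.
  apply: (@le_trans _ _ (k%:R * C * (e / 2 / C))); first by rewrite ler_wpM2r // ltW.
  by rewrite le_eqVlt; apply/orP; left; apply/eqP; field; rewrite gt_eqF.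
- move=> om /=; rewrite indicE; have [omB|omB] := boolP (om \in B); last first.
    rewrite mulr0 add0r; have : ~ B om by move=> Bom; move/negP: omB; apply; rewrite inE.
    by rewrite /B /= => /negP; rewrite -ltNge => /ltW h3; apply: le_trans h3 _;
      rewrite lerDl.
  rewrite mulr1; have := hxi om 0%N (size p); rewrite leqnn /= subn0 => /(_ isT).
  rewrite nth_last -[last _ _]/(last u p) p2 => h3; apply: le_trans h3 _.
  rewrite addrA lerD2r ler_wpDl //; last by rewrite ler_wpM2l // ltW.
  by rewrite mulr_ge0 ?ler0n // addr_ge0 ?(ltW e0) // (time_const_ge0 eX0 tX0).
Qed.

(** The points [n (y + (j/M) x)] all lie far to the left, so [block_bound] applies to each of
    the [M] blocks joining them; Markov's inequality controls the sum of the error terms. *)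
Lemma upper_local (x y : R * R) : y.1 < 0 -> (add2 y x).1 < 0 ->
  mb (add2 y x) <= mb y + m x.
Proof.
move=> y0 yx0.
(* The 7 is one for each of the limits at [y] and [y + x], one for the blocks and four for their
   error terms. The mean of these terms is at most n e, so Markov's inequality bounds the
   exceptional probability by 1/4. *)
apply: (@le_addepsP _ _ _ 7) => // e e0.
have [k [h [k0 hb]]] := block_bound x e0.
have k_gt0 : 0 < k%:R :> R by rewrite ltr0n.
have q0 : 0 < 4%:R^-1 :> R by rewrite invr_gt0.
have [n1 h1] := tX y 1 e0 q0.
have [n2 h2] := tX (add2 y x) 1 e0 q0.
pose c := Num.min (- y.1) (- (add2 y x).1).
have c0 : 0 < c by rewrite lt_min !oppr_gt0 y0.
have cy : c <= - y.1 by rewrite ge_min lexx.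
have cyx : c <= - (y.1 + x.1) by rewrite ge_min lexx orbT.
have [n3 hn3] : exists a : nat, `|h|%:~R / c <= a%:R.
  exists (Num.bound (`|h|%:~R / c)); apply/ltW/archi_boundP.
  by rewrite divr_ge0 ?ler0z // ltW.
pose M := (n1 + (n2 + n3.+1))%N.
have n2M : (n2 <= M)%N := leq_trans (leq_addr _ _) (leq_addl _ _).
have n3M : (n3 <= M)%N.
  exact: leq_trans (leqnSn n3) (leq_trans (leq_addl n2 _) (leq_addl n1 _)).
have M_gt0 : 0 < M%:R :> R by rewrite ltr0n /M !addnS.
pose n := (k * M)%N.
have nE : n%:R = k%:R * M%:R :> R by rewrite natrM.
have nM : (M <= n)%N by rewrite /n leq_pmull.
have n_gt0 : 0 < n%:R :> R by rewrite nE mulr_gt0.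
pose w j := add2 (scal2 n%:R y) (scal2 j%:R (scal2 k%:R x)).
pose u j := lattice_pt (w j).
have uh j : (j <= M)%N -> (u j).1 <= - h.
  move=> jM; rewrite -(ler_int R); apply: le_trans (Num.Theory.ge_floor _) _.
  rewrite intrN /w /= nE.
  have hM : `|h|%:~R <= M%:R * c.
    rewrite -ler_pdivrMr //; by apply: le_trans hn3 _; rewrite ler_nat.
  have hh : h%:~R <= `|h|%:~R :> R by rewrite ler_int ler_norm.
  have jM' : j%:R <= M%:R :> R by rewrite ler_nat.
  have a1 : (M%:R - j%:R) * c <= (M%:R - j%:R) * (- y.1) by rewrite ler_wpM2l // subr_ge0.
  have a2 : j%:R * c <= j%:R * (- (y.1 + x.1)) by rewrite ler_wpM2l.
  have a3 : M%:R * c <= k%:R * (M%:R * c).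
    by rewrite ler_peMl ?ler1n // mulr_ge0 // ltW.
  have a4 : k%:R * (M%:R * y.1 + j%:R * x.1) <= k%:R * (- (M%:R * c)).
    by rewrite ler_wpM2l //; lra.
  have -> : k%:R * M%:R * y.1 + j%:R * (k%:R * x.1) = k%:R * (M%:R * y.1 + j%:R * x.1) by ring.
  by move: a3 a4 hM hh; lra.
have step j : exists xi : T -> R, (j < M)%N -> [/\ measurable_fun setT xi,
    forall om, 0 <= xi om, (\int[P]_om (xi om)%:E <= (k%:R * e)%:E)%E &
    forall om, ptime X om (u j) (u j.+1) <= k%:R * (m x + e) + xi om].
  have [jM|jM] := ltnP j M; last by exists (fun=> 0).
  have wE : w j.+1 = add2 (w j) (scal2 k%:R x).
    by rewrite /w /add2 /scal2 /=; congr (_, _); rewrite -natr1; ring.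
  have [v hv uE] := lattice_pt_add (w j) (scal2 k%:R x).
  rewrite -wE in uE.
  have uh1 := uh j.+1 jM; rewrite /u uE in uh1.
  have [xi hxi] := hb (u j) v hv (uh j (ltnW jM)) uh1.
  by exists xi => _; rewrite /u uE.
have [xi hxi] := choice step.
pose Z om := \sum_(0 <= j < M | (j < M)%N) xi j om.
have mZ : measurable_fun setT Z.
  rewrite /Z; under eq_fun do rewrite big_mkcond.
  apply: measurable_sum => j.
  by have [jM|_] := boolP (j < M)%N; [have [] := hxi j jM|exact: measurable_cst].
have Z0 om : 0 <= Z om.
  by apply: sumr_ge0 => j jM; have [] := hxi j jM.
have iZ : (\int[P]_om (Z om)%:E <= (n%:R * e)%:E)%E.
  have E : (\int[P]_om (Z om)%:E =
      \sum_(0 <= j < M) \int[P]_om (if (j < M)%N then xi j om else 0)%:E)%E.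
    rewrite -ge0_integral_sum //.
    - apply: eq_integral => om _; rewrite /Z big_mkcond -sumEFin.
      by apply: eq_bigr => j _.
    - move=> j; apply/measurable_EFinP.
      by have [jM|_] := boolP (j < M)%N; [have [] := hxi j jM|exact: measurable_cst].
    - by move=> j om _; rewrite lee_fin; case: ifP => // jM; have [] := hxi j jM.
  rewrite E.
  have -> : (n%:R * e)%:E = (\sum_(0 <= j < M) (k%:R * e)%:E)%E.
    by rewrite sumEFin big_const_nat subn0 iter_addr addr0 -mulr_natl nE; congr EFin; ring.
  rewrite big_nat_cond [leRHS]big_nat_cond; apply: lee_sum => j.
  by rewrite andbT => /andP[_ jM]; rewrite jM; have [] := hxi j jM.
have chain om : ptime X om (u 0%N) (u M) <= n%:R * (m x + e) + Z om.
  have H j : (j <= M)%N -> ptime X om (u 0%N) (u j) <=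
      j%:R * (k%:R * (m x + e)) + \sum_(0 <= i < j | (i < M)%N) xi i om.
    elim: j => [_|j IH jM].
      by rewrite big_geq // mul0r addr0 /ptime passage_time_refl //; exact: env_ge0 eX om.
    apply: le_trans (passage_time_triangle _ (u j) _ (env_ge0 eX om)) _.
    rewrite big_mkcond big_nat_recr //= jM -natr1 -big_mkcond mulrDl mul1r addrACA.
    by apply: lerD; [exact: IH (ltnW jM)|have [_ _ _] := hxi j jM; exact].
  have := H M (leqnn _); rewrite nE mulrCA mulrA; exact.
have s3 := @markov_small _ _ _ P Z (n%:R * e) (n%:R * e * 4) mZ Z0 iZ.
have {}s3 := s3 (ltac:(by rewrite !mulr_gt0)).
have u0 : close_to 1 (u 0%N) (scal2 n%:R y).
  have := lattice_pt_close (w 0%N); rewrite /u.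
  by have -> : w 0%N = scal2 n%:R y; rewrite // /w /add2 /scal2 /= !mul0r !addr0.
have uM : close_to 1 (u M) (scal2 n%:R (add2 y x)).
  have := lattice_pt_close (w M); rewrite /u.
  have -> : w M = scal2 n%:R (add2 y x); last by [].
  by rewrite /w /add2 /scal2 /= nE; congr (_, _); ring.
have s1 := h1 n (leq_trans (leq_addr _ _) nM) _ u0.
have s2 := h2 n (leq_trans n2M nM) _ uM.
have s3' : small P [set om | n%:R * e * 4 <= Z om] 4^-1.
  by apply: small_le s3; rewrite invfM mulrA divff ?mul1r // mulf_neq0 // gt_eqF.
have [|om [g1 g2 g3]] := small3_exists _ s1 s2 s3'.
  by rewrite ltf_pV2 ?posrE // ltr_nat.
move: g1 g2 g3 => /= /negP; rewrite -ltNge ltr_norml => /andP[g1 g1'].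
move=> /negP; rewrite -ltNge ltr_norml => /andP[g2 g2'] /negP; rewrite -ltNge => g3.
have := passage_time_triangle (0, 0) (u 0%N) (u M) (env_ge0 eX om).
have := chain om; rewrite -!/(ptime _ _ _ _) => ch tr.
by rewrite -(ler_pM2l n_gt0) !mulrDr; rewrite mulrDr in ch; lra.
Qed.

End UpperBound.

(** * Paths leaving a lattice box *)

Definition supdist (u z : vtx) : int := Num.max `|z.1 - u.1| `|z.2 - u.2|.

(** Parametrizes the boundary of the box of radius [N]: [bs.1] tells whether the first coordinate is
    the extreme one, [bs.2] gives its sign, and [t] runs from 0 to 2N along the side. One formula
    covers the lattice box and its scaling limit. *)
Definition side_pt {K : pzRingType} (bs : bool * bool) (N t : K) : K * K :=
  let a := if bs.2 then N else - N in
  if bs.1 then (a, t - N) else (t - N, a).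

Definition side_vtx (bs : bool * bool) (N j : nat) : vtx := side_pt bs N%:Z j%:Z.

Lemma side_vtx_adj bs N j : adjacent (side_vtx bs N j) (side_vtx bs N j.+1).
Proof.
by case: bs => [[|] [|]]; rewrite /side_vtx /side_pt /adjacent /=; apply/eqP; lia.
Qed.

Lemma side_vtx_le bs N j : (j <= 2 * N)%N -> (side_vtx bs N j).1 <= N%:Z.
Proof. by case: bs => [[|] [|]]; rewrite /side_vtx /side_pt /=; lia. Qed.

Lemma supdist_side c z (N : nat) : supdist c z = N%:Z -> exists bs j,
  (j <= 2 * N)%N /\ z = shiftv c (side_vtx bs N j).
Proof.
case: c z => [c1 c2] [z1 z2]; rewrite /supdist /= => h.
have : [\/ z1 - c1 = N%:Z /\ `|z2 - c2| <= N%:Z, z1 - c1 = - N%:Z /\ `|z2 - c2| <= N%:Z,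
  z2 - c2 = N%:Z /\ `|z1 - c1| <= N%:Z | z2 - c2 = - N%:Z /\ `|z1 - c1| <= N%:Z].
  have : (z1 - c1 = N%:Z /\ `|z2 - c2| <= N%:Z) \/ (z1 - c1 = - N%:Z /\ `|z2 - c2| <= N%:Z)
    \/ (z2 - c2 = N%:Z /\ `|z1 - c1| <= N%:Z) \/ (z2 - c2 = - N%:Z /\ `|z1 - c1| <= N%:Z).
    by lia.
  by case=> [|[|[|]]]; [constructor 1|constructor 2|constructor 3|constructor 4].
case=> -[e le]; [exists (true, true), (absz (z2 - c2 + N%:Z))
  |exists (true, false), (absz (z2 - c2 + N%:Z))
  |exists (false, true), (absz (z1 - c1 + N%:Z))
  |exists (false, false), (absz (z1 - c1 + N%:Z))];
  rewrite /side_vtx /side_pt /shiftv /=; split; try lia; congr (_, _); lia.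
Qed.

Lemma supdist_step u a b : adjacent a b -> supdist u b <= supdist u a + 1.
Proof.
by case: u a b => [u1 u2] [a1 a2] [b1 b2] /adjacentP /= h; rewrite /supdist /=;
  case: h => -[-> ->]; lia.
Qed.

Lemma first_exit u (N : int) a p : supdist u a <= N -> path adjacent a p ->
  N <= supdist u (last a p) -> exists p1 p2, [/\ p = p1 ++ p2,
    supdist u (last a p1) = N & forall z, z \in a :: p1 -> supdist u z <= N].
Proof.
elim: p a => [|b p IH] a aN /=.
  move=> _ Na; exists [::], [::]; split => //=; first by apply/le_anti; rewrite aN Na.
  by move=> z; rewrite inE => /eqP->.
move=> /andP[ab bp] Nl.
have [aE|aE] := eqVneq (supdist u a) N.
  exists [::], (b :: p); split => //= z; by rewrite inE => /eqP->.
have bN : supdist u b <= N.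
  apply: le_trans (supdist_step u ab) _; move: aN aE.
  by move: (supdist u a) => x; lia.
have [p1 [p2 [-> h1 h2]]] := IH b bN bp Nl.
exists (b :: p1), p2; split => // z; rewrite inE => /orP[/eqP->//|]; exact: h2.
Qed.

Lemma path_edges_left a p : path adjacent a p ->
  (forall z, z \in a :: p -> z.1 < 0 :> int) ->
  forall e, e \in path_edges a p -> left_edge e.
Proof.
elim: p a => //= b p IH a /andP[ab bp] h e; rewrite inE => /orP[/eqP->|]; last first.
  by apply: IH => // z hz; apply: h; rewrite inE hz orbT.
have := h a (mem_head _ _); have := h b; rewrite !inE eqxx orbT => /(_ isT).
case: a b ab {IH bp h} => [a1 a2] [b1 b2] /adjacentP /= ab b0 a0.
rewrite /left_edge /step_edge /= !pair_intE.
by case: ab => -[e1 e2]; (do ?case: ifP) => /=; lia.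
Qed.

Section LowerBound.
Context (d : measure_display) (T : measurableType d) (R : realType).
Variable P : probability T R.
Variables (X X0 : edge -> T -> R) (nu : edge -> probability R R) (nu0 : probability R R).
Hypotheses (eX : environment P X nu) (eX0 : environment P X0 (fun=> nu0)).
Hypothesis nu_left : forall e, left_edge e -> nu e = nu0.
Hypothesis intY : (\int[P]_om (Ymin X0 om)%:E < +oo)%E.
Variables (mb m : R * R -> R).
Hypotheses (tX : time_const P X mb) (tX0 : time_const P X0 m).

(** A path inside [B] only uses left edges, so the existence of a light one has the same probability
    in both environments; in [X0] it forces a small passage time. All end points are treated in a
    single event, as their number grows with n. *)
Lemma left_transfer (c : vtx) (B : set vtx) (th : vtx -> R) (b : R) :
  (forall z, B z -> z.1 < 0 :> int) ->
  small P [set om | exists2 v, B v & ptime X0 om c v < th v] b ->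
  small P [set om | exists p, [/\ path adjacent c p, forall z, z \in c :: p -> B z &
    path_weight (X^~ om) c p < th (last c p)]] b.
Proof.
move=> B0 sb.
pose Q p := path adjacent c p && `[< forall z, z \in c :: p -> B z >].
pose A := \bigcup_p (if Q p then
  [set w : @config R edge | path_weight w c p < th (last c p)] else set0).
have mA : measurable A.
  apply: countable_bigcup_measurable => p; case: ifP => // _.
  exact: measurable_path_weight_lt.
have mpre Y nu' : environment P Y nu' -> measurable (sample Y @^-1` A).
  move=> eY; rewrite -[X in measurable X]setTI.
  exact: (measurable_sample (env_measurable eY)).
have law : P (sample X @^-1` A) = P (sample X0 @^-1` A).
  apply: (@env_same_law _ _ _ _ _ _ _ _ left_edge _ eX eX0) => //.
  move=> w w' ww' [p _]; case: ifP => // Qp h; exists p => //; rewrite Qp.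
  move: h; rewrite /= !path_weightE; congr (_ < _); apply: eq_big_seq => e he; apply: ww'.
  move/andP: Qp => [p1 /asboolP p2]; apply: (path_edges_left p1) he => z hz.
  exact/B0/p2.
exists (sample X @^-1` A); split; first exact: mpre eX.
  move=> om [p [p1 p2 p3]]; exists p => //.
  by rewrite /Q p1 (_ : `[< _ >] = true) //; apply/asboolP.
rewrite law; apply: small_measurableE; first exact: mpre eX0.
apply: small_sub sb => om [p _]; case: ifP => // /andP[p1 /asboolP p2] h.
exists (last c p); first by apply: p2; exact: mem_last.
by apply: le_lt_trans h; exact: (passage_time_le (env_ge0 eX0 om) p1).
Qed.

Lemma time_const_seq Y (my : R * R -> R) (xs : seq (R * R)) (C e b : R) :
  time_const P Y my -> 0 < e -> 0 < b ->
  exists n0 : nat, forall n, (n0 <= n)%N -> forall x, x \in xs -> forall v,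
  close_to C v (scal2 n%:R x) ->
  small P [set om | n%:R * e <= `|ptime Y om (0, 0) v - n%:R * my x|] b.
Proof.
move=> tY e0 b0; elim: xs => [|x xs [n1 h1]]; first by exists 0%N.
have [n2 h2] := tY x C e b e0 b0.
exists (maxn n1 n2) => n; rewrite geq_max => /andP[nn1 nn2] x'.
by rewrite inE => /orP[/eqP->|]; [exact: h2|exact: h1].
Qed.

Lemma gap_control2 (e : R) : 0 < e -> exists2 L, 0 < L &
  forall Y nuY (s : nat -> vtx) N (t : R), environment P Y nuY -> 0 < t ->
  (forall k, (k < N)%N -> adjacent (s k) (s k.+1)) ->
  (forall k, (k <= N)%N -> good nuY nu0 (s k)) ->
  small P [set om | exists i j, [/\ (i <= N)%N, (j <= N)%N &
    L * `|i%:R - j%:R| + t <= ptime Y om (s i) (s j)]] (N%:R * e / t).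
Proof.
move=> e0; have [L L0 hL] := gap_control eX0 intY e0; exists L => //.
move=> Y nuY s N t eY t0 adj gs; have [xi [mxi xi0 ixi hxi]] := hL Y nuY s N eY adj gs.
apply: small_sub (markov_small mxi xi0 ixi t0) => om [i [j [iN jN h]]] /=.
wlog ij : i j iN jN h / (i <= j)%N.
  move=> H; have [ij|/ltnW ji] := leqP i j; first exact: (H i j).
  apply: (H j i) => //; rewrite distrC /ptime passage_time_sym //; exact: env_ge0 eY om.
have := hxi om i j; rewrite ij jN => /(_ isT).
by move: h; rewrite distrC -natrB // ger0_norm ?ler0n //; lra.
Qed.

End LowerBound.

Section Grid.
Context {R : realType}.
Implicit Types (r n : R).

Lemma grid_select r n (K N j : nat) : 0 < r -> 0 < n -> (0 < K)%N ->
  N%:R <= n * r -> (j <= 2 * N)%N -> exists i : nat, (i <= K)%N /\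
  `|j%:R - n * (2 * r * i%:R / K%:R)| <= n * (2 * r / K%:R).
Proof.
move=> r0 n0 K0 Nr jN.
have K0' : 0 < K%:R :> R by rewrite ltr0n.
have q0 : 0 < n * (2 * r / K%:R) by rewrite mulr_gt0 // divr_gt0 // mulr_gt0.
have j0 : 0 <= j%:R / (n * (2 * r / K%:R)) by rewrite divr_ge0 // ltW.
have jnr : j%:R <= 2 * (n * r).
  by apply: (@le_trans _ _ (2 * N%:R)); rewrite -?natrM ?ler_nat // natrM ler_pM2l.
have /andP[i1 i2] := natr_trunc_close j0.
set i := Num.trunc _ in i1 i2.
rewrite ler_pdivlMr // in i1; rewrite ltr_pdivrMr // in i2.
exists i; split.
  rewrite -(ler_nat R) -(ler_pM2r q0); apply: le_trans i1 _; apply: le_trans jnr _.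
  by rewrite le_eqVlt; apply/orP; left; apply/eqP; field; rewrite gt_eqF.
have E : n * (2 * r * i%:R / K%:R) = i%:R * (n * (2 * r / K%:R)) by field; rewrite gt_eqF.
by rewrite E ler_norml; apply/andP; split; move: i1 i2; rewrite ?mulrDl ?mul1r; lra.
Qed.

(** The integer part of the scaled grid point can exceed [2 * N], because [N] is itself rounded down
    from n r; the end of the side is then taken instead, at distance less than 2. *)
Lemma grid_point r n (K N i : nat) : 0 < r -> 0 < n -> (0 < K)%N -> (i <= K)%N ->
  N%:R <= n * r < N%:R + 1 -> exists g : nat, (g <= 2 * N)%N /\
  `|g%:R - n * (2 * r * i%:R / K%:R)| <= 3.
Proof.
move=> r0 n0 K0 iK /andP[N1 N2].
have K0' : 0 < K%:R :> R by rewrite ltr0n.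
set t := n * _.
have t0 : 0 <= t.
  by rewrite /t !mulr_ge0 ?invr_ge0 ?ler0n // ltW.
have tn : t <= 2 * (n * r).
  have -> : t = 2 * (n * r) * (i%:R / K%:R) by rewrite /t; field; rewrite gt_eqF.
  rewrite ler_piMr //; first by rewrite !mulr_ge0 // ltW.
  by rewrite ler_pdivrMr // mul1r ler_nat.
have /andP[g1 g2] := natr_trunc_close t0.
set g := Num.trunc t in g1 g2.
have [gN|Ng] := leqP g (2 * N); [exists g|exists (2 * N)%N]; split => //.
  by rewrite ler_norml; apply/andP; split; lra.
have : (2 * N)%:R <= g%:R :> R by rewrite ler_nat ltnW.
by rewrite natrM ler_norml => h; apply/andP; split; lra.
Qed.

Lemma side_close bs (N g : nat) r n t : `|N%:R - n * r| <= 1 -> `|g%:R - n * t| <= 3 ->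
  close_to 4 (side_vtx bs N g) (scal2 n (side_pt bs r t)).
Proof.
rewrite !ler_norml => /andP[a1 a2] /andP[b1 b2].
by case: bs => [[|] [|]]; rewrite /close_to /side_vtx /side_pt /scal2 /= ?intrB ?intrN;
  rewrite -![_%:~R]/(_%:R : R) !ler_norml ?mulrBr ?mulrN;
  split; apply/andP; split; lra.
Qed.

Lemma side_pt_le bs r t : 0 < r -> 0 <= t <= 2 * r -> (side_pt bs r t).1 <= r.
Proof. by move=> r0 /andP[t1 t2]; case: bs => [[|] [|]]; rewrite /side_pt /=; lra. Qed.

Lemma side_pt_far bs r t : 0 < r ->
  r <= `|(side_pt bs r t).1| \/ r <= `|(side_pt bs r t).2|.
Proof.
by move=> r0; case: bs => [[|] [|]]; rewrite /side_pt /=; [left|left|right|right];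
  rewrite ?normrN gtr0_norm.
Qed.

End Grid.

Lemma supdist_left c z (N : nat) : c.1 + N%:Z <= -3 -> supdist c z <= N%:Z -> z.1 <= -3.
Proof.
case: c z => [c1 c2] [z1 z2]; rewrite /supdist /= ge_max => h /andP[h1 _].
by move: h h1; lia.
Qed.

Lemma supdist_refl c (N : nat) : supdist c c <= N%:Z.
Proof. by rewrite /supdist !subrr normr0 maxxx. Qed.

Lemma supdist_origin c (N : nat) : c.1 + N%:Z <= -3 -> N%:Z <= supdist c (0, 0).
Proof.
by case: c => [c1 c2]; rewrite /supdist /= le_max => h; apply/orP; left; lia.
Qed.

Lemma side_left c bs (N j : nat) : c.1 + N%:Z <= -3 -> (j <= 2 * N)%N ->
  (shiftv c (side_vtx bs N j)).1 <= -3.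
Proof.
by move=> h /(side_vtx_le bs) h2; apply: le_trans (lerD h2 (lexx c.1)) _; rewrite addrC.
Qed.

(** * The lower comparison (L) *)

Section LowerBoundLocal.
Context (d : measure_display) (T : measurableType d) (R : realType).
Variable P : probability T R.
Variables (X X0 : edge -> T -> R) (nu : edge -> probability R R) (nu0 : probability R R).
Hypotheses (eX : environment P X nu) (eX0 : environment P X0 (fun=> nu0)).
Hypothesis nu_left : forall e, left_edge e -> nu e = nu0.
Hypothesis intY : (\int[P]_om (Ymin X0 om)%:E < +oo)%E.
Variables (mb m : R * R -> R).
Hypotheses (tX : time_const P X mb) (tX0 : time_const P X0 m).

(** A path from [n y] to the origin leaves the box of radius [n r] around [n y]; up to its first
    exit it only uses edges of the left half-plane. The exit point is replaced by one of boundedly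
    many grid points on the boundary of the box at a cost given by [gap_control2]. *)
Lemma lower_local9 (y : R * R) (r e : R) : 0 < r -> y.1 + r < 0 -> 0 < e ->
  exists z : R * R, [/\ z.1 <= y.1 + r, r <= `|z.1 - y.1| \/ r <= `|z.2 - y.2| &
    mb z + m (sub2 z y) <= mb y + 9 * e].
Proof.
move=> r0 yr0 e0.
(* A side has at most 2 n r steps; with error threshold n e, the constant 64 gives probability 1/32
   per side, hence 1/8 for the four sides. *)
have [|L L0 hL] := @gap_control2 _ _ _ P X0 nu0 eX0 intY (e / (64 * r)).
  by rewrite divr_gt0 // mulr_gt0.
(* The mesh [2 * r / K] is fine enough that moving to the nearest grid point costs at most n e. *)
have [K' hK'] : exists a : nat, 2 * r * L / e <= a%:R.
  exists (Num.bound (2 * r * L / e)); apply/ltW/archi_boundP.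
  by rewrite divr_ge0 // ?mulr_ge0 // ltW.
pose K := K'.+1.
have K0 : 0 < K%:R :> R by rewrite ltr0n.
have Lh : L * (2 * r / K%:R) <= e.
  rewrite mulrA ler_pdivrMr // /K -[K'.+1%:R]natr1 mulrDr mulr1.
  by move: hK'; rewrite ler_pdivrMr //; lra.
pose ts (i : nat) : R := 2 * r * i%:R / K%:R.
have ts0 i : (i <= K)%N -> 0 <= ts i <= 2 * r.
  move=> iK; rewrite /ts -mulrA; apply/andP; split.
    by rewrite !mulr_ge0 ?invr_ge0 ?ler0n // ltW.
  by rewrite ler_piMr ?mulr_ge0 ?(ltW r0) // ler_pdivrMr // mul1r ler_nat.
pose idx : seq (bool * bool * nat) :=
  [seq (bs, i) | bs <- [:: (true, true); (true, false); (false, true); (false, false)],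
                 i <- iota 0 K.+1].
have idxP bs i : (i <= K)%N -> (bs, i) \in idx.
  by move=> iK; apply: allpairs_f; [case: bs => [[|] [|]]|rewrite mem_iota].
have idxK a : a \in idx -> (a.2 <= K)%N.
  by move=> /allpairsP[[bs i] [_ hi ->]]; move: hi; rewrite mem_iota.
pose off (a : bool * bool * nat) : R * R := side_pt a.1 r (ts a.2).
pose S : R := (size idx)%:R.
(* Two union bounds over the grid, two gap events of probability 1/8 and the limit at [y] then add
   up to less than 1/2. *)
pose b : R := (8 * (S + 1))^-1.
have S0 : 0 <= S by rewrite ler0n.
have b0 : 0 < b by rewrite invr_gt0 mulr_gt0 // ltr_wpDl.
have [n1 h1] := time_const_seq [seq add2 y (off a) | a <- idx] 5 tX e0 b0.
have [n2 h2] := time_const_seq [seq off a | a <- idx] 4 tX0 e0 b0.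
have [n3 h3] := tX y 1 e0 b0.
have [n4 h4] : exists a : nat, 3 * L / e <= a%:R.
  exists (Num.bound (3 * L / e)); apply/ltW/archi_boundP.
  by rewrite divr_ge0 // ?mulr_ge0 // ltW.
have [n5 h5] : exists a : nat, 5 / (- (y.1 + r)) <= a%:R.
  exists (Num.bound (5 / (- (y.1 + r)))); apply/ltW/archi_boundP.
  by rewrite divr_ge0 // oppr_ge0 ltW.
pose n := (maxn n1 (maxn n2 (maxn n3 (maxn n4 n5)))).+1.
have [nn1 nn2 nn3 nn4 nn5] : [/\ (n1 <= n)%N, (n2 <= n)%N, (n3 <= n)%N, (n4 <= n)%N & (n5 <= n)%N].
  by split; apply: leqW; rewrite !leq_max leqnn ?orbT.
have n0 : 0 < n%:R :> R by rewrite ltr0n.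
have ne0 : 0 < n%:R * e by rewrite mulr_gt0.
have nL : 3 * L <= n%:R * e.
  by rewrite -ler_pdivrMr //; apply: le_trans h4 _; rewrite ler_nat.
have nyr : n%:R * (y.1 + r) <= -5.
  have y0 : 0 < - (y.1 + r) by rewrite oppr_gt0.
  suff : 5 <= n%:R * - (y.1 + r) by rewrite mulrN; lra.
  by rewrite -ler_pdivrMr //; apply: le_trans h5 _; rewrite ler_nat.
pose c := lattice_pt (scal2 n%:R y).
have hc : close_to 1 c (scal2 n%:R y) by exact: lattice_pt_close.
have nr0 : 0 <= n%:R * r by rewrite mulr_ge0 // ltW.
have NP := natr_trunc_close nr0.
set N := Num.trunc _ in NP.
have [N1 N2] := andP NP.
have Ncl : `|N%:R - n%:R * r| <= 1 by rewrite ler_norml; apply/andP; split; lra.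
have cN : c.1 + N%:Z <= -3.
  rewrite -(ler_int R) intrD intrN; have [+ _] := hc; rewrite ler_norml => /andP[_] /=.
  rewrite mulrDr in nyr; rewrite -[N%:~R]/(N%:R : R); lra.
have gex i : exists a : nat, (i <= K)%N ->
    (a <= 2 * N)%N /\ `|a%:R - n%:R * ts i| <= 3.
  have [iK|iK] := leqP i K; last by exists 0%N.
  by have [a ha] := grid_point r0 n0 (ltn0Sn K') iK NP; exists a.
have [g hg] := choice gex.
have selex j : exists a : nat, (j <= 2 * N)%N ->
    (a <= K)%N /\ `|j%:R - n%:R * ts a| <= n%:R * (2 * r / K%:R).
  have [jN|jN] := leqP j (2 * N); last by exists 0%N.
  by have [a ha] := grid_select r0 n0 (ltn0Sn K') N1 jN; exists a.
have [sel hsel] := choice selex.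
(* A corner lies on two sides. The choice has to be made once and for all, since the thresholds [th]
   below must not depend on the sample point. *)
have pkex v : exists f : (bool * bool) * nat, supdist c v = N%:Z ->
    (f.2 <= 2 * N)%N /\ v = shiftv c (side_vtx f.1 N f.2).
  have [E|E] := eqVneq (supdist c v) N%:Z; last first.
    by exists ((true, true), 0%N) => E'; rewrite E' eqxx in E.
  by have [bs [j hj]] := supdist_side E; exists (bs, j).
have [pk hpk] := choice pkex.
pose pt (a : bool * bool * nat) := shiftv c (side_vtx a.1 N (g a.2)).
pose near_idx v := ((pk v).1, sel (pk v).2).
pose sides : seq (bool * bool) :=
  [:: (true, true); (true, false); (false, true); (false, false)].
pose gapbad Y := [set om : T | exists2 bs, bs \in sides &
  exists i j, [/\ (i <= 2 * N)%N, (j <= 2 * N)%N &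
    L * `|i%:R - j%:R| + n%:R * e <=
    ptime Y om (shiftv c (side_vtx bs N i)) (shiftv c (side_vtx bs N j))]].
have gapsmall Y nuY : environment P Y nuY -> (forall v, v.1 <= -3 :> int -> good nuY nu0 v) ->
    small P (gapbad Y) 8^-1.
  move=> eY gY.
  have -> : 8^-1 = 4%:R * 32^-1 :> R by field.
  apply: small_bigU => bs _.
  have hb : (2 * N)%:R * (e / (64 * r)) / (n%:R * e) <= 32^-1.
    rewrite ler_pdivrMr // natrM.
    have -> : 32^-1 * (n%:R * e) = 2 * (n%:R * r) * (e / (64 * r)) by field; rewrite gt_eqF.
    by rewrite ler_pM2r ?divr_gt0 ?mulr_gt0 // ler_pM2l.
  apply: small_le hb _; apply: hL eY ne0 _ _ => k kN.
    by rewrite (aut_adj (shift_aut c)); exact: side_vtx_adj.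
  exact/gY/side_left.
(* One n e pays for the mesh of the grid, one for the rounding by 3 of the grid points, and one is
   the threshold in [gapbad]. *)
have gap_near Y om v : ~ gapbad Y om -> supdist c v = N%:Z ->
    ptime Y om v (pt (near_idx v)) < 3 * (n%:R * e).
  move=> hgap /hpk[jN vE].
  have [sK hs] := hsel _ jN; have [gN hg'] := hg _ sK.
  rewrite ltNge; apply/negP => h; apply: hgap.
  exists (pk v).1; first by case: (pk v).1 => [[|] [|]].
  exists (pk v).2, (g (sel (pk v).2)); split => //.
  rewrite -vE; apply: le_trans h.
  have hd : `|(pk v).2%:R - (g (sel (pk v).2))%:R| <= n%:R * (2 * r / K%:R) + 3.
    have := ler_distD (n%:R * ts (sel (pk v).2)) (pk v).2%:R (g (sel (pk v).2))%:R.
    rewrite (distrC (n%:R * ts (sel (pk v).2))).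
    by clear -hs hg'; lra.
  have := ler_wpM2l (ltW L0) hd; rewrite mulrDr mulrCA.
  by have := ler_wpM2l (ltW n0) Lh; clear -nL; lra.
have sA : small P [set om | exists2 a, a \in idx &
    n%:R * e <= `|ptime X om (0, 0) (pt a) - n%:R * mb (add2 y (off a))|] (S * b).
  apply: small_bigU => a ai; apply: (h1 n nn1 (add2 y (off a)) _ (pt a)).
    by apply/mapP; exists a.
  have := close_add hc (side_close a.1 Ncl (hg _ (idxK a ai)).2).
  have -> : 1 + 4 = 5 :> R by ring.
  by rewrite /add2 /scal2 /= !mulrDr.
have sB : small P [set om | exists2 a, a \in idx &
    n%:R * e <= `|ptime X0 om c (pt a) - n%:R * m (off a)|] (S * b).
  apply: small_bigU => a ai.
  have := h2 n nn2 _ (map_f off ai) _ (side_close a.1 Ncl (hg _ (idxK a ai)).2).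
  move=> /(small_shift (c := c) eX0 (fun _ => erefl) (measurable_deviation _ _)).
  have -> : shiftv c (0, 0) = c by case: (c) => u v; rewrite /shiftv /= !add0r.
  exact.
have sGX := gapsmall _ _ eX (fun v h => good_left nu_left h).
have sGX0 := gapsmall _ _ eX0 (fun v _ _ _ _ _ => erefl).
(* On the boundary, 3 is the cost of reaching the grid point and 1 the error of the limit in [X0].
   Elsewhere the value 0 makes the event empty, since passage times are nonnegative. *)
pose th v := if supdist c v == N%:Z then n%:R * m (off (near_idx v)) - 4 * (n%:R * e) else 0.
have idx_near v : supdist c v = N%:Z -> near_idx v \in idx.
  by move=> /hpk[jN _]; apply: idxP; exact: (hsel _ jN).1.
have sL : small P [set om | exists p, [/\ path adjacent c p,
    forall z, z \in c :: p -> supdist c z <= N%:Z &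
    path_weight (X^~ om) c p < th (last c p)]] (S * b + 8^-1).
  apply: (left_transfer eX eX0 nu_left (B := [set z | supdist c z <= N%:Z])).
    by move=> z /(supdist_left cN) hz; exact: le_lt_trans hz _.
  apply: small_sub (smallU sB sGX0) => om [v _].
  rewrite /th; case: eqP => [vN|_]; last first.
    have := passage_time_ge0 c v (env_ge0 eX0 om); rewrite -/(ptime _ _ _ _).
    by rewrite leNgt => /negP.
  move=> h; have [hgap|hgap] := pselect (gapbad X0 om); [by right|left].
  have h6 := gap_near X0 om v hgap vN.
  exists (near_idx v); first exact: idx_near.
  have := passage_time_triangle c v (pt (near_idx v)) (env_ge0 eX0 om).
  rewrite -!/(ptime _ _ _ _) => tr; rewrite ler_normr; apply/orP; right.
  by clear -h h6 tr; lra.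
have sY := h3 n nn3 c hc.
have [|om hom] := small_exists (smallU (smallU sA sGX) (smallU sL sY)).
  have E : (S + 1) * b = 8^-1 by rewrite /b invfM mulrCA divff ?mulr1 // gt_eqF // ltr_wpDl.
  by rewrite mulrDl mul1r in E; lra.
have nA : ~ (exists2 a, a \in idx & n%:R * e <=
    `|ptime X om (0, 0) (pt a) - n%:R * mb (add2 y (off a))|).
  by move=> h; apply: hom; left; left.
have nG : ~ gapbad X om by move=> h; apply: hom; left; right.
have nLo : ~ (exists p, [/\ path adjacent c p,
    forall z, z \in c :: p -> supdist c z <= N%:Z &
    path_weight (X^~ om) c p < th (last c p)]) by move=> h; apply: hom; right; left.
have nY : `|ptime X om (0, 0) c - n%:R * mb y| < n%:R * e.
  by rewrite ltNge; apply/negP => h; apply: hom; right; right.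
have w0 := env_ge0 eX om.
have : passage_time (X^~ om) c (0, 0) < n%:R * mb y + n%:R * e.
  rewrite passage_time_sym // -/(ptime X om _ _); move: nY; rewrite ltr_norml => /andP[_].
  by rewrite ltrBlDl.
move=> /(passage_time_ltP _ _ _ w0)[p [p1 p2 pw]].
have := first_exit (supdist_refl c N) p1; rewrite p2 => /(_ (supdist_origin cN)).
move=> [q1 [q2 [pE vN qB]]].
set v := last c q1 in vN.
move: p1 p2 pw; rewrite pE cat_path last_cat path_weight_cat -/v => /andP[q1p q2p] q2l pw.
have hth : n%:R * m (off (near_idx v)) - 4 * (n%:R * e) <= path_weight (X^~ om) c q1.
  rewrite leNgt; apply/negP => h; apply: nLo; exists q1; split => //.
  by rewrite -/v /th vN eqxx.
have hq2 := passage_time_le w0 q2p; rewrite q2l passage_time_sym // in hq2.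
have h6 := gap_near X om v nG vN.
have h7 : `|ptime X om (0, 0) (pt (near_idx v)) - n%:R * mb (add2 y (off (near_idx v)))| < n%:R * e.
  by rewrite ltNge; apply/negP => h; apply: nA; exists (near_idx v) => //; exact: idx_near.
have tr := passage_time_triangle (0, 0) v (pt (near_idx v)) w0.
(* The 9 is 4 from [th], 3 from [gap_near] in [X], and one for each of the limits at [y] and at the
   chosen point. *)
exists (add2 y (off (near_idx v))); split.
- rewrite /= lerD2l; apply: side_pt_le => //; apply: ts0.
  exact/(idxK (near_idx v))/idx_near.
- by rewrite /= !(addrC y.1) !(addrC y.2) !addrK; exact: side_pt_far.
- have -> : sub2 (add2 y (off (near_idx v))) y = off (near_idx v).
    by rewrite /sub2 /add2 /= !(addrC y.1) !(addrC y.2) !addrK -surjective_pairing.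
  rewrite -(ler_pM2l n0) !mulrDr.
  move: tr h6 h7 hq2 hth pw; rewrite -!/(ptime X om _ _) ltr_norml => tr h6 /andP[h7 _].
  by clear -tr h6 h7; lra.
Qed.

Lemma lower_local (y : R * R) (r e : R) : 0 < r -> y.1 + r < 0 -> 0 < e ->
  exists z : R * R, [/\ z.1 <= y.1 + r, r <= `|z.1 - y.1| \/ r <= `|z.2 - y.2| &
    mb z + m (sub2 z y) <= mb y + e].
Proof.
move=> r0 yr0 e0; have [|z hz] := lower_local9 r0 yr0 (e := e / 9); first by rewrite divr_gt0.
by exists z; rewrite mulrCA divff ?mulr1 // in hz.
Qed.

End LowerBoundLocal.

(** * The variational formula *)

Section Deterministic.
Context {R : realType}.
Implicit Types (x y z : R * R) (f : R * R -> R).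

Lemma scal2_e2 (a : R) : scal2 a (e2 R) = (0, a).
Proof. by rewrite /scal2 /e2 /= mulr0 mulr1. Qed.

Lemma sub2K x y : add2 y (sub2 x y) = x.
Proof.
by case: x y => [a b] [a' b']; rewrite /add2 /sub2 /=; congr (_, _); ring.
Qed.

Lemma lipschitz2_continuous f (K : R) :
  (forall z z', `|f z - f z'| <= K * (`|z.1 - z'.1| + `|z.2 - z'.2|)) -> continuous f.
Proof.
move=> fK z; apply/cvgrPdist_le => e e0.
pose k := `|K| + 1; have k0 : 0 < k by rewrite ltr_wpDl.
have k2 : 0 < e / (2 * k) by rewrite divr_gt0 // mulr_gt0.
apply: filterS (nbhsx_ballx z _ k2) => t [].
rewrite -!ball_normE /= => h1 h2.
apply: le_trans (fK _ _) _.
have h : `|z.1 - t.1| + `|z.2 - t.2| <= e / k.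
  have -> : e / k = e / (2 * k) + e / (2 * k) by field; rewrite gt_eqF.
  by apply/ltW/ltrD.
have s0 : 0 <= `|z.1 - t.1| + `|z.2 - t.2| by rewrite addr_ge0.
apply: (@le_trans _ _ (k * (`|z.1 - t.1| + `|z.2 - t.2|))).
  by rewrite ler_wpM2r // /k; have := ler_norm K; lra.
by apply: le_trans (ler_wpM2l (ltW k0) h) _; rewrite mulrC divfK // gt_eqF.
Qed.

Record lattice_seminorm (m : R * R -> R) : Prop := LatticeSeminorm {
  seminorm_ge0 : forall x, 0 <= m x;
  seminormD : forall x y, m (add2 x y) <= m x + m y;
  seminormZ : forall t x, 0 < t -> m (scal2 t x) = t * m x;
  seminormN : forall x, m (- x.1, - x.2) = m x;
  seminorm_refl : forall x, m (- x.1, x.2) = m x;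
  seminorm_swap : forall x, m (x.2, x.1) = m x }.

Section Seminorm.
Variable m : R * R -> R.
Hypothesis mP : lattice_seminorm m.

Lemma seminorm0 : m (0, 0) = 0.
Proof.
by have := @seminormZ _ mP 2 (0, 0) (ltr0Sn _ _); rewrite /scal2 /= mulr0; lra.
Qed.

Lemma seminorm_axis (a : R) : m (a, 0) = `|a| * m (1, 0).
Proof.
have [a0|a0|->] := ltrgt0P a; last by rewrite mul0r seminorm0.
  by rewrite -(@seminormZ _ mP) // /scal2 /= mulr1 mulr0.
rewrite -(@seminormN _ mP) /= oppr0.
by rewrite -(@seminormZ _ mP) ?oppr_gt0 // /scal2 /= mulr1 mulr0.
Qed.

(** [(a, c)] is a convex combination of [(b, c)] and its mirror image [(- b, c)], at which [m] takes
    the same value. *)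
Lemma seminorm_le_reflect (a b c : R) : `|a| <= `|b| -> m (a, c) <= m (b, c).
Proof.
move=> ab; have [b0|b0] := eqVneq b 0.
  by move: ab; rewrite b0 normr0 normr_le0 => /eqP->.
have [t ta] : exists t, a = t * b by exists (a / b); rewrite divfK.
have t1 : -1 <= t <= 1.
  by rewrite -ler_norml -(ler_pM2r (x := `|b|)) ?normr_gt0 // mul1r -normrM -ta.
have [/andP[t1a t1b]] := t1.
have R1 : m (- b, c) = m (b, c) by exact: (seminorm_refl mP (b, c)).
have [t1E|tn1] := eqVneq t 1; first by rewrite ta t1E mul1r.
have [tE|tn2] := eqVneq t (-1); first by rewrite ta tE mulN1r R1.
have tl : t < 1 by rewrite lt_neqAle tn1.
have tg : -1 < t by rewrite lt_neqAle eq_sym tn2.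
pose l := (1 + t) / 2.
have l0 : 0 < l by rewrite /l; lra.
have l1 : 0 < 1 - l by rewrite /l; lra.
have -> : (a, c) = add2 (scal2 l (b, c)) (scal2 (1 - l) (- b, c)).
  by rewrite /add2 /scal2 /= ta /l; congr (_, _); field.
apply: le_trans (seminormD mP _ _) _; rewrite !(seminormZ mP) // R1.
by rewrite -mulrDl addrC subrK mul1r.
Qed.

(** With [seminorm_ge2] and [seminorm_le], this decides by the single number [m (1, 0)] whether [m]
    vanishes or is a norm. *)
Lemma seminorm_ge1 x : `|x.1| * m (1, 0) <= m x.
Proof.
rewrite -seminorm_axis; case: x => a b /=.
have [/eqP->|b0] := boolP (b == 0); first by [].
have h : m (0, a) <= m (b, a) by apply: seminorm_le_reflect; rewrite normr0.
by rewrite -(seminorm_swap mP) /= -[leRHS](seminorm_swap mP).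
Qed.

Lemma seminorm_ge2 x : `|x.2| * m (1, 0) <= m x.
Proof. by rewrite -(seminorm_swap mP x); exact: (seminorm_ge1 (x.2, x.1)). Qed.

Lemma seminorm_le x : m x <= (`|x.1| + `|x.2|) * m (1, 0).
Proof.
case: x => a b /=.
have -> : (a, b) = add2 (a, 0) (0, b) by rewrite /add2 /= addr0 add0r.
apply: le_trans (seminormD mP _ _) _.
have hb : m (0, b) = `|b| * m (1, 0) by rewrite -seminorm_axis -(seminorm_swap mP (0, b)).
by rewrite mulrDl hb (seminorm_axis a).
Qed.

Lemma seminorm_lip x y : `|m x - m y| <= m (1, 0) * (`|x.1 - y.1| + `|x.2 - y.2|).
Proof.
have h u v : m u - m v <= m (1, 0) * (`|u.1 - v.1| + `|u.2 - v.2|).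
  rewrite lerBlDl -{1}(sub2K u v); apply: le_trans (seminormD mP _ _) _.
  by rewrite lerD2l mulrC; exact: (seminorm_le (sub2 u v)).
rewrite ler_norml h andbT lerNl opprB.
by rewrite (distrC x.1) (distrC x.2).
Qed.

Lemma seminorm_sub x y : m (sub2 x y) = m (sub2 y x).
Proof. by rewrite -(seminormN mP) /= !opprB. Qed.

End Seminorm.

(** [mb] plays the role of the inhomogeneous time constant and [m] that of the
    homogeneous one of the left half-plane. *)
Record left_half_plane (mb m : R * R -> R) : Prop := LeftHalfPlane {
  lhp_seminorm : lattice_seminorm m;
  lhp_ge0 : forall x, 0 <= mb x;
  lhpZ : forall t x, 0 < t -> mb (scal2 t x) = t * mb x;
  lhp_vertical : forall a z, mb z <= mb (0, a) + mb (sub2 z (0, a)) /\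
    mb (0, a) <= mb z + mb (sub2 z (0, a));
  lhp_upper : forall x y, y.1 < 0 -> (add2 y x).1 < 0 -> mb (add2 y x) <= mb y + m x;
  lhp_lower : forall y r e, 0 < r -> y.1 + r < 0 -> 0 < e -> exists z,
    [/\ z.1 <= y.1 + r, r <= `|z.1 - y.1| \/ r <= `|z.2 - y.2| &
        mb z + m (sub2 z y) <= mb y + e] }.

Section LeftHalfPlane.
Variables mb m : R * R -> R.
Hypothesis H : left_half_plane mb m.
Let mP := lhp_seminorm H.
Let k := m (1, 0).
Let k0 : 0 <= k. Proof. exact: seminorm_ge0 mP _. Qed.

Lemma lhp_le x : x.1 <= 0 -> mb x <= m x.
Proof.
have neg y : y.1 < 0 -> mb y <= m y.
  move=> y0.
  have E : y = add2 (scal2 2^-1 y) (scal2 2^-1 y).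
    by case: (y) => a b; rewrite /add2 /scal2 /=; congr (_, _); field.
  have h1 : (scal2 2^-1 y).1 < 0 by rewrite /= pmulr_rlt0 // invr_gt0.
  have h2 : (add2 (scal2 2^-1 y) (scal2 2^-1 y)).1 < 0 by rewrite -E.
  have := lhp_upper H h1 h2; rewrite -E (lhpZ H) ?invr_gt0 // (seminormZ mP) ?invr_gt0 //.
  lra.
rewrite le_eqVlt => /orP[/eqP x0|]; last exact: neg.
apply: (@le_addepsP _ _ _ (2 * k)) => [|s s0]; first by rewrite mulr_ge0.
case: x x0 => _ a /= ->.
have h1 : mb (- s, a) <= m (0, a) + s * k.
  apply: le_trans (neg _ _) _; first by rewrite /= oppr_lt0.
  have -> : (- s, a) = add2 (0, a) (- s, 0) by rewrite /add2 /= addr0 add0r.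
  apply: le_trans (seminormD mP _ _) _; rewrite lerD2l seminorm_axis //.
  by rewrite normrN gtr0_norm.
have h2 : mb (- s, 0) <= s * k.
  apply: le_trans (neg _ _) _; first by rewrite /= oppr_lt0.
  by rewrite seminorm_axis // normrN gtr0_norm.
have [_] := lhp_vertical H a (- s, a).
by rewrite /sub2 /= subr0 subrr; move: h1 h2; rewrite -/k; lra.
Qed.

Lemma lhp_lip_le x y : x.1 <= 0 -> y.1 <= 0 -> mb x <= mb y + m (sub2 x y).
Proof.
move=> x0 y0; have [y1|y1] := eqVneq y.1 0.
  have yE : y = (0, y.2) by case: (y) y1 => ? ? /= ->.
  have [h _] := lhp_vertical H y.2 x; rewrite -yE in h.
  apply: le_trans h _; rewrite lerD2l; apply: lhp_le.
  by rewrite /= y1 subr0.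
have [x1|x1] := eqVneq x.1 0.
  have xE : x = (0, x.2) by case: (x) x1 => ? ? /= ->.
  have [_ h] := lhp_vertical H x.2 y; rewrite -xE in h.
  apply: le_trans h _; rewrite lerD2l (seminorm_sub mP); apply: lhp_le.
  by rewrite /= x1 subr0.
rewrite -{1}(sub2K x y); apply: (lhp_upper H); first by rewrite lt_neqAle y1.
by rewrite sub2K lt_neqAle x1.
Qed.

Lemma min0_lip (a b : R) : `|Num.min a 0 - Num.min b 0| <= `|a - b|.
Proof.
have := ler_norm (a - b); have := ler_norm (- (a - b)); rewrite normrN ler_norml => h1 h2.
by rewrite !minEle; case: (leP a 0) => ha; case: (leP b 0) => hb; apply/andP; split; lra.
Qed.

(** A minimizer of [mb z + (1 - eta) * m (z - x)] over the half-plane lies on the axis: at an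
    interior point, [lhp_lower] would give a point where the functional is smaller. *)
Lemma lhp_eta x (eta : R) : x.1 < 0 -> 0 < k -> 0 < eta <= 2^-1 ->
  exists2 a, `|a| <= 2 * mb x / k + `|x.1| + `|x.2| &
    mb (0, a) + (1 - eta) * m (sub2 (0, a) x) <= mb x.
Proof.
move=> x0 kp /andP[eta0 eta1].
(* Outside the box of size [B], the left half-plane satisfies [2 * mb x <= m (sub2 z x)]. As
   [1 - eta] is at least 1/2, the functional is then at least [mb x], and the minimum over the box
   is global. *)
pose B := 2 * mb x / k + `|x.1| + `|x.2|.
have mbx := lhp_ge0 H x.
have c0 : 0 <= 2 * mb x / k by rewrite divr_ge0 // mulr_ge0.
have B0 : 0 <= B by rewrite !addr_ge0.
pose A : set (R * R) := `[- B, 0]%classic `*` `[- B, B]%classic.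
pose phi z := mb z + (1 - eta) * m (sub2 z x).
(* Lipschitz bounds for [mb] hold only on the half-plane; precomposing with the projection onto it
   gives a function continuous everywhere. *)
pose f z := phi (Num.min z.1 0, z.2).
have fA z : z.1 <= 0 -> f z = phi z.
  by move=> z0; rewrite /f min_l //; case: z z0.
have cf : continuous f.
  apply: (@lipschitz2_continuous _ (2 * k)) => z z'.
  set u := (Num.min z.1 0, z.2); set u' := (Num.min z'.1 0, z'.2).
  have hu : `|u.1 - u'.1| <= `|z.1 - z'.1|.
    exact: min0_lip.
  have ul : u.1 <= 0 by rewrite /= ge_min lexx orbT.
  have ul' : u'.1 <= 0 by rewrite /= ge_min lexx orbT.
  have key v v' : v.1 <= 0 -> v'.1 <= 0 -> phi v - phi v' <=
      2 * k * (`|v.1 - v'.1| + `|v.2 - v'.2|).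
    move=> v0 v0'; rewrite /phi.
    have h1 := lhp_lip_le v0 v0'; have h2 := seminorm_le mP (sub2 v v').
    have := le_trans (ler_norm _) (seminorm_lip mP (sub2 v x) (sub2 v' x)).
    have E (p q s : R) : p - q - (s - q) = p - s by ring.
    rewrite /= !E -/k => h3.
    have h4 : (1 - eta) * (m (sub2 v x) - m (sub2 v' x)) <=
        k * (`|v.1 - v'.1| + `|v.2 - v'.2|).
      apply: le_trans (ler_wpM2l _ h3) _; first by lra.
      rewrite ler_piMl ?mulr_ge0 ?addr_ge0 //; lra.
    move: h1 h2 h4; rewrite /= -/k; lra.
  have hle : 2 * k * (`|u.1 - u'.1| + `|u.2 - u'.2|) <=
      2 * k * (`|z.1 - z'.1| + `|z.2 - z'.2|).
    by rewrite ler_wpM2l ?mulr_ge0 // lerD2r.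
  rewrite ler_norml; apply/andP; split; last exact: le_trans (key u u' ul ul') hle.
  rewrite lerNl opprB; apply: le_trans (key u' u ul' ul) _.
  by rewrite (distrC u'.1) (distrC u'.2).
have cA : compact A by apply: compact_setX; exact: segment_compact.
have xA : A x.
  split; rewrite /= in_itv /=.
    by rewrite (ltW x0) andbT lerNl -(ltr0_norm x0) /B; have := normr_ge0 x.2; lra.
  by rewrite -ler_norml /B; have := normr_ge0 x.1; lra.
have A0 : A !=set0 by exists x.
have [z0 + hmin] := compact_EVT_min A0 cA (continuous_subspaceT cf).
rewrite inE => -[]; rewrite /= !in_itv /= => /andP[z1 z1'] z2.
have phix : phi x = mb x.
  by rewrite /phi /sub2 !subrr seminorm0 // mulr0 addr0.
have hx : phi z0 <= mb x.
  by rewrite -phix -!fA ?(ltW x0) //; apply: hmin; rewrite inE.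
have [z00|z00] := eqVneq z0.1 0.
  have zE : (0, z0.2) = z0 by case: (z0) z00 => ? ? /= ->.
  by exists z0.2; [rewrite ler_norml|rewrite zE].
exfalso.
have zn : z0.1 < 0 by rewrite lt_neqAle z00.
pose r := - z0.1 / 2.
have r0 : 0 < r by rewrite divr_gt0 // oppr_gt0.
have zr : z0.1 + r < 0 by rewrite /r; lra.
(* A point at distance at least [r] gains at least [eta * (k * r)], twice the error granted to
   [lhp_lower]. *)
have e0 : 0 < eta * (k * r) / 2 by rewrite divr_gt0 // (mulr_gt0 eta0) // (mulr_gt0 kp r0).
have [z [zl zfar hz]] := lhp_lower H r0 zr e0.
have zle : z.1 <= 0 by apply: le_trans zl _; exact: ltW.
have mz : k * r <= m (sub2 z z0).
  rewrite mulrC; case: zfar => h.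
    by apply: le_trans (seminorm_ge1 mP _); rewrite ler_wpM2r.
  by apply: le_trans (seminorm_ge2 mP _); rewrite ler_wpM2r.
have tri : m (sub2 z x) <= m (sub2 z z0) + m (sub2 z0 x).
  have -> : sub2 z x = add2 (sub2 z z0) (sub2 z0 x).
    by rewrite /add2 /sub2 /=; congr (_, _); ring.
  exact: seminormD.
have lt1 : phi z < phi z0.
  rewrite /phi.
  have h1 : (1 - eta) * m (sub2 z x) <= (1 - eta) * (m (sub2 z z0) + m (sub2 z0 x)).
    by rewrite ler_wpM2l //; lra.
  have h2 : eta * (k * r) <= eta * m (sub2 z z0) by rewrite ler_wpM2l // ltW.
  by move: h1 h2 hz e0; rewrite mulrDr !mulrBl !mul1r; lra.
have [zA|zA] := pselect (A z).
  have := hmin z (mem_set zA); rewrite !fA //.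
  by rewrite leNgt lt1.
have big : 2 * mb x <= m (sub2 z x).
  have far1 : 2 * mb x / k <= `|z.1 - x.1| -> 2 * mb x <= m (sub2 z x).
    rewrite ler_pdivrMr // => h; apply: le_trans h _; exact: (seminorm_ge1 mP (sub2 z x)).
  have far2 : 2 * mb x / k <= `|z.2 - x.2| -> 2 * mb x <= m (sub2 z x).
    rewrite ler_pdivrMr // => h; apply: le_trans h _; exact: (seminorm_ge2 mP (sub2 z x)).
  have [hB1|hB1] := lerP (- B) z.1; last first.
    apply: far1; rewrite distrC ler_normr; apply/orP; left.
    have := ler_norm (- x.1); rewrite normrN; move: hB1; rewrite /B.
    have := normr_ge0 x.2; lra.
  have [hB2|hB2] := lerP `|z.2| B.
    exfalso; apply: zA; split; rewrite /= in_itv /= ?hB1 ?zle //.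
    by rewrite -ler_norml.
  apply: far2; have := ler_normD (z.2 - x.2) x.2; rewrite subrK.
  by move: hB2; rewrite /B; have := normr_ge0 x.1; lra.
have : mb x <= phi z.
  rewrite /phi; have := lhp_ge0 H z.
  have : (1 - eta) * (2 * mb x) <= (1 - eta) * m (sub2 z x) by rewrite ler_wpM2l //; lra.
  have : 2^-1 * (2 * mb x) <= (1 - eta) * (2 * mb x) by rewrite ler_wpM2r ?mulr_ge0 //; lra.
  lra.
by rewrite leNgt (lt_le_trans lt1 hx).
Qed.

(** The bound on [a] in [lhp_eta] does not depend on [eta], so a minimizer on one fixed interval can
    be compared with all of them as [eta] tends to 0. If [m] vanishes, so does [mb] at the origin,
    and [a = 0] works. *)
Lemma lhp_attained x : x.1 <= 0 ->
  exists a, mb (0, a) + m (sub2 x (0, a)) <= mb x.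
Proof.
move=> x0; have [k00|kn0] := eqVneq k 0.
  have mE z : m z = 0.
    apply/le_anti; rewrite (seminorm_ge0 mP) andbT.
    by have := seminorm_le mP z; rewrite -/k k00 mulr0.
  exists 0; rewrite mE addr0; apply: le_trans (lhp_ge0 H x).
  by have := @lhp_le (0, 0) (lexx _); rewrite mE.
have kp : 0 < k by rewrite lt_neqAle eq_sym kn0.
have [x1|x1] := eqVneq x.1 0.
  have xE : x = (0, x.2) by case: (x) x1 => ? ? /= ->.
  exists x.2; rewrite -xE /sub2 !subrr seminorm0 // addr0; exact: lexx.
have xn : x.1 < 0 by rewrite lt_neqAle x1.
pose B := 2 * mb x / k + `|x.1| + `|x.2|.
have mbx := lhp_ge0 H x.
have B0 : 0 <= B by rewrite !addr_ge0 // divr_ge0 // mulr_ge0.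
pose f a := mb (0, a) + m (sub2 (0, a) x).
have cf : {within `[- B, B], continuous f}.
  apply: continuous_subspaceT => a; apply/cvgrPdist_le => e e0.
  have q0 : 0 < e / (2 * k) by rewrite divr_gt0 // mulr_gt0.
  apply: filterS (nbhsx_ballx a _ q0) => b; rewrite -ball_normE /= => hb.
  have key u v : f u - f v <= 2 * k * `|u - v|.
    have h1 := @lhp_lip_le (0, u) (0, v) (lexx _) (lexx _).
    have h2 := seminorm_le mP (sub2 (0, u) (0, v)).
    have := le_trans (ler_norm _) (seminorm_lip mP (sub2 (0, u) x) (sub2 (0, v) x)).
    have E (p q s : R) : p - q - (s - q) = p - s by ring.
    rewrite /= !E !subrr normr0 !add0r -/k /f.
    by move: h1 h2; rewrite /= subrr normr0 add0r -/k; lra.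
  have hk : 2 * k * `|a - b| <= e.
    rewrite mulrC -ler_pdivlMr ?mulr_gt0 //; exact: ltW.
  rewrite ler_norml; apply/andP; split; last exact: le_trans (key a b) hk.
  by rewrite lerNl opprB; apply: le_trans (key b a) _; rewrite distrC.
have [a _ hmin] := EVT_min (ltac:(lra) : - B <= B) cf.
exists a; rewrite (seminorm_sub mP).
apply: (@le_addepsP _ _ _ (2 * mb x)) => [|e e0]; first by rewrite mulr_ge0.
pose eta := Num.min e 2^-1.
have eta0 : 0 < eta by rewrite lt_min e0 invr_gt0 ltr0n.
have etae : eta <= e by rewrite ge_min lexx.
have eta2 : eta <= 2^-1 by rewrite ge_min lexx orbT.
have [|c cB hc] := lhp_eta xn kp (eta := eta); first by rewrite eta0.
apply: (@le_trans _ _ (f c)); first by apply: hmin; rewrite in_itv /= -ler_norml.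
have c0 := lhp_ge0 H (0, c); have mc0 := seminorm_ge0 mP (sub2 (0, c) x).
have h1 : 2^-1 * m (sub2 (0, c) x) <= (1 - eta) * m (sub2 (0, c) x).
  by rewrite ler_wpM2r //; lra.
have h2 : m (sub2 (0, c) x) <= 2 * mb x by lra.
have h3 : eta * m (sub2 (0, c) x) <= e * (2 * mb x) by rewrite ler_pM // ltW.
by rewrite /f; move: hc; rewrite mulrBl mul1r; lra.
Qed.

End LeftHalfPlane.
End Deterministic.

(** * Reduction to nonnegative weights *)

Section PositivePart.
Context (d : measure_display) (T : measurableType d) (R : realType).
Variable P : probability T R.
Implicit Types (X : edge -> T -> R) (nu : edge -> probability R R).

(** The laws make the weights nonnegative only almost surely. Positive parts are nonnegative
    everywhere and, there being countably many edges, differ from the weights only on a null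
    event. *)
Definition pos_part X (e : edge) (om : T) : R := Num.max (X e om) 0.

Lemma probability_tail (nu0 : probability R R) (b : R) : 0 < b ->
  exists t : R, (nu0 [set x | (t <= x)%R] <= b%:E)%E.
Proof.
move=> b0; pose F (n : nat) := [set x : R | n%:R <= x].
have mF n : measurable (F n) by apply: measurable_superlevel; exact: measurable_id.
have F0 : \bigcap_n F n = set0.
  apply/seteqP; split => x // h; have := h (Num.bound `|x|) I.
  rewrite /F /= leNgt => /negP; apply.
  exact: le_lt_trans (ler_norm x) (archi_boundP (normr_ge0 x)).
have cv : (nu0 \o F) n @[n --> \oo] --> nu0 (\bigcap_n F n).
  apply: nonincreasing_cvg_mu => //.
  - by rewrite (le_lt_trans (probability_le1 _ _)) ?ltry.
  - by rewrite F0.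
  - move=> i j ij; apply/subsetPset => x; rewrite /F /=; apply: le_trans.
    by rewrite ler_nat.
move: cv; rewrite F0 measure0 => /fine_cvgP[[N1 _ h1] /cvgrPdist_lt/(_ _ b0)[N2 _ h2]].
exists (maxn N1 N2)%:R.
have := h1 (maxn N1 N2) (leq_maxl _ _) => /= h1'.
have := h2 (maxn N1 N2) (leq_maxr _ _); rewrite /= sub0r normrN => h.
by rewrite -[leLHS]fineK // lee_fin; apply/ltW/(le_lt_trans (ler_norm _)).
Qed.

Lemma probability_full d' (T' : measurableType d') (Q : probability T' R) (A B C : set T') :
  measurable A -> measurable B -> measurable C -> Q C = 1%E ->
  A `&` C = B `&` C -> Q A = Q B.
Proof.
move=> mA mB mC QC ABC.
have H D : measurable D -> Q D = Q (D `&` C).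
  move=> mD; rewrite -{1}(setIT D) -(setUv C) setIUr measureU //.
  - have : (Q (D `&` ~` C) <= Q (~` C))%E.
      by apply: le_measure; rewrite ?inE //; [apply: measurableI => //|];
        exact: measurableC.
    by rewrite probability_setC // QC subee // measure_le0 => /eqP->; rewrite adde0.
  - exact: measurableI.
  - by apply: measurableI => //; exact: measurableC.
  - by apply/seteqP; split => x // -[[_ Cx] [_ nCx]].
by rewrite (H A mA) (H B mB) ABC.
Qed.

Lemma countable_bigcup_null (I : countType) (F : I -> set T) :
  (forall i, measurable (F i)) -> (forall i, P (F i) = 0%E) -> P (\bigcup_i F i) = 0%E.
Proof.
move=> mF F0; pose G n := if unpickle n is Some i then F i else set0.
have -> : \bigcup_i F i = \bigcup_n G n.
  apply/seteqP; split => x.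
    by move=> [i _ Fx]; exists (pickle i) => //; rewrite /G pickleK.
  by move=> [n _]; rewrite /G; case: unpickle => // i Fx; exists i.
have mG n : measurable (G n) by rewrite /G; case: unpickle.
apply/negligibleP; first exact: bigcupT_measurable.
apply: negligible_bigcup => n; apply/negligibleP => //.
by rewrite /G; case: (unpickle n) => [i|]; [exact: F0|exact: measure0].
Qed.

Section OneFamily.
Variables (X : edge -> T -> R) (nu : edge -> probability R R).
Hypothesis nu_pos : forall e, nu e `[0, +oo[%classic = 1%E.
Hypothesis iX : independent_family P X.
Hypothesis lX : forall e, has_law P (X e) (nu e).
Hypothesis tight : forall b : R, 0 < b ->
  exists t, forall e, (nu e [set x | (t <= x)%R] <= b%:E)%E.

Let mmax : measurable_fun setT (fun x : R => Num.max x 0).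
Proof. by apply: measurable_maxr. Qed.

Lemma pos_part_law e : has_law P (pos_part X e) (nu e).
Proof.
have mX := (lX e).1; split; first exact: measurableT_comp mmax mX.
move=> B mB.
have mB' : measurable ((fun x : R => Num.max x 0) @^-1` B).
  by rewrite -[X in measurable X]setTI; exact: mmax.
have -> : pos_part X e @^-1` B = X e @^-1` ((fun x : R => Num.max x 0) @^-1` B) by [].
rewrite (lX e).2 //.
apply: (@probability_full _ _ (nu e) _ _ `[0, +oo[%classic) => //.
by apply/seteqP; split => x /=; rewrite in_itv /= andbT => -[h x0]; split => //;
  move: h; rewrite max_l.
Qed.

Definition pos_event := [set om | forall e, 0 <= X e om].

Lemma pos_event_full : measurable pos_event /\ P pos_event = 1%E.
Proof.
have E : ~` pos_event = \bigcup_e [set om | X e om < 0].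
  apply/seteqP; split => om.
    move=> /existsNP[e /negP]; rewrite -ltNge => h; by exists e.
  by move=> [e _ /= h] /(_ e); rewrite leNgt h.
have mE e : measurable [set om | X e om < 0].
  exact: measurable_sublevel (lX e).1.
have mC : measurable (~` pos_event).
  by rewrite E; apply: (countable_bigcup_measurable (I := edge)).
have mG : measurable pos_event by rewrite -[pos_event]setCK; exact: measurableC.
split => //.
have E0 e : P [set om | X e om < 0] = 0%E.
  have -> : [set om | X e om < 0] = X e @^-1` (~` `[0, +oo[%classic).
    apply/seteqP; split => om /=; rewrite in_itv /= andbT ltNge; first by move=> /negP.
    by move=> /negP.
  rewrite (lX e).2; last exact: measurableC.
  by rewrite probability_setC // nu_pos subee.
have P0 : P (~` pos_event) = 0%E by rewrite E; exact: countable_bigcup_null.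
by have := probability_setC P mC; rewrite setCK => ->; rewrite P0 sube0.
Qed.

Lemma pos_part_env : environment P (pos_part X) nu.
Proof.
split.
- exact: pos_part_law.
- by apply: (independent_compose (g := fun _ x => Num.max x 0)).
- by move=> om e; rewrite /pos_part le_max lexx orbT.
- move=> b /tight[t ht]; exists t => e; apply: small_measurable.
    exact: measurable_superlevel (pos_part_law e).1.
  have -> : [set om | t <= pos_part X e om] = pos_part X e @^-1` [set x | (t <= x)%R] by [].
  rewrite (pos_part_law e).2; first exact: ht.
  by apply: measurable_superlevel; exact: measurable_id.
Qed.

Lemma pos_event_small b : 0 <= b -> small P (~` pos_event) b.
Proof.
move=> b0; have [mG PG] := pos_event_full; apply: small_measurable.
  exact: measurableC.
by rewrite probability_setC // PG subee // lee_fin.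
Qed.

Lemma pos_event_eq om : pos_event om -> (pos_part X)^~ om = X^~ om.
Proof. by move=> h; apply/funext => e; rewrite /pos_part max_l. Qed.

Let dev x (c : R) n om :=
  `|passage_timeR (X^~ om) (0, 0) (scal2 n%:R x) / n%:R - c|.

Lemma measurable_dev x c n : measurable_fun setT (dev x c n).
Proof.
apply: measurableT_comp => //; apply: measurable_funB => //; apply: measurable_funM => //.
exact: (measurableT_comp (measurable_passage_time _ _) (measurable_sample (fun e => (lX e).1))).
Qed.

Lemma prob_pos_time_const (m : R * R -> R) :
  (forall x, prob_time_constant P X x (m x)) -> time_const P (pos_part X) m.
Proof.
move=> hm; apply: (prob_time_const pos_part_env) => x e b e0 b0.
have [[N1 _ h1] /cvgrPdist_lt/(_ _ b0)[N2 _ h2]] := (fine_cvgP _ _).1 (hm x _ e0).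
exists (maxn N1 N2) => n; rewrite geq_max => /andP[n1 n2].
have s1 : small P [set om | e <= dev x (m x) n om] b.
  apply: small_measurable; first exact: measurable_superlevel (measurable_dev _ _ _).
  have := h1 n n1 => /= h1'; have := h2 n n2; rewrite /= sub0r normrN => h.
  by rewrite -[leLHS]fineK // lee_fin; apply/ltW/(le_lt_trans (ler_norm _)).
rewrite -[b]addr0; apply: small_sub (smallU s1 (pos_event_small (lexx 0))) => om /= h.
have [hp|hp] := pselect (pos_event om); last by right.
by left; rewrite /dev -pos_event_eq.
Qed.

(** Almost sure convergence implies convergence in probability: the events [F N] of a deviation at
    some time from [N] on decrease to a null event. *)
Lemma as_pos_time_const (m : R * R -> R) :
  (forall x, as_time_constant P X x (m x)) -> time_const P (pos_part X) m.
Proof.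
move=> hm; apply: (prob_time_const pos_part_env) => x e b e0 b0.
pose F N := \bigcup_(n in [set n | (N <= n)%N]) [set om | e <= dev x (m x) n om].
have mS n : measurable [set om | e <= dev x (m x) n om].
  exact: measurable_superlevel (measurable_dev _ _ _).
have mF N : measurable (F N) by apply: bigcup_measurable.
have mI : measurable (\bigcap_N F N) by exact: bigcapT_measurable.
have PI : P (\bigcap_N F N) = 0%E.
  have [C [mC PC hC]] := hm x.
  apply/eqP; rewrite -measure_le0 -PC; apply: le_measure; rewrite ?inE // => om h.
  apply: hC => /cvgrPdist_lt/(_ _ e0)[N _ hN].
  have [n /= Nn] := h N I; rewrite /dev distrC leNgt => /negP; apply; exact: hN.
have [N hN] : exists N, (P (F N) <= b%:E)%E.
  have cv : (P \o F) n @[n --> \oo] --> P (\bigcap_N F N).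
    apply: nonincreasing_cvg_mu => //.
    - by rewrite (le_lt_trans (probability_le1 _ _)) ?ltry.
    - move=> i j ij; apply/subsetPset => om [n /= jn h]; exists n => //=.
      exact: leq_trans jn.
  move: cv; rewrite PI => /fine_cvgP[[N1 _ h1] /cvgrPdist_lt/(_ _ b0)[N2 _ h2]].
  exists (maxn N1 N2).
  have := h1 (maxn N1 N2) (leq_maxl _ _) => /= h1'.
  have := h2 (maxn N1 N2) (leq_maxr _ _); rewrite /= sub0r normrN => h.
  by rewrite -[leLHS]fineK // lee_fin; apply/ltW/(le_lt_trans (ler_norm _)).
exists N => n Nn.
have s1 := small_measurable (mF N) hN.
rewrite -[b]addr0; apply: small_sub (smallU s1 (pos_event_small (lexx 0))) => om /= h.
have [hp|hp] := pselect (pos_event om); last by right.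
by left; exists n => //=; rewrite /dev -pos_event_eq.
Qed.

Lemma pos_part_integral :
  (\int[P]_om (Ymin X om)%:E < +oo)%E -> (\int[P]_om (Ymin (pos_part X) om)%:E < +oo)%E.
Proof.
have mY Y : (forall e, measurable_fun setT (Y e)) -> measurable_fun setT (EFin \o Ymin Y).
  move=> mY; apply/measurable_EFinP.
  by apply: (@measurable_min4 _ _ _ (fun i => Y (star_edge i))) => i; exact: mY.
rewrite (ae_eq_integral (EFin \o Ymin (pos_part X))) //.
- by apply: mY => e; exact: (lX e).1.
- by apply: mY => e; exact: (pos_part_law e).1.
- have [mG PG] := pos_event_full.
  have PG0 : P (~` pos_event) = 0%E by rewrite probability_setC // PG subee.
  exists (~` pos_event); split => //; first exact: measurableC.
  move=> om /= h hp; apply: h => _; rewrite /Ymin /pos_part.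
  by rewrite !max_l.
Qed.

End OneFamily.
End PositivePart.

(** * Subadditivity and the shape *)

Section Instances.
Context (d : measure_display) (T : measurableType d) (R : realType).
Variable P : probability T R.

Definition reflR (x : R * R) : R * R := (- x.1, x.2).

Lemma reflRK : involutive reflR.
Proof. by move=> [a b]; rewrite /reflR /= opprK. Qed.

Lemma refl_close (C : R) v x : close_to C v x -> close_to C (reflv v) (reflR x).
Proof.
by move=> [h1 h2]; split => //=; rewrite intrN -opprD normrN.
Qed.

Lemma refl_scal (t : R) x : reflR (scal2 t x) = scal2 t (reflR x).
Proof. by rewrite /reflR /scal2 /= mulrN. Qed.

Lemma time_const_seminorm X (nu0 : probability R R) m :
  environment P X (fun=> nu0) -> time_const P X m -> lattice_seminorm m.
Proof.
move=> eX tX.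
have mD x z : m z <= m x + m (sub2 z x).
  have hc n := @lattice_pt_close R (scal2 n%:R x).
  by have [] := time_const_shift eX tX z hc (fun _ _ => erefl).
have m0 := time_const0 tX.
have mN x : m (- x.1, - x.2) = m x.
  have h y : m y <= m (- y.1, - y.2).
    have hc n := @lattice_pt_close R (scal2 n%:R y).
    have [_] := time_const_shift eX tX (0, 0) hc (fun _ _ => erefl).
    by rewrite m0 add0r /sub2 /= !sub0r.
  apply/le_anti; rewrite h andbT; have := h (- x.1, - x.2).
  by rewrite /= !opprK -surjective_pairing.
split => //.
- exact: time_const_ge0 eX tX.
- move=> x y; have := mD x (add2 x y).
  have -> // : sub2 (add2 x y) x = y.
  by case: x y => [a b] [a' b']; rewrite /sub2 /add2 /=; congr (_, _); ring.
- by move=> t x t0; exact: time_const_homogeneous tX _ _ t0.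
- apply: (time_const_aut eX tX eX tX refl_aut (gR := reflR)) => //.
  + exact: refl_close.
  + exact: refl_scal.
- apply: (time_const_aut eX tX eX tX swap_aut (gR := fun x => (x.2, x.1))) => //.
  by move=> C v x [h1 h2].
Qed.

Lemma environment_left_half_plane X X0 nu (nu0 : probability R R) mb m :
  environment P X nu -> environment P X0 (fun=> nu0) ->
  (forall e, left_edge e -> nu e = nu0) ->
  (forall k e, nu (shifte (0, k) e) = nu e) ->
  (\int[P]_om (Ymin X0 om)%:E < +oo)%E ->
  time_const P X mb -> time_const P X0 m -> left_half_plane mb m.
Proof.
move=> eX eX0 nul nuv iY tX tX0; split.
- exact: time_const_seminorm eX0 tX0.
- exact: time_const_ge0 eX tX.
- by move=> t x t0; exact: time_const_homogeneous tX _ _ t0.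
- move=> a z.
  (* The shifts lie exactly on the axis: the inhomogeneous environment is invariant in law under
     vertical translations. *)
  have hc n : close_to 1 (0, Num.floor (n%:R * a)) (scal2 n%:R (0, a)).
    by split; rewrite /= ?mulr0 ?subrr ?normr0 //; exact: floor_close.
  exact: (time_const_shift eX tX z (c := fun n => (0, Num.floor (n%:R * a))) hc
    (fun n => nuv _)).
- by move=> x y; exact: (upper_local eX eX0 nul iY tX tX0).
- by move=> y r e; exact: (lower_local eX eX0 nul iY tX tX0).
Qed.

End Instances.

Section TwoHalfPlanes.
Context {R : realType}.
Implicit Types (x y : R * R).

Section LeftConsequences.
Variables mb m : R * R -> R.
Hypothesis H : left_half_plane mb m.
Let mP := lhp_seminorm H.

Lemma lhp0 : mb (0, 0) = 0.
Proof.
by have := lhpZ H (t := 2) (0, 0) (ltr0Sn _ _); rewrite /scal2 /= mulr0; lra.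
Qed.

Lemma lhp_axisD a b : mb (0, a + b) <= mb (0, a) + mb (0, b).
Proof.
have [h _] := lhp_vertical H a (0, a + b); apply: le_trans h _.
by rewrite /sub2 /= subrr (addrC a) addrK.
Qed.

Lemma lhp_axisN a : mb (0, - a) = mb (0, a).
Proof.
have h b : mb (0, b) <= mb (0, - b).
  by have [_] := lhp_vertical H b (0, 0); rewrite lhp0 add0r /sub2 /= !sub0r oppr0.
by apply/le_anti; have := h (- a); rewrite opprK => ->; rewrite h.
Qed.

Lemma lhp_axisE a : mb (0, a) = mb (0, 1) * `|a|.
Proof.
have pos b : 0 < b -> mb (0, b) = mb (0, 1) * b.
  by move=> b0; rewrite mulrC -(lhpZ H) // /scal2 /= mulr0 mulr1.
have [a0|a0|->] := ltrgt0P a; last by rewrite mulr0 lhp0.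
  exact: pos.
by rewrite -lhp_axisN pos // oppr_gt0.
Qed.

Lemma lhp_formula x : x.1 <= 0 -> exists a : R,
  mb x = mb (scal2 a (e2 R)) + m (sub2 x (scal2 a (e2 R))) /\
  forall b, mb (scal2 a (e2 R)) + m (sub2 x (scal2 a (e2 R))) <=
            mb (scal2 b (e2 R)) + m (sub2 x (scal2 b (e2 R))).
Proof.
move=> x0; have [a ha] := lhp_attained H x0.
have E : mb x = mb (0, a) + m (sub2 x (0, a)).
  by apply/le_anti; rewrite ha (lhp_lip_le H) //= lexx.
exists a; rewrite scal2_e2; split => // b; rewrite scal2_e2 -E.
by rewrite (lhp_lip_le H) //= lexx.
Qed.

(** The sum of the minimizers for [x] and [y] is a competitor for [add2 x y]. *)
Lemma lhp_subadditive x y : x.1 <= 0 -> y.1 <= 0 -> mb (add2 x y) <= mb x + mb y.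
Proof.
move=> x0 y0; have [a ha] := lhp_attained H x0; have [b hb] := lhp_attained H y0.
have s0 : (add2 x y).1 <= 0 by rewrite /=; lra.
have := lhp_lip_le H s0 (lexx 0 : (0, a + b).1 <= 0).
have -> : sub2 (add2 x y) (0, a + b) = add2 (sub2 x (0, a)) (sub2 y (0, b)).
  by rewrite /sub2 /add2 /=; congr (_, _); ring.
have := seminormD mP (sub2 x (0, a)) (sub2 y (0, b)); have := lhp_axisD a b.
by move: ha hb; lra.
Qed.

Lemma lhp_axis_le x : x.1 <= 0 -> mb (0, x.2) <= mb x.
Proof.
move=> x0; have [a ha] := lhp_attained H x0; apply: le_trans ha.
have := lhp_axisD a (x.2 - a); rewrite addrC subrK => h; apply: le_trans h _.
rewrite lerD2l; apply: le_trans (lhp_le H _) _; first exact: lexx.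
by rewrite /sub2 subr0; apply: (seminorm_le_reflect mP); rewrite normr0.
Qed.

(** The minimizer of [x] is kept as a competitor: moving horizontally towards the axis does not
    increase the term in [m]. *)
Lemma lhp_shift_le x s : 0 <= s -> x.1 + s <= 0 -> mb (x.1 + s, x.2) <= mb x.
Proof.
move=> s0 xs; have x0 : x.1 <= 0 by lra.
have [a ha] := lhp_attained H x0; apply: le_trans ha.
apply: le_trans (lhp_lip_le H (x := (x.1 + s, x.2)) (y := (0, a)) xs (lexx _)) _.
rewrite lerD2l /sub2 /= !subr0; apply: (seminorm_le_reflect mP).
by rewrite !ler0_norm //; lra.
Qed.

End LeftConsequences.

(** By the reflection symmetry of [m] and [m'], [mb (0, y.2) <= mb y] and
    [mb (x.1 + y.1, x.2) <= mb x]. *)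
Lemma opposite_subadditive (mb m m' : R * R -> R) x y :
  left_half_plane mb m -> left_half_plane (mb \o @reflR R) m' ->
  x.1 <= 0 -> 0 <= y.1 -> x.1 + y.1 <= 0 -> mb (add2 x y) <= mb x + mb y.
Proof.
move=> HL HR x0 y0 xy.
have [h1 _] := lhp_vertical HL y.2 (add2 x y).
have h2 : mb (0, y.2) <= mb y.
  have := @lhp_axis_le _ _ HR (reflR y); rewrite /= oppr_le0 => /(_ y0).
  by rewrite /= reflRK /reflR /= oppr0.
have h3 := lhp_shift_le HL y0 xy.
apply: le_trans h1 _; rewrite addrC; apply: lerD => //.
by rewrite /sub2 /= subr0 addrK.
Qed.

Section Assembly.
Variables mb m m' : R * R -> R.
Hypotheses (HL : left_half_plane mb m) (HR : left_half_plane (mb \o @reflR R) m').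

Let HLR : left_half_plane ((mb \o @reflR R) \o @reflR R) m.
Proof. by have -> : (mb \o @reflR R) \o @reflR R = mb; [apply/funext => x; rewrite /= reflRK|]. Qed.

Lemma reflR_add x y : reflR (add2 x y) = add2 (reflR x) (reflR y).
Proof. by rewrite /reflR /add2 /= opprD. Qed.

Lemma add2C x y : add2 x y = add2 y x.
Proof. by rewrite /add2 addrC [X in (_, X)]addrC. Qed.

Lemma mixed_subadditive x y : x.1 <= 0 -> 0 <= y.1 -> mb (add2 x y) <= mb x + mb y.
Proof.
move=> x0 y0; have [xy|/ltW xy] := lerP (x.1 + y.1) 0.
  exact: opposite_subadditive HL HR x0 y0 xy.
(* The sum lies on the right; reflection exchanges the two half-planes and the roles of [x] and
   [y]. *)
have := opposite_subadditive (x := reflR y) (y := reflR x) HR HLR.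
rewrite /= oppr_le0 oppr_ge0 -opprD oppr_le0 (addrC y.1) => /(_ y0 x0 xy).
by rewrite -reflR_add !reflRK add2C addrC.
Qed.

Lemma global_subadditive x y : mb (add2 x y) <= mb x + mb y.
Proof.
have [x0|/ltW x0] := lerP x.1 0; have [y0|/ltW y0] := lerP y.1 0.
- exact: lhp_subadditive HL _ _ x0 y0.
- exact: mixed_subadditive.
- by rewrite add2C addrC; exact: mixed_subadditive.
- have := lhp_subadditive HR (x := reflR x) (y := reflR y).
  by rewrite /= !oppr_le0 => /(_ x0 y0); rewrite -reflR_add !reflRK.
Qed.

Lemma right_formula x : 0 <= x.1 -> exists a : R,
  mb x = mb (scal2 a (e2 R)) + m' (sub2 x (scal2 a (e2 R))) /\
  forall b, mb (scal2 a (e2 R)) + m' (sub2 x (scal2 a (e2 R))) <=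
            mb (scal2 b (e2 R)) + m' (sub2 x (scal2 b (e2 R))).
Proof.
move=> x0; have := lhp_formula HR (x := reflR x); rewrite /= oppr_le0 => /(_ x0).
have E b : mb (reflR (scal2 b (e2 R))) = mb (scal2 b (e2 R)).
  by rewrite scal2_e2 /reflR /= oppr0.
have E' b : m' (sub2 (reflR x) (scal2 b (e2 R))) = m' (sub2 x (scal2 b (e2 R))).
  rewrite scal2_e2 -(seminorm_refl (lhp_seminorm HR)); congr m'.
  by rewrite /sub2 /= !subr0 opprK.
move=> [a [h1 h2]]; exists a; split; first by rewrite -[in LHS](reflRK x) h1 E E'.
by move=> b; have := h2 b; rewrite !E !E'.
Qed.

Lemma global_lip x y : `|mb x - mb y| <= (m (1, 0) + m' (1, 0)) * (`|x.1 - y.1| + `|x.2 - y.2|).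
Proof.
have k0 : 0 <= m (1, 0) := seminorm_ge0 (lhp_seminorm HL) _.
have k0' : 0 <= m' (1, 0) := seminorm_ge0 (lhp_seminorm HR) _.
have up z : mb z <= (m (1, 0) + m' (1, 0)) * (`|z.1| + `|z.2|).
  have z0 : 0 <= `|z.1| + `|z.2| by rewrite addr_ge0.
  have [h|/ltW h] := lerP z.1 0.
    apply: le_trans (lhp_le HL h) _; apply: le_trans (seminorm_le (lhp_seminorm HL) z) _.
    by rewrite mulrC ler_wpM2r // lerDl.
  have := lhp_le HR (x := reflR z); rewrite /= oppr_le0 reflRK => /(_ h) h1.
  apply: le_trans h1 _; apply: le_trans (seminorm_le (lhp_seminorm HR) _) _.
  by rewrite /= normrN mulrC ler_wpM2r // lerDr.
have key u v : mb u - mb v <= (m (1, 0) + m' (1, 0)) * (`|u.1 - v.1| + `|u.2 - v.2|).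
  rewrite lerBlDl -{1}(sub2K u v); apply: le_trans (global_subadditive _ _) _.
  by rewrite lerD2l; exact: (up (sub2 u v)).
rewrite ler_norml key andbT lerNl opprB.
by rewrite (distrC x.1) (distrC x.2).
Qed.

Lemma closed_unit_ball : closed [set x | mb x <= 1].
Proof.
have -> : [set x | mb x <= 1] = mb @^-1` [set t | t <= 1] by [].
apply: closed_comp; last exact: closed_le.
by move=> x _; exact: (lipschitz2_continuous global_lip).
Qed.

Lemma convex_unit_ball : convex2 [set x | mb x <= 1].
Proof.
move=> x y t /= hx hy /andP[t0 t1].
have Z s z : 0 <= s -> mb (scal2 s z) = s * mb z.
  rewrite le_eqVlt => /orP[/eqP<-|s0]; last exact: lhpZ HL _ _ s0.
  by rewrite mul0r /scal2 !mul0r; exact: lhp0 HL.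
apply: le_trans (global_subadditive _ _) _; rewrite !Z // ?subr_ge0 //.
have h1 : t * mb x <= t by rewrite ler_piMr.
have h2 : (1 - t) * mb y <= 1 - t by rewrite ler_piMr // subr_ge0.
lra.
Qed.

Lemma closed_scaling (C : set (R * R)) x : closed C ->
  (forall s, 1 < s -> C (scal2 s^-1 x)) -> C x.
Proof.
move=> cC hC; apply: cC => B; rewrite -nbhs_ballE => -[e e0 eB].
pose K := `|x.1| + `|x.2| + 1.
have K0 : 0 < K by rewrite ltr_wpDl // addr_ge0.
pose s := 1 + e / K.
have s1 : 1 < s by rewrite ltrDl divr_gt0.
have s0 : 0 < s by lra.
exists (scal2 s^-1 x); split; first exact: hC.
have small t : `|t| < K -> `|t - s^-1 * t| < e.
  move=> tK; have -> : t - s^-1 * t = t * (e / K) / s.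
    by rewrite /s; field; rewrite !gt_eqF // addr_gt0.
  have sV : 0 < s^-1 by rewrite invr_gt0.
  have eK : 0 < e / K by rewrite divr_gt0.
  rewrite normrM (normrM t) (gtr0_norm sV) (gtr0_norm eK) ltr_pdivrMr //.
  apply: (@lt_le_trans _ _ e); last by rewrite ler_peMr // ltW.
  by rewrite mulrCA -[ltRHS]mulr1 ltr_pM2l // ltr_pdivrMr // mul1r.
apply: eB; split; rewrite -ball_normE /=; apply: small; rewrite /K.
  by have := normr_ge0 x.2; lra.
by have := normr_ge0 x.1; lra.
Qed.

(** For positive [p], [q] of sum 1, u + v is the convex combination of u / p and v / q. Since [p] or
    [q] may vanish, both are increased to reach a total [s > 1], which puts (u + v) / s in [C];
    closedness lets [s] tend to 1. *)
Lemma hull_point (C : set (R * R)) u v (p q : R) : closed C -> convex2 C ->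
  0 <= p -> 0 <= q -> p + q <= 1 ->
  (forall p', 0 < p' -> p <= p' -> C (scal2 p'^-1 u)) ->
  (forall q', 0 < q' -> q <= q' -> C (scal2 q'^-1 v)) -> C (add2 u v).
Proof.
move=> cC cvC p0 q0 pq hu hv; apply: closed_scaling => // s s1.
pose e := (s - p - q) / 2.
have e0 : 0 < e by rewrite divr_gt0 //; lra.
have pe : 0 < p + e by rewrite ltr_wpDl.
have qe : 0 < q + e by rewrite ltr_wpDl.
have s0 : 0 < s by lra.
have sE : s = (p + e) + (q + e) by rewrite /e; field.
have := cvC _ _ ((p + e) / s) (hu _ pe (ler_wpDr (ltW e0) (lexx p)))
  (hv _ qe (ler_wpDr (ltW e0) (lexx q))).
have -> : add2 (scal2 ((p + e) / s) (scal2 (p + e)^-1 u))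
    (scal2 (1 - (p + e) / s) (scal2 (q + e)^-1 v)) = scal2 s^-1 (add2 u v).
  have h1 : 1 - (p + e) / s = (q + e) / s.
    have -> : q + e = s - (p + e) by rewrite {1}sE; ring.
    by rewrite mulrBl divff // gt_eqF.
  rewrite h1 /add2 /scal2 /=; congr (_, _); field; rewrite !gt_eqF //.
apply; apply/andP; split; first by rewrite divr_ge0 // ltW.
by rewrite ler_pdivrMr // mul1r sE lerDl ltW.
Qed.

(** A point of the ball splits at its minimizer into an axis part and a part measured by [m] or
    [m'], whose values add up to at most 1; [hull_point] recombines them. Conversely, the ball is
    closed and convex, and contains the three sets since [mb] lies below [m] and [m'] on their
    half-planes. *)
Lemma hull_unit_ball : [set x : R * R | mb x <= 1] =
  closed_convex_hull
    ([set x : R * R | x.1 <= 0 /\ m x <= 1] `|`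
     [set x : R * R | 0 <= x.1 /\ m' x <= 1] `|`
     [set x : R * R | x.1 = 0 /\ mb (e2 R) * `|x.2| <= 1]).
Proof.
have axis a : mb (0, a) = mb (e2 R) * `|a| by exact: lhp_axisE HL a.
apply/seteqP; split => x /=; last first.
  move=> hull; apply: (hull [set x | mb x <= 1]).
  split; [exact: closed_unit_ball|exact: convex_unit_ball|].
  move=> z [[[z0 hz]|[z0 hz]]|[z0 hz]] /=.
  - exact: le_trans (lhp_le HL z0) hz.
  - have := lhp_le HR (x := reflR z); rewrite /= oppr_le0 reflRK => /(_ z0) h.
    by apply: le_trans h _; rewrite (seminorm_refl (lhp_seminorm HR)).
  - by have -> : z = (0, z.2) by [case: z z0 hz => ? ? /= ->]; rewrite axis.
move=> hx C [cC cvC AC].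
have side (M : R * R -> R) (a : R) : lattice_seminorm M ->
    mb x = mb (0, a) + M (sub2 x (0, a)) ->
    (forall s z, M z <= 1 -> z = scal2 s^-1 (sub2 x (0, a)) -> 0 < s -> C z) -> C x.
  move=> MP hE hC; rewrite -(sub2K x (0, a)).
  apply: (hull_point (p := mb (0, a)) (q := M (sub2 x (0, a)))) => //.
  - exact: lhp_ge0 HL _.
  - exact: seminorm_ge0 MP _.
  - by rewrite -hE.
  - move=> p' p0 hp; apply: AC; right; split; first by rewrite /= mulr0.
    rewrite /= normrM mulrCA -axis gtr0_norm ?invr_gt0 // mulrC.
    by rewrite ler_pdivrMr // mul1r.
  - move=> q' q0 hq; apply: (hC q') => //.
    by rewrite (seminormZ MP) ?invr_gt0 // mulrC ler_pdivrMr // mul1r.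
have [x0|/ltW x0] := lerP x.1 0.
  have [a [hE _]] := lhp_formula HL x0; rewrite scal2_e2 in hE.
  apply: (side m a (lhp_seminorm HL) hE) => s z hz zE s0; apply: AC; left; left; split => //.
  by rewrite zE /= subr0 pmulr_rle0 // invr_gt0.
have [a [hE _]] := right_formula x0; rewrite scal2_e2 in hE.
apply: (side m' a (lhp_seminorm HR) hE) => s z hz zE s0; apply: AC; left; right; split => //.
by rewrite zE /= subr0 pmulr_rge0 // invr_gt0.
Qed.

End Assembly.
End TwoHalfPlanes.

(** * The two half-planes of the inhomogeneous environment *)

Lemma neg_edge_left e : left_edge e -> neg_edge e.
Proof. by rewrite /left_edge /neg_edge => /andP[->]. Qed.

Lemma neg_edge_refl e : left_edge e -> neg_edge (refle e) = false.
Proof.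
case: e => [[a b] [|]]; rewrite /left_edge /neg_edge /refle /reflv /=; lia.
Qed.

Lemma neg_edge_shift k e : neg_edge (shifte (0, k) e) = neg_edge e.
Proof.
by rewrite /neg_edge edge_ends_shift /= !addr0.
Qed.

Lemma neg_edge_refl_shift k e :
  neg_edge (refle (shifte (0, k) e)) = neg_edge (refle e).
Proof.
by case: e => [[a b] [|]]; rewrite /neg_edge /refle /reflv /shifte /shiftv /= !addr0.
Qed.

Theorem theorem3 (R : realType) (d : measure_display) (Omega : measurableType d)
  (P : probability Omega R)
  (* laws F_- and F_+ : probability measures supported on [0, oo) *)
  (nuM nuP : probability R R)
  (* inhomogeneous environment tau, homogeneous environments tauM (F_-), tauP (F_+) *)
  (tau tauM tauP : edge -> Omega -> R)
  (mubar muM muP : R * R -> R) :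
  nuM `[0, +oo[%classic = 1%E -> nuP `[0, +oo[%classic = 1%E ->
  independent_family P tau ->
  (forall e, has_law P (tau e) (if neg_edge e then nuM else nuP)) ->
  independent_family P tauM -> (forall e, has_law P (tauM e) nuM) ->
  independent_family P tauP -> (forall e, has_law P (tauP e) nuP) ->
  (* E Y_- < oo and E Y_+ < oo *)
  (\int[P]_om (Ymin tauM om)%:E < +oo)%E ->
  (\int[P]_om (Ymin tauP om)%:E < +oo)%E ->
  (* mubar(x) = a.s. limit of T(0,nx)/n;  mu_-(x), mu_+(x) = limits in probability
     of T_{F_-}(0,nx)/n, T_{F_+}(0,nx)/n *)
  (forall x, as_time_constant P tau x (mubar x)) ->
  (forall x, prob_time_constant P tauM x (muM x)) ->
  (forall x, prob_time_constant P tauP x (muP x)) ->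
  [/\ (forall x : R * R, x.1 <= 0 ->
         exists a : R,
           mubar x = mubar (scal2 a (e2 R)) + muM (sub2 x (scal2 a (e2 R))) /\
           forall b : R,
             mubar (scal2 a (e2 R)) + muM (sub2 x (scal2 a (e2 R))) <=
             mubar (scal2 b (e2 R)) + muM (sub2 x (scal2 b (e2 R)))),
      (forall x : R * R, 0 <= x.1 ->
         exists a : R,
           mubar x = mubar (scal2 a (e2 R)) + muP (sub2 x (scal2 a (e2 R))) /\
           forall b : R,
             mubar (scal2 a (e2 R)) + muP (sub2 x (scal2 a (e2 R))) <=
             mubar (scal2 b (e2 R)) + muP (sub2 x (scal2 b (e2 R)))),
      (forall x y : R * R, mubar (add2 x y) <= mubar x + mubar y),
      (forall (t : R) (x : R * R), 0 < t -> mubar (scal2 t x) = t * mubar x) &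
      [set x : R * R | mubar x <= 1] =
      closed_convex_hull
        ([set x : R * R | x.1 <= 0 /\ muM x <= 1] `|`
         [set x : R * R | 0 <= x.1 /\ muP x <= 1] `|`
         (* {0} x [-mubar(e2)^-1, mubar(e2)^-1], with 0^-1 = oo *)
         [set x : R * R | x.1 = 0 /\ mubar (e2 R) * `|x.2| <= 1])].
Proof.
move=> posM posP itau ltau itM ltM itP ltP iYM iYP hbar hM hP.
pose nu e := if neg_edge e then nuM else nuP.
have nu_pos e : nu e `[0, +oo[%classic = 1%E by rewrite /nu; case: ifP.
have tight1 (nu0 : probability R R) (b : R) : 0 < b ->
    exists t, forall _ : edge, (nu0 [set x | (t <= x)%R] <= b%:E)%E.
  by move=> /(probability_tail nu0)[t ht]; exists t.
have tight b : 0 < b -> exists t, forall e, (nu e [set x | (t <= x)%R] <= b%:E)%E.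
  move=> b0; have [t ht] := probability_tail nuM b0; have [t' ht'] := probability_tail nuP b0.
  exists (Num.max t t') => e.
  have mono (nu0 : probability R R) s : s <= Num.max t t' ->
      (nu0 [set x | (s <= x)%R] <= b%:E)%E ->
      (nu0 [set x | (Num.max t t' <= x)%R] <= b%:E)%E.
    move=> st; apply: le_trans; apply: le_measure.
    - by rewrite inE; apply: measurable_superlevel; exact: measurable_id.
    - by rewrite inE; apply: measurable_superlevel; exact: measurable_id.
    - by move=> x /=; exact: le_trans.
  by rewrite /nu; case: ifP => _; [apply: mono ht|apply: mono ht'];
    rewrite le_max lexx ?orbT.
have eX := pos_part_env nu_pos itau ltau tight.
have eM := pos_part_env (fun=> posM) itM ltM (tight1 nuM).
have eP := pos_part_env (fun=> posP) itP ltP (tight1 nuP).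
have tX := as_pos_time_const nu_pos itau ltau tight hbar.
have tM := prob_pos_time_const (fun=> posM) itM ltM (tight1 nuM) hM.
have tP := prob_pos_time_const (fun=> posP) itP ltP (tight1 nuP) hP.
have iM := pos_part_integral (fun=> posM) ltM iYM.
have iP := pos_part_integral (fun=> posP) ltP iYP.
have HL : left_half_plane mubar muM.
  apply: environment_left_half_plane eX eM _ _ iM tX tM.
    by move=> e /neg_edge_left; rewrite /nu => ->.
  by move=> k e; rewrite /nu neg_edge_shift.
(* The reflected environment has law [nuP] on every left edge and is still invariant under vertical
   shifts. *)
have HR : left_half_plane (mubar \o @reflR R) muP.
  apply: environment_left_half_plane (env_reindex (aut_edge_inj refl_aut) eX) eP _ _ iP _ tP.
  - by move=> e /neg_edge_refl; rewrite /nu /= => ->.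
  - by move=> k e; rewrite /nu /= neg_edge_refl_shift.
  - apply: (time_const_reindex tX refl_aut) => //; [exact: refl_close|exact: refl_scal].
split.
- by move=> x; exact: lhp_formula HL _.
- by move=> x; exact: right_formula HR _.
- exact: global_subadditive HL HR.
- by move=> t x; exact: lhpZ HL _ _.
- exact: hull_unit_ball HL HR.
Qed.
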